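(* Let $a(z),b(z),c(z)$ be the difference operators \[a(z)=\prod_{i=1}^n\theta(z+x_i)\,\frac{\theta(\lambda+\sum_{l=1}^n(x_l+z_l+\Lambda_l\eta))}{\theta(\lambda)}\,T_\lambda^{-2\eta},\] \[b(z)=-\sum_{i=1}^n\frac{\theta(\lambda+z+x_i)}{\theta(\lambda)}\prod_{j\ne i}\frac{\theta(z+x_j)}{\theta(x_i-x_j)}\,\Delta_+(-x_i)\,T_{x_i}^{-2\eta}T_\lambda^{2\eta},\] \[c(z)=-\sum_{i=1}^n\frac{\theta(-\lambda+z+x_i-2s)}{\theta(\lambda)}\prod_{j\ne i}\frac{\theta(z+x_j)}{\theta(x_i-x_j)}\,\Delta_-(-x_i)\,T_{x_i}^{2\eta}T_\lambda^{-2\eta},\] and let $d(z)$ be the difference operator defined implicitly by \[a(z+2\eta)d(z)-c(z+2\eta)b(z)=\frac{\theta(\lambda-2\eta h)}{\theta(\lambda)}\prod_{i=1}^n\theta(z-z_i-\Lambda_i\eta)\,\theta(z-z_i+\Lambda_i\eta+2\eta),\] where $\eta h$ acts as multiplication by $-\sum_{i=1}^n(x_i+z_i)$. Then $a(z),b(z),c(z),d(z)$, with this $h$, obey the relations of the elliptic quantum group $E_{\tau,\eta}(sl_2)$.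
   Context: Let $\mathrm{Im}\,\tau>0$, $\eta\in\mathbb C\setminus\{0\}$, $\theta(z)=-\sum_{j\in\mathbb Z}\exp(i\pi(j+\frac12)^2\tau+2\pi i(j+\frac12)(z+\frac12))$. Let $z_1,\dots,z_n\in\mathbb C$ be distinct and $\Lambda_1,\dots,\Lambda_n\in\mathbb Z_{\ge0}$. The operators act on meromorphic functions of $n+1$ complex variables $\lambda,x_1,\dots,x_n$; $T_{x_i}^{a}$ and $T_\lambda^{a}$ are the shifts $x_i\mapsto x_i+a$, $\lambda\mapsto\lambda+a$ of the argument: $(T_{x_i}^af)(\lambda,x)=f(\lambda,\dots,x_i+a,\dots)$, $(T_\lambda^af)(\lambda,x)=f(\lambda+a,x)$. Set $\Delta_-(z)=\prod_{i=1}^n\theta(z-z_i+\Lambda_i\eta)$, $\Delta_+(z)=\prod_{i=1}^n\theta(z-z_i-\Lambda_i\eta)$, $s=\sum_{i=1}^n(x_i+z_i)$. Relations of $E_{\tau,\eta}(sl_2)$. Let $V$ have basis $e[1],e[-1]$, $E_{ij}e[k]=\delta_{jk}e[i]$, $h=E_{11}-E_{-1,-1}$ on $V$, \[\alpha(z,\lambda)=\frac{\theta(\lambda+2\eta)\theta(z)}{\theta(\lambda)\theta(z-2\eta)},\qquad\beta(z,\lambda)=-\frac{\theta(\lambda+z)\theta(2\eta)}{\theta(\lambda)\theta(z-2\eta)},\] \[R(z,\lambda)=E_{11}\otimes E_{11}+E_{-1,-1}\otimes E_{-1,-1}+\alpha(z,\lambda)E_{11}\otimes E_{-1,-1}+\alpha(z,-\lambda)E_{-1,-1}\otimes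 E_{11}+\beta(z,\lambda)E_{1,-1}\otimes E_{-1,1}+\beta(z,-\lambda)E_{-1,1}\otimes E_{1,-1}.\] Let $W$ be the space of meromorphic functions of $x_1,\dots,x_n$, on which $h$ acts by multiplication by $-\eta^{-1}\sum_i(x_i+z_i)$. Operators $a(z),b(z),c(z),d(z)$ on meromorphic functions $f$ of $\lambda$ with values in $W$ correspond to an operator $L(z,\lambda)$ on $V\otimes W$ (a difference operator in $x$, with $\lambda$ as a parameter) via: the operator $\tilde L(z)$ with $(\tilde L(z)(v\otimes f))(\lambda)=L(z,\lambda)(v\otimes f(\lambda-2\eta\mu))$ for $hv=\mu v$ satisfies \[\tilde L(z)(e[1]\otimes f)=e[1]\otimes a(z)f+e[-1]\otimes c(z)f,\quad \tilde L(z)(e[-1]\otimes f)=e[1]\otimes b(z)f+e[-1]\otimes d(z)f.\] To obey the relations of $E_{\tau,\eta}(sl_2)$ means that $L(z,\lambda)$ commutes with $h\otimes1+1\otimes h$ and that on $V\otimes V\otimes W$ \[R^{(12)}(z-w,\lambda-2\eta h^{(3)})L^{(13)}(z,\lambda)L^{(23)}(w,\lambda-2\eta h^{(1)})=L^{(23)}(w,\lambda)L^{(13)}(z,\lambda-2\eta h^{(2)})R^{(12)}(z-w,\lambda),\] where superscripts indicate the factors acted upon and $h^{(i)}$ in an argument is replaced by the value of $h$ on the $i$th component of the vector being acted on (for $i=3$: by the multiplication operator $h$ on $W$). *)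

(* Defs.v *)
From mathcomp Require Import all_boot all_order all_algebra.
From mathcomp Require Import all_classical all_reals all_analysis.
From mathcomp Require Import complex.
Import numFieldNormedType.Exports.
Import Order.TTheory GRing.Theory Num.Theory.

Set Implicit Arguments.
Unset Strict Implicit.
Unset Printing Implicit Defensive.

Local Open Scope classical_set_scope.
Local Open Scope ring_scope.

(* [R[i]] typed as a numClosedFieldType, so that the topology and norm that
   MathComp-Analysis puts on every numClosedFieldType are found by inference. *)
Definition Cplx (R : realType) : numClosedFieldType := R[i].

Section MeromorphicFunctions.
Context {K : numFieldType}.

(* [differentiable] is Frechet differentiability over the scalar field; for
   K = Cplx R it is complex differentiability, i.e. holomorphy on an open set.
   A meromorphic function is represented by a total function whose values where
   the denominator vanishes are irrelevant. "h has dense non-vanishing set in U"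
   says that h does not vanish identically on any nonempty open part of U. *)
Definition meromorphic (V : normedModType K) (f : V -> K) : Prop :=
  forall p : V, exists (U : set V) (g h : V -> K),
    [/\ open_nbhs p U,
        forall q, U q -> differentiable g q /\ differentiable h q,
        forall O : set V, open O -> O !=set0 -> O `<=` U ->
          exists2 q, O q & h q != 0
      & forall q, U q -> h q != 0 -> f q = g q / h q].

(* Equality of meromorphic functions: equality of the representatives on a
   dense open set. *)
Definition mero_eq (V : topologicalType) (f g : V -> K) : Prop :=
  exists D : set V, [/\ open D, dense D & forall q, D q -> f q = g q].

End MeromorphicFunctions.

Section Theta.
Context {R : realType}.
Local Notation C := (Cplx R).

Definition ofR (t : R) : C := Complex t 0.
Definition im_unit : C := Complex 0 1.

Definition cexp (z : C) : C :=
  ofR (expR (complex.Re z)) * Complex (cos (complex.Im z)) (sin (complex.Im z)).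

Definition sumZ (u : int -> C) : C :=
  limn (series (fun k : nat => u k%:Z))
  + limn (series (fun k : nat => u (- k.+1%:Z))).

Definition theta (tau z : C) : C :=
  - sumZ (fun j : int =>
      cexp (im_unit * ofR pi * (j%:~R + 2^-1) ^+ 2 * tau
            + 2 * im_unit * ofR pi * (j%:~R + 2^-1) * (z + 2^-1))).

End Theta.

Section DifferenceOperators.
Context {R : realType} {n : nat}.
Local Notation C := (Cplx R).

(* Functions of x = (x_1, ..., x_n), resp. of (lambda, x); the coordinate x_i
   is [x 0 i]. *)
Definition Wfun := 'rV[C]_n -> C.
Definition Mfun := C -> Wfun.

Definition joint (f : Mfun) : C * 'rV[C]_n -> C := fun p => f p.1 p.2.
Definition meroM (f : Mfun) : Prop := meromorphic (joint f).
Definition mero_eqM (f g : Mfun) : Prop := mero_eq (joint f) (joint g).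

Definition Tx (i : 'I_n) (s : C) (f : Mfun) : Mfun :=
  fun l x => f l (x + s *: delta_mx 0 i).
Definition Tl (s : C) (f : Mfun) : Mfun := fun l x => f (l + s) x.

Definition difference_operator (D : Mfun -> Mfun) : Prop :=
  exists (N : nat) (coef : 'I_N -> Mfun) (p : 'I_N -> C)
         (v : 'I_N -> 'rV[C]_n),
    (forall k, meroM (coef k)) /\
    forall f l x, D f l x = \sum_(k < N) coef k l x * f (l + p k) (x + v k).

(* Difference operator in x, acting on functions of x, with lambda as a
   parameter on which its coefficients depend. *)
Definition x_difference_operator (P : C -> Wfun -> Wfun) : Prop :=
  exists (N : nat) (coef : 'I_N -> Mfun) (v : 'I_N -> 'rV[C]_n),
    (forall k, meroM (coef k)) /\
    forall l g x, P l g x = \sum_(k < N) coef k l x * g (x + v k).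

End DifferenceOperators.
Arguments Wfun : clear implicits.
Arguments Mfun : clear implicits.

Section EllipticQuantumGroup.
Context {R : realType} (tau eta : Cplx R) {n : nat}.
Local Notation C := (Cplx R).
Local Notation W := (Wfun R n).
Local Notation M := (Mfun R n).
Local Notation theta := (theta tau).

(* The basis e[1], e[-1] of V is indexed by true, false. A vector of V (x) W is
   its family of components in W, and similarly for V (x) V (x) W. *)
Definition wt (m : bool) : C := if m then 1 else -1.
Definition VW := bool -> W.
Definition VVW := bool -> bool -> W.

Definition tens (m : bool) (g : W) : VW := fun k x => (k == m)%:R * g x.

Definition alpha (z l : C) : C :=
  (theta (l + 2 * eta) * theta z) / (theta l * theta (z - 2 * eta)).
Definition beta (z l : C) : C :=
  - ((theta (l + z) * theta (2 * eta)) / (theta l * theta (z - 2 * eta))).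

(* E_{ij} (x) E_{kl} on V (x) V, where E_{ij} e[k] = delta_{jk} e[i]. *)
Definition EE (i j k l : bool) (u : bool -> bool -> C) : bool -> bool -> C :=
  fun p q => ((p == i) && (q == k))%:R * u j l.

Definition Rmat (z l : C) (u : bool -> bool -> C) : bool -> bool -> C :=
  fun p q =>
    EE true true true true u p q
    + EE false false false false u p q
    + alpha z l * EE true true false false u p q
    + alpha z (- l) * EE false false true true u p q
    + beta z l * EE true false false true u p q
    + beta z (- l) * EE false true true false u p q.

(* In R12, L13 and L23 the dynamical argument depends on x, on the second
   index and on the first index respectively; this accommodates lambda as well
   as lambda - 2 eta h^(3), lambda - 2 eta h^(2) and lambda - 2 eta h^(1). *)
Definition R12 (z : C) (lam : 'rV[C]_n -> C) (F : VVW) : VVW :=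
  fun i j x => Rmat z (lam x) (fun k m => F k m x) i j.
Definition L13 (L : C -> VW -> VW) (lam : bool -> C) (F : VVW) : VVW :=
  fun i j => L (lam j) (fun k => F k j) i.
Definition L23 (L : C -> VW -> VW) (lam : bool -> C) (F : VVW) : VVW :=
  fun i j => L (lam i) (F i) j.

(* (Ltilde L m f)(lambda) = L(lambda)(e[m] (x) f(lambda - 2 eta m)). *)
Definition Ltilde (L : C -> VW -> VW) (m : bool) (f : M) : C -> VW :=
  fun l => L l (tens m (f (l - 2 * eta * wt m))).

Definition x_difference_operatorV (L : C -> VW -> VW) : Prop :=
  exists P : bool -> bool -> C -> W -> W,
    (forall i j, x_difference_operator (P i j)) /\
    forall l F i x, L l F i x = \sum_(j : bool) P i j l (F j) x.

Definition corresponds (L : C -> C -> VW -> VW) (a b c d : C -> M -> M) : Prop :=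
  forall (z : C) (f : M), meroM f ->
    [/\ mero_eqM (fun l => Ltilde (L z) true f l true) (a z f),
        mero_eqM (fun l => Ltilde (L z) true f l false) (c z f),
        mero_eqM (fun l => Ltilde (L z) false f l true) (b z f)
      & mero_eqM (fun l => Ltilde (L z) false f l false) (d z f)].

(* h (x) 1 + 1 (x) h on V (x) W, with h on W the multiplication by [h]. *)
Definition total_h (h : W) (F : VW) : VW := fun i x => (wt i + h x) * F i x.

Definition weight_zero (h : W) (L : C -> C -> VW -> VW) : Prop :=
  forall (z : C) (F : VW), (forall i, meromorphic (F i)) ->
  forall i, mero_eqM (fun l => L z l (total_h h F) i)
                     (fun l => total_h h (L z l F) i).

(* R(z - w, -) is defined only for theta(z - w - 2 eta) <> 0. *)
Definition RLL_relation (h : W) (L : C -> C -> VW -> VW) : Prop :=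
  forall z w : C, theta (z - w - 2 * eta) != 0 ->
  forall F : VVW, (forall i j, meromorphic (F i j)) ->
  forall i j : bool,
    mero_eqM
      (fun l => R12 (z - w) (fun x => l - 2 * eta * h x)
                  (L13 (L z) (fun=> l)
                    (L23 (L w) (fun m => l - 2 * eta * wt m) F)) i j)
      (fun l => L23 (L w) (fun=> l)
                  (L13 (L z) (fun m => l - 2 * eta * wt m)
                    (R12 (z - w) (fun=> l) F)) i j).

Definition obeys_relations (h : W) (a b c d : C -> M -> M) : Prop :=
  exists L : C -> C -> VW -> VW,
    [/\ forall z, x_difference_operatorV (L z),
        corresponds L a b c d,
        weight_zero h L
      & RLL_relation h L].

Section Operators.
Variables (zz : 'I_n -> C) (La : 'I_n -> nat).

Definition Delta_minus (z : C) : C :=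
  \prod_i theta (z - zz i + (La i)%:R * eta).
Definition Delta_plus (z : C) : C :=
  \prod_i theta (z - zz i - (La i)%:R * eta).

Definition ssum (x : 'rV[C]_n) : C := \sum_i (x 0 i + zz i).

Definition hW : W := fun x => - eta^-1 * ssum x.

Definition op_a (z : C) (f : M) : M := fun l x =>
  \prod_i theta (z + x 0 i)
  * (theta (l + \sum_i (x 0 i + zz i + (La i)%:R * eta)) / theta l)
  * Tl (- (2 * eta)) f l x.

Definition op_b (z : C) (f : M) : M := fun l x =>
  - \sum_i (theta (l + z + x 0 i) / theta l
            * \prod_(j | j != i) (theta (z + x 0 j) / theta (x 0 i - x 0 j))
            * Delta_plus (- x 0 i)
            * Tx i (- (2 * eta)) (Tl (2 * eta) f) l x).

Definition op_c (z : C) (f : M) : M := fun l x =>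
  - \sum_i (theta (- l + z + x 0 i - 2 * ssum x) / theta l
            * \prod_(j | j != i) (theta (z + x 0 j) / theta (x 0 i - x 0 j))
            * Delta_minus (- x 0 i)
            * Tx i (2 * eta) (Tl (- (2 * eta)) f) l x).

Definition determinant_eq (d : C -> M -> M) : Prop :=
  forall (z : C) (f : M), meroM f ->
    mero_eqM
      (fun l x => op_a (z + 2 * eta) (d z f) l x
                  - op_c (z + 2 * eta) (op_b z f) l x)
      (fun l x => theta (l - 2 * eta * hW x) / theta l
                  * \prod_i (theta (z - zz i - (La i)%:R * eta)
                             * theta (z - zz i + (La i)%:R * eta + 2 * eta))
                  * f l x).

(* d(z) is the difference operator defined implicitly by [determinant_eq]. *)
Definition is_op_d (d : C -> M -> M) : Prop :=
  (forall z, difference_operator (d z)) /\ determinant_eq d.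

End Operators.
End EllipticQuantumGroup.

(* Main.v *)
From HB Require Import structures.
From Stdlib Require BinInt.
Require Import Defs.
From mathcomp Require Import all_boot all_order all_algebra.
From mathcomp Require Import generic_quotient ring_quotient.
From mathcomp Require Import all_classical all_reals all_analysis.
From mathcomp Require Import complex.
From mathcomp Require Import ring lra zify.
Import numFieldNormedType.Exports.
Import Order.TTheory GRing.Theory Num.Theory.

(** Put h = 2 eta. The operator a(z) multiplies by a function and shifts lambda, so it is
    invertible, and the operator matrix has a Gauss decomposition
      b(z) = a(z) e(z),   c(z) = f(z) a(z),   d(z) = f(z) a(z) e(z) + k(z),
    where e(z) and f(z) are sums over i of a function times the shift of x_i by -h, resp. h,
    and k(z) is a function times a shift of lambda ([opA], [opE], [opF], [opK]). The equation
    that defines d(z) says exactly this: a(z + h) can be cancelled, because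
    c(z + h) b(z) = a(z + h) f(z) a(z) e(z) ([rel_AFA_shifted]), and a(z + h) k(z) is the
    multiplication by the given determinant ([rel_AK_qdet]); see [determinantE].

    For operators of this triangular form the sixteen components of the RLL relation follow,
    by algebra in an additive group alone, from a list of exchange relations between the
    factors at z and at w ([rll_components]). Three kinds of relations occur in the list.
    - Relations with one shift of one x_i. The coefficient of each shift is an instance of
      Fay's three-term identity [th_fay], which comes from the addition formula
      [theta_addition] and a Pluecker relation.
    - The relations [rel_AEAE] and [rel_FAFA], with two shifts. After adding the coefficients
      of the two orders in which x_i and x_j are shifted, they reduce to [pairc_sym].
    - The relations with the commutator of e(z) and f(w). The terms that shift two different
      variables cancel, and the remaining function is a sum over i of residues of a quotient
      of products of theta ([rel_EF_commutator]). The partial fraction expansion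
      [theta_partial_fractions] evaluates that sum ([ef_split], [ef_swap]).

    All these identities hold where some values of theta do not vanish. Operators therefore act
    on the group [QM] of functions modulo those that vanish on a dense open set, and the
    complement of the zeros of an affine pullback of theta has to be dense and open. Density
    ([theta_dense]) is deduced from Fay's identity and the quasi-periods: two zeros p, p'
    force theta (p - p') theta (p + p' - 2 c) = 0 whenever theta c <> 0, which makes a ball of
    zeros grow until it contains a translate of c by a period.

    Each entry of the matrix shifts lambda by a fixed amount ([homogeneous_op_opL]). Hence the
    value at lambda of an entry applied to f depends on one value of f only ([Lx_local]), and the
    dynamical shifts in the RLL relation for L(z, lambda) become compositions of the
    operators a, b, c, d ([Lop_of_comp]). *)

Set Implicit Arguments.
Unset Strict Implicit.
Unset Printing Implicit Defensive.
Local Open Scope ring_scope.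

(** * Unconditionally convergent complex sums *)

Section Norm.
Context {R : realType}.
Local Notation C := (Cplx R).

Definition nm (z : C) : R := Normc.normc z.

Lemma nmE (z : C) : `|z| = ofR (nm z).
Proof. by []. Qed.
Lemma nm_ge0 (z : C) : 0 <= nm z.
Proof. by case: z => a b; rewrite /nm /= sqrtr_ge0. Qed.
Lemma nmD (x y : C) : nm (x + y) <= nm x + nm y.
Proof. exact: (@le_normcD R x y). Qed.
Lemma nmM (x y : C) : nm (x * y) = nm x * nm y.
Proof. exact: Normc.normcM. Qed.
Lemma nmN (x : C) : nm (- x) = nm x.
Proof. exact: normcN. Qed.
Lemma nm0 : nm 0 = 0.
Proof. exact: Normc.normc0. Qed.
Lemma nm1 : nm 1 = 1.
Proof. exact: Normc.normc1. Qed.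
Lemma nm_eq0 (x : C) : nm x = 0 -> x = 0.
Proof. exact: Normc.eq0_normc. Qed.
Lemma nmB (x y : C) : nm (x - y) = nm (y - x).
Proof. by rewrite -opprB nmN. Qed.
Lemma nm_sqr (a b : R) : nm (Complex a b) ^+ 2 = a ^+ 2 + b ^+ 2.
Proof. by rewrite /nm /= sqr_sqrtr // addr_ge0 // sqr_ge0. Qed.
Lemma nm_ReIm (z : C) : nm z <= `|complex.Re z| + `|complex.Im z|.
Proof.
case: z => a b /=.
rewrite -(@ler_pXn2r _ 2) ?nnegrE ?addr_ge0 ?nm_ge0 // nm_sqr.
rewrite sqrrD -!normrX (ger0_norm (sqr_ge0 a)) (ger0_norm (sqr_ge0 b)).
by rewrite lerD2r lerDl mulrn_wge0 // mulr_ge0 // normr_ge0.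
Qed.
Lemma Re_nm (z : C) : `|complex.Re z| <= nm z.
Proof.
case: z => a b /=.
rewrite -(@ler_pXn2r _ 2) ?nnegrE ?addr_ge0 ?nm_ge0 // nm_sqr.
by rewrite -normrX ger0_norm ?sqr_ge0 // lerDl sqr_ge0.
Qed.
Lemma Im_nm (z : C) : `|complex.Im z| <= nm z.
Proof.
case: z => a b /=.
rewrite -(@ler_pXn2r _ 2) ?nnegrE ?addr_ge0 ?nm_ge0 // nm_sqr.
by rewrite -normrX ger0_norm ?sqr_ge0 // lerDr sqr_ge0.
Qed.
Lemma nm_ofR (a : R) : nm (ofR a) = `|a|.
Proof. by rewrite /nm /= expr0n addr0 sqrtr_sqr. Qed.
Lemma nm_sum (I : Type) (J : seq I) (u : I -> C) :
  nm (\sum_(i <- J) u i) <= \sum_(i <- J) nm (u i).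
Proof.
elim: J => [|i J IH]; first by rewrite !big_nil nm0.
rewrite !big_cons; apply: le_trans (nmD _ _) _.
by rewrite lerD2l.
Qed.

End Norm.

Section UnconditionalSums.
Context {R : realType}.
Local Notation C := (Cplx R).

(** The sum of a family in the sense of nets over finite subfamilies: it is insensitive to
    reindexing, which is how theta series are transformed below. *)
Definition hasum (I : eqType) (u : I -> C) (s : C) : Prop :=
  forall eps : R, 0 < eps -> exists J0 : seq I,
    forall J, uniq J -> {subset J0 <= J} -> nm (\sum_(i <- J) u i - s) < eps.

Definition abs_summable (I : eqType) (u : I -> C) : Prop :=
  exists M : R, forall J : seq I, uniq J -> \sum_(i <- J) nm (u i) <= M.

Lemma sum_uniq_split (V : zmodType) (I : eqType) (u : I -> V) (J J' : seq I) :
  uniq J -> uniq J' -> {subset J <= J'} ->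
  \sum_(i <- J') u i = \sum_(i <- J) u i + \sum_(i <- J' | i \notin J) u i.
Proof.
move=> uJ uJ' sub; rewrite (bigID (mem J)) /=; congr (_ + _).
rewrite -big_filter; apply: perm_big; apply: uniq_perm => //.
  exact: filter_uniq.
move=> i; rewrite mem_filter andb_idr //; exact: sub.
Qed.

Lemma sum_uniq_le (I : eqType) (u : I -> R) (J J' : seq I) :
  (forall i, 0 <= u i) -> uniq J -> uniq J' -> {subset J <= J'} ->
  \sum_(i <- J) u i <= \sum_(i <- J') u i.
Proof.
move=> u0 uJ uJ' sub; rewrite (sum_uniq_split u uJ uJ' sub) lerDl.
by apply: sumr_ge0.
Qed.

Lemma real_sum_ex (I : eqType) (u : I -> R) (M : R) :
  (forall i, 0 <= u i) ->
  (forall J, uniq J -> \sum_(i <- J) u i <= M) ->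
  exists s : R, forall eps : R, 0 < eps -> exists J0 : seq I,
    forall J, uniq J -> {subset J0 <= J} -> `|\sum_(i <- J) u i - s| < eps.
Proof.
move=> u0 ub.
pose E := [set x : R | exists2 J, uniq J & x = \sum_(i <- J) u i]%classic.
have hE : has_sup E.
  split; first by exists 0; exists [::]; rewrite ?big_nil.
  by exists M => x [J uJ ->]; exact: ub.
exists (sup E) => eps eps0.
have [x [J0 uJ0 ->] hx] := sup_adherent eps0 hE.
exists J0 => J uJ sub.
have h1 := sum_uniq_le u0 uJ0 uJ sub.
have h2 : \sum_(i <- J) u i <= sup E.
  by apply: ub_le_sup; [exact: hE.2 | exists J].
rewrite ler0_norm ?subr_le0 //; lra.
Qed.

(** Both |u| + u and |u| are nonnegative, and u is their difference. *)
Lemma real_abs_sum_ex (I : eqType) (u : I -> R) (M : R) :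
  (forall J, uniq J -> \sum_(i <- J) `|u i| <= M) ->
  exists s : R, forall eps : R, 0 < eps -> exists J0 : seq I,
    forall J, uniq J -> {subset J0 <= J} -> `|\sum_(i <- J) u i - s| < eps.
Proof.
move=> ub.
have [|J uJ|s1 h1] := @real_sum_ex I (fun i => `|u i| + u i) (M + M).
- by move=> i; have := ler_norm (- u i); rewrite normrN; lra.
- rewrite big_split /=; apply: lerD; first exact: ub.
  apply: le_trans (ub _ uJ); apply: ler_sum => i _; exact: ler_norm.
have [|J uJ|s2 h2] := @real_sum_ex I (fun i => `|u i|) M; [by []|exact: ub|].
exists (s1 - s2) => eps eps0.
have e2 : 0 < eps / 2 by lra.
have [J1 H1] := h1 _ e2; have [J2 H2] := h2 _ e2.
exists (J1 ++ J2) => J uJ sub.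
have s1J : {subset J1 <= J} by move=> i Hi; apply: sub; rewrite mem_cat Hi.
have s2J : {subset J2 <= J} by move=> i Hi; apply: sub; rewrite mem_cat Hi orbT.
have := H1 J uJ s1J; have := H2 J uJ s2J; rewrite big_split /=.
set a := \sum_(i <- J) `|u i|; set b := \sum_(i <- J) u i.
rewrite !ltr_norml => /andP[? ?] /andP[? ?]; apply/andP; split; lra.
Qed.

Lemma abs_summable_ex (I : eqType) (u : I -> C) : abs_summable u -> exists s, hasum u s.
Proof.
move=> [M ub].
have [J uJ|a ha] := @real_abs_sum_ex I (fun i => complex.Re (u i)) M.
  by apply: le_trans (ub _ uJ); apply: ler_sum => i _; exact: Re_nm.
have [J uJ|b hb] := @real_abs_sum_ex I (fun i => complex.Im (u i)) M.
  by apply: le_trans (ub _ uJ); apply: ler_sum => i _; exact: Im_nm.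
exists (Complex a b) => eps eps0.
have e2 : 0 < eps / 2 by lra.
have [J1 H1] := ha _ e2; have [J2 H2] := hb _ e2.
exists (J1 ++ J2) => J uJ sub.
have s1J : {subset J1 <= J} by move=> i Hi; apply: sub; rewrite mem_cat Hi.
have s2J : {subset J2 <= J} by move=> i Hi; apply: sub; rewrite mem_cat Hi orbT.
apply: le_lt_trans (nm_ReIm _) _.
rewrite !raddfB /= (raddf_sum (@complex.Re R : {additive C -> R})).
rewrite (raddf_sum (@complex.Im R : {additive C -> R})) /=.
have := H1 J uJ s1J; have := H2 J uJ s2J; lra.
Qed.

Lemma hasum_uniq (I : eqType) (u : I -> C) s t : hasum u s -> hasum u t -> s = t.
Proof.
move=> hs ht; apply/eqP; rewrite -subr_eq0; apply/eqP/nm_eq0.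
apply/eqP; rewrite eq_le nm_ge0 andbT leNgt; apply/negP => h.
have e2 : 0 < nm (s - t) / 2 by lra.
have [J1 H1] := hs _ e2; have [J2 H2] := ht _ e2.
pose J := undup (J1 ++ J2).
have uJ : uniq J by exact: undup_uniq.
have s1J : {subset J1 <= J} by move=> i Hi; rewrite mem_undup mem_cat Hi.
have s2J : {subset J2 <= J} by move=> i Hi; rewrite mem_undup mem_cat Hi orbT.
have := H1 J uJ s1J; have := H2 J uJ s2J.
set b := \sum_(i <- J) u i => h2 h1.
have : nm (s - t) <= nm (s - b) + nm (b - t).
  by apply: le_trans (nmD _ _); rewrite addrA subrK.
rewrite (nmB s b); lra.
Qed.

Lemma eq_hasum (I : eqType) (u v : I -> C) s : u =1 v -> hasum u s -> hasum v s.
Proof. by move=> /funext ->. Qed.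

Lemma hasumD (I : eqType) (u v : I -> C) s t : hasum u s -> hasum v t ->
  hasum (fun i => u i + v i) (s + t).
Proof.
move=> hs ht eps eps0.
have e2 : 0 < eps / 2 by lra.
have [J1 H1] := hs _ e2; have [J2 H2] := ht _ e2.
exists (J1 ++ J2) => J uJ sub.
have s1J : {subset J1 <= J} by move=> i Hi; apply: sub; rewrite mem_cat Hi.
have s2J : {subset J2 <= J} by move=> i Hi; apply: sub; rewrite mem_cat Hi orbT.
rewrite big_split /= opprD addrACA; apply: le_lt_trans (nmD _ _) _.
have := H1 J uJ s1J; have := H2 J uJ s2J; lra.
Qed.

Lemma hasumZ (I : eqType) (u : I -> C) s (c : C) : hasum u s ->
  hasum (fun i => c * u i) (c * s).
Proof.
move=> hs eps eps0.
have c0 : 0 < nm c + 1 by have := nm_ge0 c; lra.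
have [|J0 H] := hs (eps / (nm c + 1)); first by rewrite divr_gt0.
exists J0 => J uJ sub; rewrite -big_distrr /= -mulrBr nmM.
have := H J uJ sub; rewrite ltr_pdivlMr //; apply: le_lt_trans.
by rewrite mulrC ler_wpM2l ?nm_ge0 // lerDl.
Qed.

Lemma hasumN (I : eqType) (u : I -> C) s : hasum u s ->
  hasum (fun i => - u i) (- s).
Proof.
move=> /(hasumZ (-1)); rewrite mulN1r; apply: eq_hasum => i.
by rewrite mulN1r.
Qed.

(** Terms off the image of f vanish, so finite subfamilies can be pulled back along f. *)
Lemma hasum_inj (I I' : eqType) (f : I' -> I) (u : I -> C) s :
  injective f -> (forall i, (forall i', i != f i') -> u i = 0) ->
  hasum (u \o f) s -> hasum u s.
Proof.
move=> fi u0 hs eps eps0; have [J0 H] := hs _ eps0.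
exists (map f J0) => J uJ sub.
have : exists2 J', uniq J' /\ {subset J0 <= J'} &
  \sum_(i <- J) u i = \sum_(i <- J') (u \o f) i.
  have [J' hJ'] : exists J' : seq I', forall i', (i' \in J') = (f i' \in J).
    clear - fi; elim: J => [|j J [J' IH]]; first by exists [::] => i'.
    have [[i' <-]|no] := pselect (exists i', f i' = j).
      exists (i' :: J') => k; rewrite !inE IH; congr (_ || _).
      by rewrite (inj_eq fi).
    exists J' => k; rewrite IH inE; case: eqP => // e; case: no.
    by exists k.
  pose K := undup J'.
  have uK : uniq K by exact: undup_uniq.
  exists K; first split=> //.
    by move=> i Hi; rewrite mem_undup hJ'; apply: sub; apply: map_f.
  rewrite -(big_map f xpredT u).
  have uf : uniq (map f K) by rewrite map_inj_uniq.
  rewrite (sum_uniq_split u uf uJ); last first.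
    by move=> _ /mapP[k + ->]; rewrite mem_undup hJ'.
  rewrite [X in _ + X]big_seq_cond [X in _ + X]big1 ?addr0 // => i /andP[iJ /negP ni].
  apply: u0 => i'; apply/eqP => e; apply: ni; rewrite e map_f //.
  by rewrite mem_undup hJ' -e.
move=> [J' [uJ' sub'] ->]; exact: H.
Qed.

Lemma hasum_bij (I I' : eqType) (f : I' -> I) (g : I -> I') (u : I -> C) s :
  cancel f g -> cancel g f -> hasum (u \o f) s <-> hasum u s.
Proof.
move=> fK gK; split.
  apply: hasum_inj; first exact: can_inj fK.
  by move=> i /(_ (g i)); rewrite gK eqxx.
move=> hs; apply: (@hasum_inj _ _ g); first exact: can_inj gK.
  by move=> i /(_ (f i)); rewrite fK eqxx.
by apply: eq_hasum hs => i /=; rewrite gK.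
Qed.

(** Extending each half by zero reduces this to the sum of two families. *)
Lemma hasum_part (I I1 I2 : eqType) (f : I1 -> I) (g : I2 -> I) (u : I -> C) s t :
  injective f -> injective g -> (forall i j, f i != g j) ->
  (forall k, (exists i, k = f i) \/ (exists j, k = g j)) ->
  hasum (u \o f) s -> hasum (u \o g) t -> hasum u (s + t).
Proof.
move=> fi gi dis cov hs ht.
(* The indicator of the image of f splits u into two families. *)
pose inf k := `[< exists i, k = f i >].
have h1 : hasum (fun k => if inf k then u k else 0) s.
  apply: (hasum_inj fi); last first.
    by apply: eq_hasum hs => i /=; rewrite /inf asboolT //; exists i.
  move=> k hk; rewrite /inf asboolF // => -[i e].
  by have := hk i; rewrite e eqxx.
have h2 : hasum (fun k => if inf k then 0 else u k) t.
  apply: (hasum_inj gi); last first.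
    apply: eq_hasum ht => i /=; rewrite /inf asboolF // => -[j e].
    by have := dis j i; rewrite e eqxx.
  move=> k hk; rewrite /inf; case: asboolP => // ni.
  case: (cov k) => [//|[j e]]; by have := hk j; rewrite e eqxx.
by apply: eq_hasum (hasumD h1 h2) => k; case: ifP; rewrite ?addr0 ?add0r.
Qed.

Lemma abs_summable_inj (I I' : eqType) (f : I' -> I) (u : I -> C) : injective f ->
  abs_summable u -> abs_summable (u \o f).
Proof.
move=> fi [M hM]; exists M => J uJ.
rewrite -(big_map f xpredT (fun i => nm (u i))); apply: hM.
by rewrite map_inj_uniq.
Qed.

Lemma abs_summable_prod (I J : eqType) (u : I -> C) (v : J -> C) : abs_summable u -> abs_summable v ->
  abs_summable (fun p : I * J => u p.1 * v p.2).
Proof.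
move=> [M hM] [N hN]; exists (M * N) => K uK.
pose K1 := undup (map fst K); pose K2 := undup (map snd K).
pose KK := [seq (i, j) | i <- K1, j <- K2].
have uKK : uniq KK by apply: allpairs_uniq; rewrite ?undup_uniq // => -[? ?] [].
apply: le_trans (sum_uniq_le _ uK uKK _) _.
- by move=> i; exact: nm_ge0.
- move=> [i j] ij; apply/allpairsP; exists (i, j); split=> //=; rewrite mem_undup.
    by apply/mapP; exists (i, j).
  by apply/mapP; exists (i, j).
rewrite big_allpairs /=.
under eq_bigr do (under eq_bigr do rewrite nmM; rewrite -big_distrr /=).
rewrite -big_distrl /=; apply: ler_pM.
- by apply: sumr_ge0 => i _; exact: nm_ge0.
- by apply: sumr_ge0 => i _; exact: nm_ge0.
- exact/hM/undup_uniq.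
- exact/hN/undup_uniq.
Qed.

(** The product family converges unconditionally, so its sum may be computed along rectangles,
    where it factors. *)
Lemma hasum_prod (I J : eqType) (u : I -> C) (v : J -> C) s t :
  abs_summable u -> abs_summable v -> hasum u s -> hasum v t ->
  hasum (fun p : I * J => u p.1 * v p.2) (s * t).
Proof.
move=> su sv hu hv.
have [p hp] := abs_summable_ex (abs_summable_prod su sv).
suff -> : s * t = p by [].
apply/eqP; rewrite -subr_eq0; apply/eqP/nm_eq0.
apply/eqP; rewrite eq_le nm_ge0 andbT leNgt; apply/negP => h.
set d := nm (s * t - p) in h *.
have d2 : 0 < d / 2 by lra.
pose e := Num.min 1 (d / 2 / (nm s + nm t + 1)).
have D0 : 0 < nm s + nm t + 1 by have := nm_ge0 s; have := nm_ge0 t; lra.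
have e0 : 0 < e by rewrite lt_min ltr01 /= !divr_gt0.
have [K0 HK] := hp _ d2; have [I0 HI] := hu _ e0; have [J0 HJ] := hv _ e0.
pose K1 := undup (map fst K0 ++ I0); pose K2 := undup (map snd K0 ++ J0).
pose KK := [seq (i, j) | i <- K1, j <- K2].
have uKK : uniq KK by apply: allpairs_uniq; rewrite ?undup_uniq // => -[? ?] [].
have sKK : {subset K0 <= KK}.
  move=> [i j] ij; apply/allpairsP; exists (i, j); split=> //=; rewrite mem_undup mem_cat.
    by apply/orP; left; apply/mapP; exists (i, j).
  by apply/orP; left; apply/mapP; exists (i, j).
have := HK _ uKK sKK; rewrite big_allpairs /=.
under eq_bigr do rewrite -big_distrr /=; rewrite -big_distrl /=.
have := HI K1 (undup_uniq _); have := HJ K2 (undup_uniq _).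
set a := \sum_(i <- K1) u i; set b := \sum_(j <- K2) v j.
move=> /(_ _)/wrap[|hb]; first by move=> i Hi; rewrite mem_undup mem_cat Hi orbT.
move=> /(_ _)/wrap[|ha]; first by move=> i Hi; rewrite mem_undup mem_cat Hi orbT.
move=> hab.
have : d <= nm (s * t - a * b) + nm (a * b - p).
  by apply: le_trans (nmD _ _); rewrite addrA subrK.
have -> : s * t - a * b = - ((a - s) * (b - t) + (s * (b - t) + (a - s) * t)) by ring.
rewrite nmN => hd.
have hd2 : nm ((a - s) * (b - t) + (s * (b - t) + (a - s) * t)) <=
   e * (nm s + nm t + 1).
  have e1 : e <= 1 by rewrite ge_min lexx.
  apply: le_trans (nmD _ _) _; rewrite [leLHS]addrC [leRHS]mulrDr mulr1.
  apply: lerD; last first.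
    by rewrite nmM -[e]mulr1; apply: ler_pM; rewrite ?nm_ge0 ?ltW // (lt_le_trans hb).
  apply: le_trans (nmD _ _) _; rewrite !nmM mulrDr; apply: lerD.
    by rewrite mulrC ler_wpM2r ?nm_ge0 // ltW.
  by rewrite ler_wpM2r ?nm_ge0 // ltW.
have : e * (nm s + nm t + 1) <= d / 2.
  by rewrite -ler_pdivlMr // ge_min lexx orbT.
lra.
Qed.

Lemma hasum_bound (I : eqType) (u : I -> C) (s : C) (M : R) :
  hasum u s -> (forall J, uniq J -> nm (\sum_(i <- J) u i) <= M) -> nm s <= M.
Proof.
move=> hs hM; rewrite leNgt; apply/negP => h.
have [|J0 H] := hs (nm s - M); first by rewrite subr_gt0.
have := H _ (undup_uniq J0); have := hM _ (undup_uniq J0).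
set a := \sum_(i <- _) _ => h1 /(_ _)/wrap[|h2].
  by move=> i; rewrite mem_undup.
have : nm s <= nm (s - a) + nm a by apply: le_trans (nmD _ _); rewrite subrK.
rewrite (nmB s a); lra.
Qed.

End UnconditionalSums.

(** * The complex exponential and Gaussian series *)

Section ComplexExp.
Context {R : realType}.
Local Notation C := (Cplx R).
Local Notation cexp := (@cexp R).
Local Notation ofR := (@ofR R).
Local Notation im_unit := (@im_unit R).

Lemma ofRD a b : ofR (a + b) = ofR a + ofR b.
Proof. exact: (rmorphD (real_complex R)). Qed.
Lemma ofRM a b : ofR (a * b) = ofR a * ofR b.
Proof. exact: (rmorphM (real_complex R)). Qed.
Lemma ofRN a : ofR (- a) = - ofR a.
Proof. exact: (rmorphN (real_complex R)). Qed.
Lemma ofR1 : ofR 1 = 1.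
Proof. by []. Qed.
Lemma ofR_int (j : int) : ofR j%:~R = j%:~R.
Proof. exact: (rmorph_int (real_complex R)). Qed.
Lemma ofRV2 : ofR 2^-1 = 2^-1.
Proof.
have n2 : (2 : C) != 0 by rewrite pnatr_eq0.
apply: (mulfI n2); rewrite divff //.
have <- : ofR 2 = 2 :> C by exact: (rmorph_nat (real_complex R) 2).
by rewrite -ofRM divff // pnatr_eq0.
Qed.

Lemma cexpD (x y : C) : cexp (x + y) = cexp x * cexp y.
Proof.
case: x => a b; case: y => c d; rewrite /cexp /= expRD cosD sinD.
by apply/eqP; rewrite eq_complex /=; apply/andP; split; apply/eqP; ring.
Qed.
Lemma nm_cexp (x : C) : nm (cexp x) = expR (complex.Re x).
Proof.
rewrite /cexp nmM nm_ofR ger0_norm ?expR_ge0 // -[RHS]mulr1; congr (_ * _).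
have : nm (Complex (cos (complex.Im x)) (sin (complex.Im x)) : C) ^+ 2 = 1.
  by rewrite nm_sqr cos2Dsin2.
move=> /eqP; rewrite sqrf_eq1 => /orP[/eqP//|/eqP h].
by have := nm_ge0 (Complex (cos (complex.Im x)) (sin (complex.Im x)) : C); rewrite h; lra.
Qed.
Lemma cexp0 : cexp 0 = 1.
Proof. by rewrite /cexp /= expR0 cos0 sin0 mulr1. Qed.
Lemma cexp_neq0 x : cexp x != 0.
Proof.
apply/eqP => h; have := nm_cexp x; rewrite h nm0 => e.
by have := expR_gt0 (complex.Re x); rewrite -e ltxx.
Qed.
Lemma cexpN x : cexp (- x) = (cexp x)^-1.
Proof.
by apply: (mulIf (cexp_neq0 x)); rewrite mulVf ?cexp_neq0 // -cexpD addNr cexp0.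
Qed.
Definition ipi : C := im_unit * ofR pi.
Lemma nm_ipi : nm ipi = pi.
Proof.
rewrite /ipi nmM nm_ofR ger0_norm ?pi_ge0 //.
by rewrite -[nm im_unit]/(Num.sqrt (0 ^+ 2 + 1 ^+ 2)) expr0n expr1n add0r sqrtr1 mul1r.
Qed.

Lemma cexp_ipi : cexp ipi = -1.
Proof.
rewrite /cexp /ipi /= !(mul0r, mul1r, subr0, addr0, mulr0, add0r).
rewrite ?oppr0 expR0 cospi sinpi.
by apply/eqP; rewrite eq_complex /= !(mul1r, mul0r, subr0, addr0, mulr0, oppr0) !eqxx.
Qed.
Lemma cexp_2ipi : cexp (2 * ipi) = 1.
Proof. by rewrite mulr_natl mulr2n cexpD cexp_ipi mulrNN mulr1. Qed.
Lemma cexp_2ipi_int (j : int) : cexp (2 * ipi * j%:~R) = 1.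
Proof.
have H (k : nat) : cexp (2 * ipi * k%:R) = 1.
  elim: k => [|k IH]; first by rewrite mulr0 cexp0.
  by rewrite -[k.+1]addn1 natrD mulrDr cexpD IH mulr1 cexp_2ipi mulr1.
case: (intP j) => [|k|k]; first by rewrite mulr0 cexp0.
  exact: H.
by rewrite rmorphN /= mulrN cexpN H invr1.
Qed.

Lemma expRB1_le (a : R) : `|expR a - 1| <= `|a| * expR `|a|.
Proof.
have [a0|a0] := leP 0 a.
  have e1 := expR_ge1Dx a; have e2 := expR_ge1Dx (- a).
  rewrite ger0_norm; last by lra.
  rewrite (ger0_norm a0).
  have : expR a * (1 - a) <= 1.
    by rewrite -[X in _ <= X](@expRxMexpNx_1 R a) ler_wpM2l ?expR_ge0.
  lra.
have e1 := expR_ge1Dx a; have := expR_lt1 a; rewrite a0 => e2.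
rewrite ler0_norm; last by lra.
rewrite (ltr0_norm a0).
have := expR_ge1Dx (- a).
nra.
Qed.

Lemma expRB1a_le (a : R) : `|expR a - 1 - a| <= a ^+ 2 * expR `|a|.
Proof.
have e1 := expR_ge1Dx a; have e2 := expR_ge1Dx (- a).
have e3 : expR a * (1 - a) <= 1.
  by rewrite -[X in _ <= X](@expRxMexpNx_1 R a) ler_wpM2l ?expR_ge0.
rewrite ger0_norm; last by lra.
apply: (@le_trans _ _ (a * (expR a - 1))); first by lra.
apply: le_trans (ler_norm _) _; rewrite normrM -real_normK ?num_real // expr2 -mulrA.
by rewrite ler_wpM2l // expRB1_le.
Qed.

Lemma sin_le (b : R) : `|sin b| <= `|b|.
Proof.
have H (x y : R) : x < y -> `|sin y - sin x| <= `|y - x|.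
  move=> xy; have [|c _ ->] := @MVT R sin cos x y xy.
    exact/continuous_subspaceT/continuous_sin.
  rewrite normrM -[leRHS]mul1r ler_wpM2r // ler_norml.
  by rewrite cos_geN1 cos_le1.
have [h|h|<-] := ltgtP 0 b; last by rewrite sin0.
  by have := H _ _ h; rewrite sin0 !subr0.
by have := H _ _ h; rewrite sin0 !sub0r !normrN.
Qed.

Lemma cosB1_le (b : R) : `|cos b - 1| <= b ^+ 2 / 2.
Proof.
have -> : cos b - 1 = - (2 * sin (b / 2) ^+ 2).
  have : cos b = cos (b / 2 + b / 2) by congr cos; field.
  rewrite cosD -!expr2 => ->; have := cos2Dsin2 (b / 2).
  set c := cos _; set s := sin _; lra.
rewrite normrN ger0_norm; last by rewrite mulr_ge0 // sqr_ge0.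
have : sin (b / 2) ^+ 2 <= (b / 2) ^+ 2.
  rewrite -(real_normK (num_real (sin (b/2)))) -(real_normK (num_real (b/2))).
  by rewrite lerXn2r ?nnegrE // sin_le.
lra.
Qed.

Lemma cosB1_le1 (b : R) : `|cos b - 1| <= `|b|.
Proof.
have h1 := cosB1_le b.
have h2 : `|cos b - 1| <= 2.
  have := cos_geN1 b; have := cos_le1 b => ? ?; rewrite ler0_norm; lra.
have [h|h] := leP `|b| 2; last by lra.
rewrite -(real_normK (num_real b)) in h1.
have := normr_ge0 b; nra.
Qed.

Lemma sinB_le (b : R) : `|sin b - b| <= b ^+ 2.
Proof.
have H (x y : R) : x < y -> x * y <= 0 ->
    `|(sin y - y) - (sin x - x)| <= `|y - x| ^+ 2.
  move=> xy xy0; have [|c cxy ->] := @MVT R (fun t => sin t - t) (fun t => cos t - 1) x y xy.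
    apply: continuous_subspaceT => z; apply: cvgB; [exact: continuous_sin|exact: cvg_id].
  rewrite normrM expr2 ler_wpM2r //.
  apply: le_trans (cosB1_le1 _) _.
  move: cxy; rewrite in_itv /= => /andP[? ?].
  rewrite [leRHS]ger0_norm ?ler_norml; last by lra.
  apply/andP; split; nra.
have [h|h|<-] := ltgtP 0 b; last by rewrite sin0 subrr normr0 expr0n.
  have := H _ _ h; rewrite mul0r sin0 !subr0 => /(_ (lexx _)).
  by rewrite real_normK ?num_real.
have := H _ _ h; rewrite mulr0 sin0 !subr0 => /(_ (lexx _)).
by rewrite !sub0r !normrN real_normK ?num_real.
Qed.

(** Splits exp into modulus and phase; the three summands are bounded by the real estimates
    for exp, cos and sin. *)
Lemma cexp_taylor (y : C) : nm (cexp y - 1 - y) <= 4 * nm y ^+ 2 * expR (nm y).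
Proof.
case: y => a b; set y : C := Complex a b.
have -> : cexp y - 1 - y = ofR (expR a - 1 - a)
   + (ofR (expR a) * (Complex (cos b - 1) (sin b - b) : C)
      + ofR (expR a - 1) * (Complex 0 b : C)).
  rewrite /y /cexp /=.
  by apply/eqP; rewrite eq_complex /=; apply/andP; split; apply/eqP; ring.
have ha : `|a| <= nm y := Re_nm y.
have hb : `|b| <= nm y := Im_nm y.
have r0 := nm_ge0 y; set r := nm y in ha hb r0 *.
have E1 : expR `|a| <= expR r by rewrite ler_expR.
have E2 : expR a <= expR r by rewrite ler_expR (le_trans _ ha) // ler_norm.
have E0 := expR_gt0 `|a|; have Er := expR_gt0 r.
have a2 : a ^+ 2 <= r ^+ 2 by rewrite -(real_normK (num_real a)) lerXn2r ?nnegrE.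
have b2 : b ^+ 2 <= r ^+ 2 by rewrite -(real_normK (num_real b)) lerXn2r ?nnegrE.
have T1 : nm (ofR (expR a - 1 - a)) <= r ^+ 2 * expR r.
  rewrite nm_ofR; apply: le_trans (expRB1a_le a) _.
  by apply: ler_pM => //; rewrite ?sqr_ge0 ?expR_ge0.
have T2 : nm (ofR (expR a) * (Complex (cos b - 1) (sin b - b) : C)) <=
   expR r * (3 / 2 * r ^+ 2).
  rewrite nmM nm_ofR ger0_norm ?expR_ge0 //.
  apply: ler_pM; rewrite ?expR_ge0 ?nm_ge0 //.
  apply: le_trans (nm_ReIm _) _; rewrite /=.
  have := cosB1_le b; have := sinB_le b; lra.
have T3 : nm (ofR (expR a - 1) * (Complex 0 b : C)) <= r * expR r * r.
  rewrite nmM nm_ofR; apply: ler_pM; rewrite ?nm_ge0 //.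
    apply: le_trans (expRB1_le a) _; apply: ler_pM => //; exact: ltW.
  by apply: le_trans (nm_ReIm _) _; rewrite /= normr0 add0r.
apply: le_trans (nmD _ _) _; have := nmD (ofR (expR a) * (Complex (cos b - 1) (sin b - b) : C)) (ofR (expR a - 1) * (Complex 0 b : C)).
nra.
Qed.

End ComplexExp.

Section GaussianSums.
Context {R : realType}.
Local Notation C := (Cplx R).
Local Notation cexp := (@cexp R).
Local Notation ofR := (@ofR R).

Lemma geo_le (r : R) (N : nat) : 0 <= r -> r < 1 ->
  \sum_(k <- iota 0 N) r ^+ k <= (1 - r)^-1.
Proof.
move=> r0 r1.
have -> : \sum_(k <- iota 0 N) r ^+ k = (1 - r ^+ N) / (1 - r).
  elim: N => [|N IH]; first by rewrite big_nil expr0 subrr mul0r.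
  rewrite -addn1 iotaD big_cat /= IH big_seq1 add0n addn1 exprS; field; lra.
rewrite -[leRHS]mul1r ler_wpM2r ?invr_ge0; first lra.
  by lra.
by rewrite lerBlDr lerDl exprn_ge0.
Qed.

Lemma abs_summable_geo (u : int -> C) (M r : R) : 0 <= r -> r < 1 ->
  (forall j : int, nm (u j) <= M * r ^+ absz j) -> abs_summable u.
Proof.
move=> r0 r1 hu.
have M0 : 0 <= M by have := hu 0; rewrite expr0 mulr1; apply: le_trans; exact: nm_ge0.
exists (M * (1 - r)^-1 + M * (1 - r)^-1) => J uJ.
have [N hN] : exists N, forall j, j \in J -> (absz j < N)%N.
  by exists (\max_(j <- J) absz j).+1 => j jJ; rewrite ltnS; apply: leq_bigmax_seq.
pose K := map Posz (iota 0 N) ++ map Negz (iota 0 N).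
have uK : uniq K.
  rewrite cat_uniq !map_inj_uniq ?iota_uniq ?andTb ?andbT //; try by move=> ? ? [].
  apply/hasPn => _ /mapP[k _ ->]; apply/mapP => -[? _ //].
have sK : {subset J <= K}.
  move=> j jJ; have jN := hN _ jJ.
  rewrite mem_cat; case: j jN {jJ} => k kN; apply/orP; [left|right].
    by apply: map_f; rewrite mem_iota.
  by apply: map_f; rewrite mem_iota /= add0n; apply: leq_trans kN; rewrite /= ltnS.
apply: le_trans (sum_uniq_le _ uJ uK sK) _; first by move=> i; exact: nm_ge0.
rewrite big_cat !big_map /=; apply: lerD.
  apply: le_trans (_ : \sum_(k <- iota 0 N) M * r ^+ k <= _).
    by apply: ler_sum => k _; exact: hu.
  by rewrite -big_distrr /= ler_wpM2l // geo_le.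
apply: le_trans (_ : \sum_(k <- iota 0 N) M * r ^+ k <= _).
  apply: ler_sum => k _; apply: le_trans (hu _) _; rewrite ler_wpM2l //=.
  by rewrite exprS ler_piMl ?exprn_ge0 // ltW.
by rewrite -big_distrr /= ler_wpM2l // geo_le.
Qed.

(** The general term of a theta series with characteristic c. *)
Definition gauss_term (al be c : C) (j : int) : C :=
  cexp (al * (j%:~R + c) ^+ 2 + be * (j%:~R + c)).

Lemma nm_gauss_term al be (c : R) j :
  nm (gauss_term al be (ofR c) j) =
  expR (complex.Re al * (j%:~R + c) ^+ 2 + complex.Re be * (j%:~R + c)).
Proof.
rewrite nm_cexp -ofR_int -ofRD; congr expR.
set t := j%:~R + c; rewrite raddfD /= -[X in al * X]/(ofR t ^+ 2) !expr2 -ofRM.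
by case: al => a1 a2; case: be => b1 b2 /=; ring.
Qed.

(** Completing the square: a negative quadratic is eventually below - |t|. *)
Lemma gauss_le (p q t : R) : 0 < p ->
  - p * t ^+ 2 + q * t <= (`|q| + 1) ^+ 2 / (4 * p) - `|t|.
Proof.
move=> p0.
have h : q * t <= `|q| * `|t| by rewrite -normrM ler_norm.
have e : - p * t ^+ 2 = - p * `|t| ^+ 2 by rewrite real_normK ?num_real.
rewrite e; set T := `|t| in h *; set Q := `|q| in h *.
have : 0 <= (2 * p * T - (Q + 1)) ^+ 2 / (4 * p) by rewrite divr_ge0 ?sqr_ge0 // mulr_ge0 // ltW.
have -> : (2 * p * T - (Q + 1)) ^+ 2 / (4 * p) = p * T ^+ 2 - (Q + 1) * T + (Q + 1) ^+ 2 / (4 * p).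
  by field; rewrite gt_eqF.
lra.
Qed.

(** By [gauss_le] the terms are dominated by a geometric sequence. *)
Lemma abs_summable_gauss_term al be (c : R) : complex.Re al < 0 -> abs_summable (gauss_term al be (ofR c)).
Proof.
move=> al0; set p := - complex.Re al; have p0 : 0 < p by rewrite /p; lra.
set q := complex.Re be.
apply: (@abs_summable_geo _ (expR ((`|q| + 1) ^+ 2 / (4 * p) + `|c|)) (expR (-1))).
- exact: expR_ge0.
- by rewrite expR_lt1 ltrN10.
move=> j; rewrite nm_gauss_term -expRM_natl -expRD ler_expR.
have := @gauss_le p q (j%:~R + c) p0; rewrite /p opprK.
have : `|j%:~R| <= `|j%:~R + c| + `|c|.
  by rewrite -{1}[j%:~R](addrK c); apply: le_trans (ler_normB _ _) _.
have -> : `|j%:~R : R| = (absz j)%:R by rewrite -intr_norm -abszE.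
lra.
Qed.

Local Open Scope classical_set_scope.
Lemma series_hasum (u : nat -> C) s : hasum u s -> limn (series u) = s.
Proof.
move=> hs; apply: cvg_lim => //; apply/cvgrPdist_lt => eps eps0.
have [e e0 ->] : exists2 e : R, 0 < e & eps = ofR e.
  case: eps eps0 => a b; rewrite ltcE /= => /andP[/eqP b0 a0].
  by exists a => //; rewrite b0.
have [J0 H] := hs _ e0.
exists (\max_(j <- J0) j).+1 => // n /= hn.
rewrite nmE nmB seriesEnat /= /index_iota subn0 ltcR; apply: H; first exact: iota_uniq.
move=> j jJ; rewrite mem_iota /= add0n; apply: leq_trans hn.
by rewrite ltnS; apply: leq_bigmax_seq.
Qed.

(** Absolute convergence makes the two one-sided limits agree with the unordered sum. *)
Lemma sumZ_hasum (u : int -> C) : abs_summable u -> hasum u (sumZ u).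
Proof.
move=> su.
have [s1 h1] := abs_summable_ex (@abs_summable_inj _ _ _ Posz _ (fun _ _ e => let: erefl := e in erefl) su).
have [s2 h2] := abs_summable_ex (@abs_summable_inj _ _ _ Negz _ (fun _ _ e => let: erefl := e in erefl) su).
have -> : sumZ u = s1 + s2.
  by rewrite /sumZ; congr (_ + _); apply: series_hasum.
apply: (@hasum_part _ _ _ _ Posz Negz) => //; try by move=> ? ? [].
by move=> [k|k]; [left|right]; exists k.
Qed.

End GaussianSums.

(** * The theta function: periods, addition formula, Fay's identity *)

Section Theta.
Context {R : realType} (tau : Cplx R) (tau_gt0 : 0 < complex.Im tau).
Local Notation C := (Cplx R).
Local Notation cexp := (@cexp R).
Local Notation ofR := (@ofR R).
Local Notation ipi := (@ipi R).
Local Notation theta := (theta tau).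

Lemma two_neq0 : (2 : C) != 0. Proof. by rewrite pnatr_eq0. Qed.

Definition theta_term (z : C) : int -> C := gauss_term (ipi * tau) (2 * ipi * (z + 2^-1)) 2^-1.

Lemma Re_ipi_tau (c : C) : complex.Re (ipi * c) = - (pi * complex.Im c).
Proof. by case: c => a b; rewrite /ipi /=; ring. Qed.

Lemma abs_summable_theta_term z : abs_summable (theta_term z).
Proof.
rewrite /theta_term -ofRV2; apply: abs_summable_gauss_term.
by rewrite Re_ipi_tau oppr_lt0 mulr_gt0 // pi_gt0.
Qed.

Lemma theta_hasum z : hasum (theta_term z) (- theta z).
Proof.
rewrite /Defs.theta opprK.
have -> : (fun j : int => cexp (im_unit * ofR pi * (j%:~R + 2^-1) ^+ 2 * tau
            + 2 * im_unit * ofR pi * (j%:~R + 2^-1) * (z + 2^-1))) = theta_term z.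
  by apply/funext => j; rewrite /theta_term /gauss_term /ipi; congr cexp; ring.
by apply: sumZ_hasum; exact: abs_summable_theta_term.
Qed.

Lemma cexp_half (j : int) : cexp (2 * ipi * (j%:~R + 2^-1)) = -1.
Proof.
rewrite mulrDr cexpD cexp_2ipi_int mul1r -cexp_ipi; congr cexp.
by field.
Qed.

(** The reflection j |-> - j - 1 fixes the squares (j + 1/2)^2. *)
Lemma thetaN z : theta (- z) = - theta z.
Proof.
apply: oppr_inj; apply: (hasum_uniq (theta_hasum (- z))).
apply/(@hasum_bij _ _ _ (fun j : int => - j - 1) (fun j : int => - j - 1)).
- by move=> j; lia.
- by move=> j; lia.
apply: eq_hasum (hasumN (theta_hasum z)) => j.
rewrite /theta_term /gauss_term /= -[LHS]mulN1r -(cexp_half (- j - 1)) -cexpD; congr cexp.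
by rewrite rmorphB rmorphN /=; field.
Qed.

Lemma theta0 : theta 0 = 0.
Proof.
have := thetaN 0; rewrite oppr0 => /eqP; rewrite -addr_eq0 -mulr2n -mulr_natl.
by rewrite mulf_eq0 (negPf two_neq0) => /eqP.
Qed.

Lemma theta_p1 z : theta (z + 1) = - theta z.
Proof.
apply: oppr_inj; apply: (hasum_uniq (theta_hasum (z + 1))).
apply: eq_hasum (hasumN (theta_hasum z)) => j.
rewrite /theta_term /gauss_term /= -mulN1r -(cexp_half j) -cexpD; congr cexp.
by field.
Qed.

(** Completing the square turns the shift by tau into j |-> j + 1, up to a factor. *)
Lemma theta_ptau z : exists2 c : C, c != 0 & theta (z + tau) = c * theta z.
Proof.
exists (cexp (- ipi * tau - 2 * ipi * (z + 2^-1))); first exact: cexp_neq0.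
apply: oppr_inj; apply: (hasum_uniq (theta_hasum (z + tau))).
rewrite -mulrN.
have h : hasum (theta_term z \o (fun j : int => j + 1)) (- theta z).
  apply/(@hasum_bij _ _ _ _ (fun j : int => j - 1)); last exact: theta_hasum.
  - by move=> j; lia.
  - by move=> j; lia.
apply: eq_hasum (hasumZ _ h) => j.
rewrite /theta_term /gauss_term /= -cexpD; congr cexp.
by rewrite rmorphD /=; field.
Qed.

(** [theta2_int] and [theta2_half] are the theta series of period 2 tau with characteristics
    0 and 1/2. *)
Definition theta2_int (x : C) := sumZ (gauss_term (2 * ipi * tau) (4 * ipi * x) 0).
Definition theta2_half (x : C) := sumZ (gauss_term (2 * ipi * tau) (4 * ipi * x) 2^-1).

Lemma Re_2ipi_tau : complex.Re (2 * ipi * tau) < 0.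
Proof.
have -> : 2 * ipi * tau = ipi * tau + ipi * tau by ring.
rewrite raddfD /= Re_ipi_tau; have := mulr_gt0 (pi_gt0 R) tau_gt0; lra.
Qed.

Lemma abs_summable_A x : abs_summable (gauss_term (2 * ipi * tau) (4 * ipi * x) 0).
Proof. exact: (@abs_summable_gauss_term R _ _ 0 Re_2ipi_tau). Qed.
Lemma abs_summable_B x : abs_summable (gauss_term (2 * ipi * tau) (4 * ipi * x) 2^-1).
Proof. rewrite -ofRV2; exact: (abs_summable_gauss_term _ _ Re_2ipi_tau). Qed.

(** In the double series put j = a + b and k = a - b - 1 or k = a - b, according to the parity
    of j + k; the quadratic form j^2 + k^2 separates in a and b. *)
Lemma theta_addition x y :
  theta (x + y) * theta (x - y) = theta2_int x * theta2_half y - theta2_half x * theta2_int y.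
Proof.
have hp := hasum_prod (abs_summable_theta_term (x + y)) (abs_summable_theta_term (x - y))
  (theta_hasum (x + y)) (theta_hasum (x - y)).
rewrite mulrNN in hp; apply: (hasum_uniq hp).
have hAB := hasum_prod (abs_summable_A x) (abs_summable_B y) (sumZ_hasum (abs_summable_A x)) (sumZ_hasum (abs_summable_B y)).
have hBA := hasum_prod (abs_summable_B x) (abs_summable_A y) (sumZ_hasum (abs_summable_B x)) (sumZ_hasum (abs_summable_A y)).
apply: (@hasum_part _ _ _ _ (fun p : int * int => (p.1 + p.2, p.1 - p.2 - 1))
  (fun p : int * int => (p.1 + p.2, p.1 - p.2))).
- by move=> [a b] [c d] /= [] h1 h2; congr (_, _); lia.
- by move=> [a b] [c d] /= [] h1 h2; congr (_, _); lia.
- by move=> [a b] [c d] /=; apply/eqP => -[]; lia.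
- move=> [j k]; have [h|h] : ((j + k) %% 2)%Z = 1 \/ ((j + k) %% 2)%Z = 0 by lia.
    by left; exists (((j + k + 1) %/ 2)%Z, ((j - k - 1) %/ 2)%Z); congr (_, _) => /=; lia.
  by right; exists (((j + k) %/ 2)%Z, ((j - k) %/ 2)%Z); congr (_, _) => /=; lia.
- apply: eq_hasum hAB => -[a b] /=; rewrite /theta_term /gauss_term -!cexpD.
  rewrite -[LHS]mulr1 -[X in _ * X = _](cexp_2ipi_int a) -cexpD; congr cexp.
  by rewrite !rmorphB !rmorphD /=; field.
- apply: eq_hasum (hasumN hBA) => -[a b] /=; rewrite /theta_term /gauss_term -!cexpD.
  rewrite -mulN1r -(cexp_half a) -cexpD; congr cexp.
  by rewrite !rmorphB !rmorphD /=; field.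
Qed.

Lemma plucker (K : comRingType) (a1 b1 a2 b2 a3 b3 a4 b4 : K) :
  (a1 * b2 - b1 * a2) * (a3 * b4 - b3 * a4)
  + (a1 * b4 - b1 * a4) * (a2 * b3 - b2 * a3)
  = (a1 * b3 - b1 * a3) * (a2 * b4 - b2 * a4).
Proof. ring. Qed.

(** By [theta_addition] every product of two values is a 2 x 2 minor of one 2 x 4 matrix. *)
Lemma theta_fay p q r m :
  theta (p + q + m) * theta (p - q) * (theta (r + m) * theta r)
  + theta (p + m) * theta p * (theta (q + r + m) * theta (q - r))
  = theta (p + r + m) * theta (p - r) * (theta (q + m) * theta q).
Proof.
have W x y : theta (x + y + m) * theta (x - y) =
    theta2_int (x + m / 2) * theta2_half (y + m / 2) - theta2_half (x + m / 2) * theta2_int (y + m / 2).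
  by rewrite -theta_addition; congr (theta _ * theta _); field.
have W0 x : theta (x + m) * theta x =
    theta2_int (x + m / 2) * theta2_half (m / 2) - theta2_half (x + m / 2) * theta2_int (m / 2).
  by rewrite -theta_addition; congr (theta _ * theta _); field.
rewrite (W p q) (W0 r) (W0 p) (W q r) (W p r) (W0 q).
exact: plucker.
Qed.

(** If theta vanished identically, so would every average over translations by fractions of 1
    with denominator 2^k, which keeps the terms with index divisible by 2^k only. For large k
    all of these but the term of index 0 are negligible. *)
Lemma theta_nontrivial : exists z, theta z != 0.
Proof.
apply: contrapT => /forallNP th0.
have {}th0 z : theta z = 0 by apply/eqP; have := th0 z; case: eqP.
have P (k : nat) z : hasum (fun j => if ((2 ^ k)%:Z %| j)%Z then theta_term z j else 0) 0.
  elim: k z => [|k IH] z.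
    by have := theta_hasum z; rewrite th0 oppr0; apply: eq_hasum => j; rewrite expn0 dvd1z.
  (* Averaging with the translate by 1/2^(k+1) removes the odd multiples of 2^k. *)
  pose e : C := (2 ^ k.+1)%:R; have e0 : e != 0 by rewrite pnatr_eq0 expn_eq0.
  have h := hasumZ (2^-1) (hasumD (IH z) (hasumZ (cexp (- (ipi / e))) (IH (z + e^-1)))).
  rewrite !mulr0 addr0 mulr0 in h; apply: eq_hasum h => j.
  have [/dvdzP[t jt]|nd] := boolP ((2 ^ k)%:Z %| j)%Z; last first.
    rewrite !mulr0 addr0 mulr0; case: ifP => // /dvdzP[t jt]; case/negP: nd.
    by apply/dvdzP; exists (t * 2); rewrite jt expnS PoszM mulrA.
  have -> : cexp (- (ipi / e)) * theta_term (z + e^-1) j = cexp (ipi * t%:~R) * theta_term z j.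
    rewrite /theta_term /gauss_term -!cexpD; congr cexp; rewrite jt /e expnS natrM rmorphM /=.
    have : ((2 ^ k)%N%:R : C) != 0 by rewrite pnatr_eq0 expn_eq0.
    rewrite -[((2 ^ k)%N : int)%:~R]/((2 ^ k)%N%:R); set E := (2 ^ k)%:R => E0.
    by field.
  have -> : ((2 ^ k.+1)%:Z %| j)%Z = (2 %| t)%Z.
    by rewrite jt expnS PoszM dvdz_mul2r // -lt0n expn_gt0.
  have [/dvdzP[t' ->]|nd] := boolP (2 %| t)%Z.
    have -> : ipi * (t' * 2)%:~R = 2 * ipi * t'%:~R by rewrite rmorphM /=; ring.
    by rewrite cexp_2ipi_int; field.
  have [t' ->] : exists t', t = t' * 2 + 1 by exists (t %/ 2)%Z; lia.
  have -> : ipi * (t' * 2 + 1)%:~R = 2 * ipi * (t'%:~R + 2^-1).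
    by rewrite rmorphD rmorphM /=; field.
  by rewrite cexp_half; field.
pose u := theta_term 0.
have u00 : 0 < nm (u 0).
  rewrite lt_neqAle nm_ge0 andbT eq_sym; apply/eqP => /nm_eq0 /eqP.
  by rewrite (negPf (cexp_neq0 _)).
set eps := nm (u 0) in u00.
have [M hM] := abs_summable_theta_term 0.
have e2 : 0 < eps / 4 by lra.
have [s' hs'] := @real_sum_ex R _ (fun j => nm (u j)) M (fun i => nm_ge0 _) hM.
have [J0 H0] := hs' _ e2.
(* Beyond J0 the terms sum to little, and J0 contains no nonzero multiple of 2^k. *)
have [k hk] : exists k : nat, forall j, j \in J0 -> (absz j < 2 ^ k)%N.
  exists (\max_(j <- J0) absz j)%N => j jJ.
  by apply: leq_ltn_trans (ltn_expl _ (ltnSn 1)); apply: leq_bigmax_seq.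
have [J1 H1] := P k 0 _ e2.
pose J := undup (0 :: J0 ++ J1).
have uJ : uniq J := undup_uniq _.
have J0J : {subset J0 <= J} by move=> i iJ; rewrite mem_undup inE mem_cat iJ orbT.
have J1J : {subset J1 <= J} by move=> i iJ; rewrite mem_undup inE mem_cat iJ !orbT.
have zJ : 0 \in J by rewrite mem_undup inE eqxx.
have := H1 J uJ J1J; rewrite subr0 (perm_big _ (perm_to_rem zJ)) big_cons /= dvdz0.
set S := \sum_(j <- rem 0 J) _ => hS.
suff hS2 : nm S < eps / 2.
  have : eps <= nm (theta_term 0 0 + S) + nm S.
    by rewrite /eps -[u 0](addrK S) -(nmN S); exact: nmD.
  lra.
apply: le_lt_trans (nm_sum _ _) _.
have uJ0 : uniq (undup J0) := undup_uniq _.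
have h1 := H0 _ uJ0 (fun i (h : i \in J0) => eq_ind_r is_true h (mem_undup J0 i)).
have := H0 _ uJ J0J.
rewrite (@sum_uniq_split _ _ (fun j => nm (u j)) _ _ uJ0 uJ); last first.
  by move=> i; rewrite mem_undup; exact: J0J.
set T1 := \sum_(i <- _) _ in h1 *; set T2 := (X in T1 + X) => h2.
have : T2 < eps / 2.
  by move: h1 h2; rewrite !ltr_norml => /andP[? ?] /andP[? ?]; lra.
apply: le_lt_trans.
have -> : T2 = nm (if 0 \notin undup J0 then u 0 else 0) + 
   \sum_(j <- rem 0 J) nm (if j \notin undup J0 then u j else 0).
  rewrite -(big_cons _ _ _ _ xpredT (fun j => nm (if j \notin undup J0 then u j else 0))).
  rewrite -(perm_big _ (perm_to_rem zJ)) /T2 big_mkcond /=.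
  by apply: eq_bigr => j _; case: ifP => // _; rewrite nm0.
rewrite -[leLHS]add0r; apply: lerD; first exact: nm_ge0.
rewrite [leLHS]big_seq_cond [leRHS]big_seq_cond; apply: ler_sum => j /andP[jJ _].
case: ifP => [/dvdzP[t jt]|_]; last by rewrite nm0 nm_ge0.
rewrite mem_undup; case: ifP => // /negbFE jJ0.
have := hk _ jJ0; rewrite jt abszM /=.
have : j != 0 by apply/eqP => j0; move: jJ; rewrite j0 mem_rem_uniqF.
rewrite jt mulf_eq0 negb_or => /andP[t0 _].
by rewrite -[X in (_ < X)%N]mul1n ltn_pmul2r ?expn_gt0 // ltnS leqn0 absz_eq0 (negPf t0).
Qed.

End Theta.

(** * Differentiability of theta and density of its non-zeros *)

Opaque Defs.theta Defs.cexp expR pi nm ipi.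

Section ThetaAnalytic.
Context {R : realType} (tau : Cplx R) (tau_gt0 : 0 < complex.Im tau).
Local Notation C := (Cplx R).
Local Notation cexp := (@cexp R).
Local Notation ofR := (@ofR R).
Local Notation ipi := (@ipi R).
Local Notation theta := (theta tau).

Lemma ofR_nat (k : nat) : ofR k%:R = k%:R.
Proof. exact: (rmorph_nat (real_complex R)). Qed.

Lemma hasum_le (I : eqType) (u : I -> C) (w : I -> R) (s : C) (M a : R) :
  0 <= a -> hasum u s -> (forall i, nm (u i) <= a * w i) ->
  (forall J, uniq J -> \sum_(i <- J) w i <= M) -> nm s <= a * M.
Proof.
move=> a0 hs hu hw; apply: (hasum_bound hs) => J uJ.
apply: le_trans (nm_sum _ _) _; apply: le_trans (_ : \sum_(i <- J) a * w i <= _).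
  by apply: ler_sum.
by rewrite -big_distrr /= ler_wpM2l // hw.
Qed.

Lemma sqr_le_expR (x : R) : 0 <= x -> x ^+ 2 <= 2 * expR x.
Proof.
move=> x0; have := @expR_ge1Dxn R x 1 x0; have -> : (1.+1)`!%:R = 2 :> R by []; lra.
Qed.

(** The Taylor remainder of each term is dominated by the same term at shifted arguments,
    because exp (c |t|) is at most exp (c t) + exp (- c t). *)
Lemma theta_taylor z : exists L : C, exists M : R, 0 <= M /\ forall h : C, nm h <= 1 ->
  nm (theta (z + h) - theta z - h * L) <= nm h ^+ 2 * M.
Proof.
pose t (j : int) : C := j%:~R + 2^-1.
pose tr (j : int) : R := j%:~R + 2^-1.
have tE j : t j = ofR (tr j) by rewrite ofRD ofR_int ofRV2.
pose al : C := ipi * tau; pose be : C := 2 * ipi * (z + 2^-1).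
have al0 : complex.Re al < 0 by rewrite Re_ipi_tau oppr_lt0 mulr_gt0 // pi_gt0.
have sP k : abs_summable (gauss_term al (be + ofR k) 2^-1).
  by rewrite -ofRV2; apply: abs_summable_gauss_term.
have gE k j : nm (gauss_term al (be + ofR k) 2^-1 j) = nm (theta_term tau z j) * expR (k * tr j).
  rewrite /theta_term /gauss_term -/(t j) -/al -/be mulrDl addrA cexpD nmM; congr (_ * _).
  by rewrite tE -ofRM nm_cexp.
have [M1 hM1] := sP (4 * pi); have [M2 hM2] := sP (- (4 * pi)).
have Mp : 0 <= M1 + M2.
  by have := hM1 [::] isT; have := hM2 [::] isT; rewrite !big_nil; lra.
have bnd j : nm (theta_term tau z j) * expR (4 * pi * `|tr j|) <=
    nm (gauss_term al (be + ofR (4 * pi)) 2^-1 j) + nm (gauss_term al (be + ofR (- (4 * pi))) 2^-1 j).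
  rewrite (gE (4 * pi) j) (gE (- (4 * pi)) j) -mulrDr ler_wpM2l ?nm_ge0 //.
  have [h|h] := leP 0 (tr j); first by rewrite ger0_norm // lerDl expR_ge0.
  by rewrite ltr0_norm // mulrN -mulNr lerDr expR_ge0.
have nt j : nm (t j) = `|tr j| by rewrite tE nm_ofR.
have n2 : nm (2 : C) = 2.
  by rewrite -(ofR_nat 2) nm_ofR ger0_norm.
have sL : abs_summable (fun j => theta_term tau z j * (2 * ipi * t j)).
  exists (M1 + M2) => J uJ; apply: le_trans (lerD (hM1 J uJ) (hM2 J uJ)).
  rewrite -big_split /=; apply: ler_sum => j _; apply: le_trans (bnd j).
  rewrite nmM ler_wpM2l ?nm_ge0 // (nmM (2 * ipi) (t j)) (nmM 2 ipi) n2 nm_ipi nt.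
  have := expR_ge1Dx (4 * pi * `|tr j|).
  have : 0 <= pi * `|tr j| by rewrite mulr_ge0 ?pi_ge0.
  lra.
have [L hL] := abs_summable_ex sL.
exists (- L), (32 * (M1 + M2)); split=> [|h h1]; first by rewrite mulr_ge0.
have hh : hasum (fun j => theta_term tau z j * (cexp (2 * ipi * h * t j) - 1 - 2 * ipi * h * t j))
   (- theta (z + h) - (- theta z) - h * L).
  apply: eq_hasum (hasumD (hasumD (theta_hasum tau_gt0 (z + h)) (hasumN (theta_hasum tau_gt0 z)))
     (hasumN (hasumZ h hL))) => j.
  rewrite mulrBr mulrBr mulr1; congr (_ - _ - _); last by ring.
  rewrite /theta_term /gauss_term -cexpD -/(t j); congr cexp; ring.
rewrite -nmN.
have -> : - (theta (z + h) - theta z - h * - L) = - theta (z + h) - (- theta z) - h * L.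
  by move: (theta _) (theta _) => a b; ring.
have -> : nm h ^+ 2 * (32 * (M1 + M2)) = (32 * nm h ^+ 2) * (M1 + M2) by ring.
apply: (hasum_le _ hh (w := fun j => nm (gauss_term al (be + ofR (4 * pi)) 2^-1 j)
    + nm (gauss_term al (be + ofR (- (4 * pi))) 2^-1 j))).
- by rewrite mulr_ge0 // sqr_ge0.
- move=> j; rewrite nmM; apply: le_trans (ler_wpM2l (nm_ge0 _) (cexp_taylor _)) _.
  apply: le_trans (ler_wpM2l _ (bnd j)); last by rewrite mulr_ge0 // sqr_ge0.
  rewrite [leRHS]mulrCA ler_wpM2l ?nm_ge0 //.
  have -> : nm (2 * ipi * h * t j) = nm h * (2 * pi * `|tr j|).
    by rewrite (nmM _ (t j)) (nmM _ h) (nmM 2 ipi) n2 nm_ipi nt; ring.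
  set x := 2 * pi * `|tr j|.
  have x0 : 0 <= x by rewrite /x !mulr_ge0 // pi_ge0.
  have -> : 4 * pi * `|tr j| = x + x by rewrite /x; ring.
  rewrite expRD.
  have e1 : expR (nm h * x) <= expR x by rewrite ler_expR ler_piMl.
  have e2 := sqr_le_expR x0.
  rewrite exprMn.
  have -> : 4 * (nm h ^+ 2 * x ^+ 2) * expR (nm h * x) = nm h ^+ 2 * (4 * (x ^+ 2 * expR (nm h * x))) by ring.
  have -> : 32 * nm h ^+ 2 * (expR x * expR x) = nm h ^+ 2 * (4 * (8 * (expR x * expR x))) by ring.
  rewrite ler_wpM2l ?sqr_ge0 // ler_wpM2l //.
  apply: le_trans (_ : 2 * expR x * expR x <= _).
    by apply: ler_pM; rewrite ?sqr_ge0 ?expR_ge0.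
  have := mulr_ge0 (expR_ge0 x) (expR_ge0 x); lra.
- by move=> J uJ; rewrite big_split /=; apply: lerD; [exact: hM1|exact: hM2].
Qed.

Local Open Scope classical_set_scope.
Lemma ofR_eps (eps : C) : 0 < eps -> exists2 e : R, 0 < e & eps = ofR e.
Proof.
case: eps => a b; rewrite ltcE /= => /andP[/eqP b0 a0].
by exists a => //; rewrite b0.
Qed.

Lemma theta_differentiable z : differentiable theta z.
Proof.
apply/derivable1_diffP.
have [L [M [M0 H]]] := theta_taylor z.
apply/cvg_ex; exists L; apply/cvgrPdist_lt => eps /ofR_eps[e e0 ->].
have M1 : 0 < M + 1 by lra.
near=> h.
have h0 : h != 0 by near: h; exact: nbhs_dnbhs_neq.
have hd : `|h| < ofR (Num.min 1 (e / (M + 1))).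
  near: h; apply: dnbhs0_lt; rewrite ltcR lt_min ltr01 /= divr_gt0 //.
rewrite nmE ltcR lt_min in hd; case/andP: hd => hd1 hd2.
have nh : 0 < nm h by rewrite lt_neqAle nm_ge0 andbT eq_sym; apply: contra h0 => /eqP/nm_eq0/eqP.
rewrite nmE ltcR nmB.
have -> : h^-1 *: ((theta \o shift z) (h *: 1) - theta z) - L =
   h^-1 * (theta (z + h) - theta z - h * L).
  rewrite /= -[h *: 1]/(h * 1) mulr1 (addrC h z) -[_ *: _]/(h^-1 * _).
  by rewrite [RHS]mulrBr mulKf.
have := H h (ltW hd1) => Hh.
rewrite nmM -(ltr_pM2l nh) mulrA -nmM divff // nm1 mul1r.
apply: le_lt_trans Hh _; rewrite expr2 -mulrA ltr_pM2l //.
rewrite ltr_pdivlMr // in hd2; apply: le_lt_trans hd2.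
by rewrite ler_wpM2l ?ltW //; lra.
Unshelve. all: by end_near.
Qed.

Lemma theta_nbhs c : theta c != 0 -> exists2 rho : R, 0 < rho &
  forall q, nm (q - c) < rho -> theta q != 0.
Proof.
move=> c0.
have cc : {for c, continuous theta} := differentiable_continuous (theta_differentiable c).
have : \forall q \near c, theta q != 0.
  have tc : 0 < `|theta c| by rewrite normr_gt0.
  move/cvgrPdist_lt: cc => /(_ _ tc); apply: filterS => q.
  by apply: contraTneq => ->; rewrite subr0 ltxx.
move=> /nbhs_normP[eps /= /ofR_eps[e e0 ->] H]; exists e => // q hq.
by apply: H; rewrite /= /ball_ nmE ltcR nmB.
Qed.

Lemma theta_int_shift (m n : int) z : theta z != 0 -> theta (z + m%:~R + n%:~R * tau) != 0.
Proof.
have P1 y : (theta (y + 1) != 0) = (theta y != 0) by rewrite theta_p1 // oppr_eq0.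
have P2 y : (theta (y + tau) != 0) = (theta y != 0).
  by have [c c0 ->] := theta_ptau tau_gt0 y; rewrite mulf_eq0 negb_or c0.
have H1 (k : nat) y : (theta (y + k%:R) != 0) = (theta y != 0).
  elim: k => [|k IH]; first by rewrite addr0.
  by rewrite -[k.+1]addn1 natrD addrA P1.
have H2 (k : nat) y : (theta (y + k%:R * tau) != 0) = (theta y != 0).
  elim: k => [|k IH]; first by rewrite mul0r addr0.
  by rewrite -[k.+1]addn1 natrD mulrDl mul1r addrA P2.
have G1 (k : int) y : (theta (y + k%:~R) != 0) = (theta y != 0).
  case: (intP k) => [|l|l]; [by rewrite addr0|exact: H1|].
  by rewrite -(H1 l.+1 (y + _)) rmorphN /= subrK.
have G2 (k : int) y : (theta (y + k%:~R * tau) != 0) = (theta y != 0).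
  case: (intP k) => [|l|l]; [by rewrite mul0r addr0|exact: H2|].
  by rewrite -(H2 l.+1 (y + _)) rmorphN /= mulNr subrK.
by move=> h; rewrite (G2 n (z + m%:~R)) (G1 m z).
Qed.

Lemma lattice_close (c p : C) : exists m n : int,
  nm (c + m%:~R + n%:~R * tau - p) <= 1 + nm tau.
Proof.
pose w := p - c.
pose y := complex.Im w / complex.Im tau.
pose n := Num.floor y.
pose x := complex.Re w - y * complex.Re tau.
pose m := Num.floor x.
exists m, n.
have -> : c + m%:~R + n%:~R * tau - p = - (ofR (x - m%:~R) + ofR (y - n%:~R) * tau).
  rewrite -[c + _ + _ - p](addrC) /x /y /w -!ofR_int.
  have t0 : complex.Im tau != 0 by rewrite gt_eqF.
  case: (tau) t0 => t1 t2 /= t0; case: (p) => p1 p2; case: (c) => c1 c2.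
  apply/eqP; rewrite eq_complex /=; apply/andP; split; apply/eqP; by rewrite /=; field.
rewrite nmN; apply: le_trans (nmD _ _) _; rewrite nmM !nm_ofR.
have fl (v : R) : `|v - (Num.floor v)%:~R| <= 1.
  rewrite ger0_norm ?subr_ge0 ?ge_floor // lerBlDl.
  by have /ltW := lt_succ_floor v; rewrite intrD addrC.
apply: lerD; first exact: fl.
by rewrite -[leRHS]mul1r ler_wpM2r ?nm_ge0 // fl.
Qed.

(** Fay's identity at p, p' and c, in which two of the three terms contain theta p or theta p'. *)
Lemma theta_zero_pair p p' c : theta c != 0 -> theta p = 0 -> theta p' = 0 ->
  theta (p - p') * theta (p + p' - 2 * c) = 0.
Proof.
move=> c0 hp hp'.
have := theta_fay tau_gt0 (2 * c - p') (c - p') (p - p') (2 * p' - 2 * c).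
have -> : 2 * c - p' + (c - p') + (2 * p' - 2 * c) = c by ring.
have -> : 2 * c - p' - (c - p') = c by ring.
have -> : p - p' + (2 * p' - 2 * c) = p + p' - 2 * c by ring.
have -> : 2 * c - p' + (2 * p' - 2 * c) = p' by ring.
have -> : 2 * c - p' + (p - p') + (2 * p' - 2 * c) = p by ring.
rewrite hp hp' !mul0r addr0 => /eqP; rewrite mulf_eq0 mulf_eq0 (negPf c0) /=.
by rewrite [_ * theta (p - p')]mulrC => /eqP.
Qed.

Definition zball (p : C) (r : R) := forall q, nm (q - p) < r -> theta q = 0.

(** The points of the larger ball are obtained as p1 + p2 - 2 c from two zeros p1, p2 in the
    given ball at distance delta and a point c near c0, using [theta_zero_pair]. *)
Lemma zball_step p r delta c0 rho : 0 < rho -> theta delta != 0 ->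
  (forall q, nm (q - c0) < rho -> theta q != 0) ->
  zball p r -> nm delta < 2 * r ->
  zball (2 * (p - c0)) (2 * r - nm delta + 2 * rho).
Proof.
move=> rho0 d0 hc hz hd q hq.
set w := q - 2 * (p - c0) in hq.
set A := 2 * r - nm delta in hq; have A0 : 0 < A by rewrite /A; lra.
have S0 : 0 < A + 2 * rho by lra.
pose s := ofR (A / (A + 2 * rho)) * w; pose v := ofR (- rho / (A + 2 * rho)) * w.
have sA : nm s < A.
  rewrite nmM nm_ofR ger0_norm ?divr_ge0 ?ltW // mulrAC ltr_pdivrMr //.
  by rewrite ltr_pM2l.
have vr : nm v < rho.
  rewrite nmM nm_ofR mulNr normrN ger0_norm ?divr_ge0 ?ltW // mulrAC ltr_pdivrMr //.
  by rewrite ltr_pM2l.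
have e : s - 2 * v = w.
  rewrite /s /v mulrA -mulrBl -[RHS]mul1r; congr (_ * _).
  rewrite -(ofR_nat 2) -ofRM -ofRN -ofRD -ofR1; congr ofR; field; lra.
have two0 : (2 : C) != 0 := two_neq0.
have n2 : nm (2^-1 : C) = 2^-1 by rewrite -ofRV2 nm_ofR ger0_norm.
have h1 : theta (p + (delta + s) / 2) = 0.
  apply: hz; rewrite addrC addKr nmM n2; have := nmD delta s; rewrite /A in sA; lra.
have h2 : theta (p + (s - delta) / 2) = 0.
  apply: hz; rewrite addrC addKr nmM n2; have := nmD s (- delta); rewrite nmN /A in sA *; lra.
have hcv : theta (c0 + v) != 0 by apply: hc; rewrite addrC addKr.
have := theta_zero_pair hcv h1 h2.
have -> : p + (delta + s) / 2 - (p + (s - delta) / 2) = delta by field.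
have -> : p + (delta + s) / 2 + (p + (s - delta) / 2) - 2 * (c0 + v) = q.
  have -> : q = w + 2 * (p - c0) by rewrite /w subrK.
  by rewrite -e; field.
by move=> /eqP; rewrite mulf_eq0 (negPf d0) => /eqP.
Qed.

Lemma theta_dense p (eps : R) : 0 < eps -> exists2 q, nm (q - p) < eps & theta q != 0.
Proof.
move=> eps0; apply: contrapT => hno.
have Z0 : zball p eps.
  by move=> q hq; apply/eqP; apply: contrapT => /negP hq0; apply: hno; exists q.
have [c0 hc0] := theta_nontrivial tau_gt0.
have [rho rho0 hc] := theta_nbhs hc0.
(* A ball of zeros and a non-zero delta, so small that [zball_step] increases the radius by
   at least rho: if the given ball has no such delta, all small points are zeros, and the
   largest ball of zeros around 0 has non-zeros just outside. *)
have [p0 [r0 [delta [hz d0 hd1 hd2]]]] : exists p0 r0 delta,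
    [/\ zball p0 r0, theta delta != 0, nm delta < 2 * r0 & nm delta < r0 + rho].
  have [[delta [hd d0]]|no] := pselect (exists delta, nm delta < eps /\ theta delta != 0).
    by exists p, eps, delta; split=> //; lra.
  pose E := [set r : R | zball 0 r].
  have Eeps : E eps.
    move=> q; rewrite subr0 => hq; apply/eqP; apply: contrapT => /negP hq0.
    by apply: no; exists q.
  have ubE : ubound E (nm c0).
    move=> r hr; rewrite leNgt; apply/negP => h.
    by move: hc0; rewrite hr ?eqxx // subr0.
  have hsE : has_sup E by split; [exists eps | exists (nm c0)].
  set r0 := sup E.
  have r0e : eps <= r0 by apply: ub_le_sup => //; exists (nm c0).
  have Zr0 : zball 0 r0.
    move=> q hq; have [|r Er hr] := sup_adherent _ hsE (eps := r0 - nm (q - 0)).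
      by rewrite subr_gt0.
    by apply: Er; rewrite opprB addrC subrK in hr.
  have [[delta [hd d0]]|no2] := pselect (exists delta,
      nm delta < r0 + Num.min rho r0 /\ theta delta != 0).
    exists 0, r0, delta; split=> //.
      by apply: lt_le_trans hd _; rewrite mulr_natl mulr2n lerD2l ge_min lexx orbT.
    by apply: lt_le_trans hd _; rewrite lerD2l ge_min lexx.
  have : E (r0 + Num.min rho r0).
    move=> q; rewrite subr0 => hq; apply/eqP; apply: contrapT => /negP hq0.
    by apply: no2; exists q.
  move=> /(ub_le_sup hsE.2); rewrite -/r0 gerDl leNgt lt_min rho0 /=.
  by rewrite (lt_le_trans eps0 r0e).
(* The radius grows by rho at every step, until the ball contains a translate of c0. *)
have big (k : nat) : exists pk, zball pk (r0 + k%:R * rho).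
  elim: k => [|k [pk hk]]; first by exists p0; rewrite mul0r addr0.
  have k0 : 0 <= k%:R * rho by rewrite mulr_ge0 // ltW.
  exists (2 * (pk - c0)) => q hq.
  have := zball_step rho0 d0 hc hk; apply; first by lra.
  apply: lt_le_trans hq _; rewrite -[k.+1]addn1 natrD mulrDl mul1r; lra.
pose k := (Num.truncn ((1 + nm tau - r0) / rho)).+1.
have hk : 1 + nm tau < r0 + k%:R * rho.
  have : (1 + nm tau - r0) / rho < k%:R by exact: truncnS_gt.
  by rewrite ltr_pdivrMr //; lra.
have [pk hpk] := big k.
have [m [n hmn]] := lattice_close c0 pk.
have := theta_int_shift m n hc0; rewrite hpk ?eqxx //.
exact: le_lt_trans hmn hk.
Qed.

End ThetaAnalytic.

Fact th_key : unit. Proof. exact: tt. Qed.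
(** theta, locked so that two of its values are compared through their arguments. *)
Definition th (R : realType) (tau z : Cplx R) : Cplx R :=
  locked_with th_key (theta tau z).

Section LockedTheta.
Context {R : realType} (tau : Cplx R) (tau_gt0 : 0 < complex.Im tau).
Local Notation C := (Cplx R).

Lemma thE : th tau = theta tau.
Proof. by apply/funext => z; rewrite /th unlock. Qed.
Lemma thN (z : C) : th tau (- z) = - th tau z.
Proof. by rewrite thE thetaN. Qed.
Lemma th0 : th tau 0 = 0.
Proof. by rewrite thE theta0. Qed.
Lemma th_fay (p q r m : C) :
  th tau (p + q + m) * th tau (p - q) * (th tau (r + m) * th tau r)
  + th tau (p + m) * th tau p * (th tau (q + r + m) * th tau (q - r))
  = th tau (p + r + m) * th tau (p - r) * (th tau (q + m) * th tau q).
Proof. by rewrite thE theta_fay. Qed.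
Lemma th_dense (p : C) (eps : R) : 0 < eps -> exists2 q : C, nm (q - p) < eps & th tau q != 0.
Proof. by rewrite thE; exact: theta_dense. Qed.
Lemma th_differentiable (z : C) : differentiable (th tau) z.
Proof. by rewrite thE; exact: theta_differentiable. Qed.
End LockedTheta.

(** * Tactics for identities between values of theta *)

Ltac fieldn0 := field; do ?[apply/andP; split]; assumption.
Ltac gen_thetas :=
  repeat match goal with |- context [th ?t ?a] => generalize (th t a); intro end.

(** Carries the weight of the argument of a named value of theta. *)
Definition tagged (k : BinNums.Z) (P : Prop) : Prop := P.
(** Arguments of theta are combinations of variables with small integer coefficients. Giving
    the k-th variable the weight 100^k separates them, so that equal arguments are found by
    comparing weights, and [ring] only confirms. *)
Ltac atom_weights env x := lazymatch x with
  | @GRing.add _ ?p ?q => let env := atom_weights env p in atom_weights env q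
  | @GRing.opp _ ?p => atom_weights env p
  | @GRing.mul _ ?p ?q => let env := atom_weights env p in atom_weights env q
  | @GRing.natmul _ _ _ => env
  | @GRing.zero _ => env
  | _ => lazymatch env with
    | context [pair x _] => env
    | pair (pair _ ?w) _ =>
        let w := eval vm_compute in (BinInt.Z.mul w (BinInt.Z.of_nat 100)) in
        constr:(pair (pair x w) env)
    | _ => constr:(pair (pair x (BinInt.Z.of_nat 1)) env) end
  end.
Ltac weight env x := lazymatch x with
  | @GRing.add _ ?p ?q => let u := weight env p in let v := weight env q in constr:(BinInt.Z.add u v)
  | @GRing.opp _ ?p => let u := weight env p in constr:(BinInt.Z.opp u)
  | @GRing.mul _ ?p ?q => let u := weight env p in let v := weight env q in constr:(BinInt.Z.mul u v)
  | @GRing.natmul _ _ ?m => constr:(BinInt.Z.of_nat m)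
  | @GRing.zero _ => constr:(BinNums.Z0)
  | _ => lazymatch env with context [pair x ?k] => k end
  end.
Ltac th_abs_from env := lazymatch goal with
  | |- context [th ?t ?a] =>
    let env := atom_weights env a in
    let k := weight env a in let k := eval vm_compute in (BinInt.Z.abs k) in
    let v := fresh "v" in let E := fresh "E" in
    remember (th t a) as v eqn:E; change (tagged k (v = th t a)) in E;
    th_abs_from env
  | _ => idtac end.
Ltac th_abs := th_abs_from tt.
Ltac th_same E1 E2 := lazymatch type of E1 with tagged _ (?v1 = th ?t ?a) =>
  lazymatch type of E2 with tagged _ (?v2 = th t ?b) =>
    let e := fresh "e" in assert (e : b = a) by ring;
    let e' := fresh "e" in
    assert (e' : v2 = v1) by exact (etrans E2 (etrans (congr1 (th t) e) (esym E1)));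
    clear e E2; subst v2
  end end.
Ltac th_opposite E1 E2 := lazymatch type of E1 with tagged _ (?v1 = th ?t ?a) =>
  lazymatch type of E2 with tagged _ (?v2 = th t ?b) =>
    let e := fresh "e" in assert (e : b = - a) by ring;
    let e' := fresh "e" in
    assert (e' : v2 = - v1) by (transitivity (th t (- a));
      [exact (etrans E2 (congr1 (th t) e)) | rewrite thN; [congr (- _); exact (esym E1) | assumption]]);
    clear e E2; subst v2
  end end.
Ltac th_forget := repeat match goal with E : tagged _ _ |- _ => clear E end.
Ltac th_merge := repeat match goal with
  E1 : tagged ?k _, E2 : tagged ?k _ |- _ => th_same E1 E2 end; th_forget.
Ltac th_merge_odd := repeat match goal with
  E1 : tagged ?k _, E2 : tagged ?k _ |- _ => first [th_same E1 E2 | th_opposite E1 E2] end; th_forget.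

(** Concludes from an instance of Fay's identity in front of the goal, up to the oddness of
    theta and an overall sign. *)
Ltac by_fay := th_abs; th_merge_odd;
  move=> /eqP; rewrite -subr_eq0 => /eqP;
  let H := fresh "H" in intro H; apply: subr0_eq;
  first [rewrite -H; ring | rewrite -[RHS]oppr0 -H; ring].

Ltac gen_atoms := repeat match goal with
  | |- context [?f ?x] => lazymatch type of x with matrix _ _ _ =>
      lazymatch type of (f x) with Num.ClosedField.sort _ => generalize (f x); intro end end
  | |- context [fun_of_matrix ?x ?i ?j] => generalize (fun_of_matrix x i j); intro
  end.
(** Proves a rational identity between values of theta, whose nonvanishing is assumed in front
    of the goal. *)
Ltac th_solve := gen_atoms; rewrite ?addr0; th_abs; th_merge; intros; fieldn0.
Ltac subst_by e b := revert e; generalize b;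
  let y := fresh "y" in let e' := fresh "e" in intros y e'; subst y.
(** Identifies the values of f at arguments that are equal by [ring]. *)
Ltac f_merge f := repeat match goal with
  | |- context [f ?a ?X] => match goal with
    | |- context [f ?b X] => tryif constr_eq a b then fail else
        (let e := fresh "e" in
        assert (e : f b X = f a X) by (apply: (f_equal (fun y => f y X)); ring);
        subst_by e (f b X))
    end
  end.

Ltac s_merge s := repeat match goal with
  | |- context [s ?a] => match goal with
    | |- context [s ?b] => tryif constr_eq a b then fail else
        (let e := fresh "e" in
        assert (e : s b = s a) by (apply: (congr1 s); ring);
        subst_by e (s b))
    end
  end.

(** * Instances of Fay's identity *)

Section FayIdentities.
Context {R : realType} (tau : Cplx R) (tau_gt0 : 0 < complex.Im tau).
Local Notation C := (Cplx R).
Local Notation theta := (th tau).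

Lemma fay_pf (D X e k : C) :
  theta (X + k) * theta (X + D + e) * theta (k + e) * theta D =
  (theta (D + e) * theta (X + k + e) * theta k * theta (X + D))
  - (theta (k - D) * theta e * theta (X + D + k + e) * theta X).
Proof. by have := th_fay tau_gt0 (D + e) (D - k) (- X - k) (- D + X + k); by_fay. Qed.

Lemma fay_split (a b m s : C) :
  theta (a + m) * theta (b - m - s) * theta (a - b) * theta s =
  (theta (a - b + m) * theta (m + s) * theta (b - s) * theta a)
  - (theta m * theta (a - b + m + s) * theta (a - s) * theta b).
Proof. by have := th_fay tau_gt0 (a - b + m) (a - s) (a - b) (- a + b + s); by_fay. Qed.

Lemma fay_swap (a b l s : C) :
  theta (a - b - l - s) * theta l * theta (a + l) * theta (b - l - s) =
  - (theta (l + a - b) * theta (l + s) * theta (b + l) * theta (a - l - s))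
  + (theta b * theta (a - s) * theta (a - b) * theta (2 * l + s)).
Proof. by have := th_fay tau_gt0 (a - b + l) (- b) (a - b - l - s) (- a + b + s); by_fay. Qed.

Lemma fay_AE (a b h l : C) :
  theta a * theta (b + l) * theta (l + h) * theta (a - b - h) =
  (theta l * theta (a - b) * theta (b + l + h) * theta (a - h))
  + (theta (a - b - l - h) * theta h * theta (a + l) * theta b).
Proof. by have := th_fay tau_gt0 (l) (- a + b + h + l) (- a) (a - b - l); by_fay. Qed.

Lemma fay_AEA (a b h l : C) :
  theta (a + l) * theta (b - h) * theta l * theta (a - b - h) =
  (theta (l + h) * theta (a - b) * theta b * theta (a + l - h))
  - (theta (l + a - b) * theta h * theta (b + l) * theta (a - h)).
Proof. by have := th_fay tau_gt0 (h + l) (b + l) (l) (a - b - h - l); by_fay. Qed.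

Lemma fay_AEAE (b h l p q : C) :
  theta (b + q + l + h) * theta (b + p - h) * theta l * theta (p - q) =
  (theta (l + h + q - p) * theta h * theta (l + b + p) * theta (b + q))
  + (theta (l + h) * theta (p - q - h) * theta (l + b + q) * theta (b + p)).
Proof. by have := th_fay tau_gt0 (h + l - p + q) (b + l + q) (l) (- l + p - q); by_fay. Qed.

Lemma fay_Y1 (a b h l : C) :
  theta (a + l + h) * theta b * theta l * theta (a - b - h) =
  - (theta (l + a - b) * theta h * theta (b + l + h) * theta a)
  + (theta (l + h) * theta (a - b) * theta (l + a) * theta (b + h)).
Proof. by have := th_fay tau_gt0 (a - b + l) (a + l) (l) (- a + b + h - l); by_fay. Qed.

Lemma fay_Y3 (a b h l : C) :
  theta (l + b) * theta (a + h) * theta l * theta (a - b - h) =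
  (theta (a - b - l) * theta h * theta (l + a) * theta (b + h))
  + (theta (l - h) * theta (a - b) * theta (b + l + h) * theta a).
Proof. by have := th_fay tau_gt0 (a - b - l) (- b - h - l) (- l) (- a + b + h + l); by_fay. Qed.

Lemma fay_X1 (L a b h : C) :
  theta (a - L) * theta (b + h) * theta (L + 2 * h) * theta (a - b - h) =
  (theta (a - b - L - 2 * h) * theta h * theta (b - L) * theta (a + h))
  + (theta (L + h) * theta (a - b) * theta (b + 2 * h) * theta (a - L - h)).
Proof. by have := th_fay tau_gt0 (- L + a - b - 2 * h) (- b - 2 * h) (- L - 2 * h) (L - a + b + 3 * h); by_fay. Qed.

Lemma fay_X3 (L a b h : C) :
  theta (a + 2 * h) * theta (b - L - h) * theta (L + 2 * h) * theta (a - b - h) =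
  - (theta (b + 2 * h) * theta (a - L - h) * theta (L + 2 * h + a - b) * theta h)
  + (theta (b - L) * theta (a - b) * theta (L + 3 * h) * theta (a + h)).
Proof. by have := th_fay tau_gt0 (b + 2 * h) (- a + b) (L + 2 * h) (- L + a - b - 3 * h); by_fay. Qed.

Lemma fay_AFA (L a b h : C) :
  theta (b - L) * theta (a + h) * theta L * theta (a - b - h) =
  (theta (L + h) * theta (a - b) * theta a * theta (b - L + h))
  - (theta (L + a - b) * theta h * theta (a - L) * theta (b + h)).
Proof. by have := th_fay tau_gt0 (L + h) (L - a) (L) (- L + a - b - h); by_fay. Qed.

Lemma fay_FAA (L a b h : C) :
  theta b * theta (a - L + h) * theta L * theta (a - b - h) =
  (theta (L - h) * theta (a - b) * theta (a - L) * theta (b + h))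
  + (theta (a - b - L) * theta h * theta a * theta (b - L + h)).
Proof. by have := th_fay tau_gt0 (L - h) (L - a + b) (b) (- L + a - b + h); by_fay. Qed.

Lemma fay_sq (L h l : C) :
  theta (L + h) * theta (L - h) * theta l * theta l =
  (theta (l + h) * theta (l - h) * theta L * theta L)
  + (theta h * theta h * theta (L + l) * theta (L - l)).
Proof. by have := th_fay tau_gt0 (h + l) (h) (L + h) (- 2 * h); by_fay. Qed.

End FayIdentities.

(** * Partial fractions in products of theta *)

Section ThetaIdentities.
Context {R : realType} (tau : Cplx R) (tau_gt0 : 0 < complex.Im tau).
Local Notation C := (Cplx R).
Local Notation theta := (th tau).

Lemma three_term_div (t s1 s2 s3 s4 s5 s6 s7 s8 s9 s10 s11 s12 : C) :
  s1 != 0 -> s2 != 0 -> s3 != 0 -> s4 != 0 ->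
  s5 * s6 * s7 * s2 = s8 * s9 * s3 * s4 - s10 * s11 * s12 * s1 ->
  s7 * s6 / (s3 * s4) * (t * (s5 / s1)) =
  t * (s10 / - s2 / s3 * (s11 * (s12 / s4))) + s8 / s2 * t * (s9 / s1).
Proof.
move=> h1 h2 h3 h4 F.
have -> : s7 * s6 / (s3 * s4) * (t * (s5 / s1)) = t / (s1 * s2 * s3 * s4) * (s5 * s6 * s7 * s2).
  by fieldn0.
by rewrite F; field; rewrite ?oppr_eq0 h1 h2 h3 h4.
Qed.

Section PartialFractions.
Variables (I : eqType) (a b : I -> C).

Definition pf_shift (s : seq I) : C := \sum_(k <- s) (b k - a k).
Definition pf_num (s : seq I) (y : C) : C := \prod_(k <- s) theta (y - a k).
Definition pf_den (s : seq I) (y : C) : C := \prod_(k <- s) theta (y - b k).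
Definition pf_coef (s : seq I) (i : I) : C :=
  pf_num s (b i) / \prod_(k <- s | k != i) theta (b i - b k).

(** Induction on the number of poles: the new factor multiplies every term by a quotient that
    [fay_pf] splits into a term with the old pole and one with the new pole; the new residues
    are collected by the induction hypothesis at the new pole. *)
Lemma theta_partial_fractions (s : seq I) (w : C) : uniq s ->
  (forall i j, i \in s -> j \in s -> i != j -> theta (b i - b j) != 0) ->
  (forall m, (m < size s)%N -> theta (pf_shift (drop m s)) != 0) ->
  (forall i, i \in s -> theta (w - b i) != 0) -> (0 < size s)%N ->
  theta (pf_shift s) * (pf_num s w / pf_den s w) =
  \sum_(i <- s) pf_coef s i * (theta (w - b i + pf_shift s) / theta (w - b i)).
Proof.
elim: s w => [//|i0 s IH] w /= /andP[i0s us] hb hk hw _.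
case: s IH i0s us hb hk hw => [|i1 s'] IH i0s us hb hk hw.
  rewrite /pf_coef /pf_num /pf_den /pf_shift !big_seq1 big_cons big_nil eqxx /= divr1.
  by rewrite (_ : w - b i0 + (b i0 - a i0) = w - a i0); last by ring.
move: (i1 :: s') (isT : (0 < size (i1 :: s'))%N) IH i0s us hb hk hw => {s' i1} s s0 IH i0s us hb hk hw.
have sb i : i \in s -> theta (b i - b i0) != 0.
  move=> si; apply: hb; rewrite ?inE ?si ?eqxx ?orbT //.
  by apply: contraNneq i0s => <-.
have hbs i j : i \in s -> j \in s -> i != j -> theta (b i - b j) != 0.
  by move=> si sj; apply: hb; rewrite inE ?si ?sj orbT.
have hks m : (m < size s)%N -> theta (pf_shift (drop m s)) != 0.
  by move=> ms; apply: (hk m.+1).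
have IHw := IH w us hbs hks (fun i si => hw i (mem_behead (s := i0 :: s) si)) s0.
have IHb : theta (pf_shift s) * (pf_num s (b i0) / pf_den s (b i0)) =
  \sum_(i <- s) pf_coef s i * (theta (b i0 - b i + pf_shift s) / theta (b i0 - b i)).
  apply: IH => // i si; rewrite -opprB thN // oppr_eq0; exact: sb.
have k0 : theta (pf_shift s) != 0 by have := hks 0%N s0; rewrite drop0.
have k1 : theta (pf_shift (i0 :: s)) != 0 by have := hk 0%N isT.
have w0 : theta (w - b i0) != 0 by apply: hw; rewrite inE eqxx.
set k := pf_shift s in IHw IHb k0 *.
set e := b i0 - a i0.
have kE : pf_shift (i0 :: s) = k + e by rewrite /pf_shift big_cons addrC.
rewrite kE in k1 *.
have den0 y : pf_den (i0 :: s) y = theta (y - b i0) * pf_den s y by rewrite /pf_den big_cons.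
have num0 y : pf_num (i0 :: s) y = theta (y - a i0) * pf_num s y by rewrite /pf_num big_cons.
have c0 : pf_coef (i0 :: s) i0 = theta e * (pf_num s (b i0) / pf_den s (b i0)).
  rewrite /pf_coef num0 -mulrA; congr (_ * (_ / _)).
  rewrite big_cons eqxx /= /pf_den big_seq_cond [RHS]big_seq; apply: eq_bigl => i.
  by case: (boolP (i \in s)) => //= si; apply/eqP => ei; move: i0s; rewrite -ei si.
have ci i : i \in s -> pf_coef (i0 :: s) i =
    theta (b i - b i0 + e) / theta (b i - b i0) * pf_coef s i.
  move=> si; rewrite /pf_coef num0 big_cons.
  have -> : i0 != i by apply: contraNneq i0s => ->.
  rewrite invfM /e (_ : b i - b i0 + (b i0 - a i0) = b i - a i0); last by ring.
  by rewrite [LHS]mulrACA.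
rewrite big_cons c0.
have D0 : pf_den s w != 0.
  by rewrite /pf_den prodf_seq_neq0; apply/allP => i si /=; apply: hw; rewrite inE si orbT.
have -> : theta e * (pf_num s (b i0) / pf_den s (b i0)) *
    (theta (w - b i0 + (k + e)) / theta (w - b i0)) =
  \sum_(i <- s) pf_coef s i * (theta (b i0 - b i + k) / theta (b i0 - b i) / theta k *
    (theta e * (theta (w - b i0 + (k + e)) / theta (w - b i0)))).
  under eq_bigr do rewrite !mulrA; rewrite -!mulr_suml.
  under eq_bigr do rewrite -mulrA; rewrite -IHb.
  by move: (pf_num _ _ / _) k0 w0 => t; gen_thetas => ? ?; fieldn0.
rewrite -big_split /= num0 den0.
have -> : theta (k + e) * (theta (w - a i0) * pf_num s w / (theta (w - b i0) * pf_den s w))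
  = theta (k + e) * theta (w - a i0) / (theta k * theta (w - b i0)) * (theta k * (pf_num s w / pf_den s w)).
  by move: (pf_num _ _) (pf_den _ _) D0 k0 w0 => t1 t2; gen_thetas => ? ? ?; fieldn0.
rewrite IHw mulr_sumr; apply: eq_big_seq => i si.
rewrite ci //.
have := fay_pf tau_gt0 (b i - b i0) (w - b i) e k.
rewrite (_ : w - b i + (b i - b i0) + e = w - a i0); last by rewrite /e; ring.
rewrite (_ : w - b i + (b i - b i0) + k + e = w - b i0 + (k + e)); last by ring.
rewrite (_ : w - b i + (b i - b i0) = w - b i0); last by ring.
rewrite (_ : k - (b i - b i0) = b i0 - b i + k); last by ring.
rewrite (_ : w - b i + k + e = w - b i + (k + e)); last by ring.
rewrite (_ : b i0 - b i = - (b i - b i0)); last by ring.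
rewrite thN //.
have hi := hw i (mem_behead (s := i0 :: s) si); have hbi := sb i si.
exact: three_term_div.
Qed.
End PartialFractions.

Local Open Scope classical_set_scope.

Section Differentiable.
Variables (V : normedModType C) (p : V).
Implicit Types f g : V -> C.

Lemma dif_cst (c : C) : differentiable (fun _ : V => c) p.
Proof. exact: differentiable_cst. Qed.
Lemma difM f g : differentiable f p -> differentiable g p ->
  differentiable (fun q => f q * g q) p.
Proof. by move=> df dg; apply: differentiableM. Qed.
Lemma difD f g : differentiable f p -> differentiable g p ->
  differentiable (fun q => f q + g q) p.
Proof. by move=> df dg; apply: differentiableD. Qed.
Lemma difB f g : differentiable f p -> differentiable g p ->
  differentiable (fun q => f q - g q) p.
Proof. by move=> df dg; apply: differentiableB. Qed.
Lemma difV f : f p != 0 -> differentiable f p -> differentiable (fun q => (f q)^-1) p.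
Proof.
by move=> f0 df; apply: (differentiable_comp df (differentiable_Rinv f0)).
Qed.
Lemma dif_theta f : differentiable f p -> differentiable (fun q => theta (f q)) p.
Proof.
by move=> df; apply: (differentiable_comp df (th_differentiable tau_gt0 (f p))).
Qed.
Lemma dif_prod (I : Type) (s : seq I) (P : pred I) (f : I -> V -> C) :
  (forall i, differentiable (f i) p) ->
  differentiable (fun q => \prod_(i <- s | P i) f i q) p.
Proof.
move=> df; elim: s => [|i s IH].
  have -> : (fun q => \prod_(i <- [::] | P i) f i q) = (fun=> 1).
    by apply/funext => q; rewrite big_nil.
  exact: dif_cst.
have -> : (fun q => \prod_(i <- i :: s | P i) f i q) = (fun q =>
    (if P i then f i q else 1) * \prod_(i <- s | P i) f i q).
  by apply/funext => q; rewrite big_cons; case: ifP => // _; rewrite mul1r.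
by apply: difM => //; case: (P i) => //; exact: dif_cst.
Qed.
Lemma dif_sum (I : Type) (s : seq I) (P : pred I) (f : I -> V -> C) :
  (forall i, differentiable (f i) p) ->
  differentiable (fun q => \sum_(i <- s | P i) f i q) p.
Proof.
move=> df; elim: s => [|i s IH].
  have -> : (fun q => \sum_(i <- [::] | P i) f i q) = (fun=> 0).
    by apply/funext => q; rewrite big_nil.
  exact: dif_cst.
have -> : (fun q => \sum_(i <- i :: s | P i) f i q) = (fun q =>
    (if P i then f i q else 0) + \sum_(i <- s | P i) f i q).
  by apply/funext => q; rewrite big_cons; case: ifP => // _; rewrite add0r.
by apply: difD => //; case: (P i) => //; exact: dif_cst.
Qed.
Lemma dif_near f : differentiable f p -> f p != 0 -> \forall q \near p, f q != 0.
Proof.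
move=> df f0; have tc : 0 < `|f p| by rewrite normr_gt0.
move/cvgrPdist_lt: (differentiable_continuous df) => /(_ _ tc); apply: filterS => q.
by apply: contraTneq => ->; rewrite subr0 ltxx.
Qed.
End Differentiable.

Lemma dif_id (p : C) : differentiable (fun q : C => q) p.
Proof. by []. Qed.

(** The non-zeros of theta accumulate at every point. *)
Lemma dif_dense (f : C -> C) (h0 : C) : differentiable f h0 ->
  (\forall h \near h0, theta h != 0 -> f h = 0) -> f h0 = 0.
Proof.
move=> cf H; apply/eqP; apply: contrapT => /negP f0.
have HH : \forall h \near h0, (theta h != 0 -> f h = 0) /\ f h != 0.
  by apply: filterI; [exact: H|exact: (dif_near cf f0)].
move: HH => /nbhs_normP[eps /= /ofR_eps[e e0 ->] He].
have [q hq tq] := th_dense tau_gt0 h0 e0.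
have [|h1 /eqP h2] := He q; first by rewrite /= /ball_ nmE ltcR nmB.
exact/h2/h1.
Qed.

Lemma near_fin (T : topologicalType) (p : T) (I : finType) (P : I -> T -> Prop) :
  (forall i, \forall q \near p, P i q) -> \forall q \near p, forall i, P i q.
Proof.
move=> H; have : \forall q \near p, forall i, i \in enum I -> P i q.
  elim: (enum I) => [|i s IH]; first by apply: nearW.
  apply: filterS2 (H i) IH => q Pi Ps j; rewrite inE => /orP[/eqP->//|]; exact: Ps.
by apply: filterS => q Hq i; apply: Hq; rewrite mem_enum.
Qed.

Ltac dif_auto := repeat lazymatch goal with
  | |- differentiable (fun _ => ?c) _ => exact: dif_cst
  | |- differentiable (fun q => q) _ => exact: dif_id
  | |- differentiable (fun q => GRing.add (@?f q) (GRing.opp (@?g q))) _ => apply: (@difB _ _ f g)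
  | |- differentiable (fun q => GRing.add (@?f q) (@?g q)) _ => apply: (@difD _ _ f g)
  | |- differentiable (fun q => GRing.mul (@?f q) (@?g q)) _ => apply: (@difM _ _ f g)
  | |- differentiable (fun q => GRing.inv (@?f q)) _ => apply: (@difV _ _ f)
  | |- differentiable (fun q => th _ (@?f q)) _ => apply: (@dif_theta _ _ f)
  | |- differentiable (fun q => bigop _ _ (fun i => BigBody i GRing.add _ (@?f i q))) _ =>
      apply: (@dif_sum _ _ _ _ _ f) => ?
  | |- differentiable (fun q => bigop _ _ (fun i => BigBody i GRing.mul _ (@?f i q))) _ =>
      apply: (@dif_prod _ _ _ _ _ f) => ?
  end.

Lemma split_div (a b m s : C) : theta a != 0 -> theta b != 0 ->
  theta s * theta (a - b) * (theta (a + m) * theta (b - m - s) / (theta a * theta b)) =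
  theta (a - b + m) * theta (m + s) * (theta (b - s) / theta b)
  - theta m * theta (a - b + m + s) * (theta (a - s) / theta a).
Proof.
move=> a0 b0; have := fay_split tau_gt0 a b m s; move: a0 b0; gen_thetas => a0 b0 F.
have -> : forall p q r t u v : C, p * q * (r * t / (u * v)) = r * t * q * p / (u * v).
  by move=> *; ring.
by rewrite F; fieldn0.
Qed.

Lemma swap_div (a b l s : C) : theta a != 0 -> theta b != 0 ->
  theta (a - b - l - s) * theta l * (theta (a + l) * theta (b - l - s) / (theta a * theta b))
  + theta (l + a - b) * theta (l + s) * (theta (b + l) * theta (a - l - s) / (theta b * theta a))
  = theta (a - b) * theta (2 * l + s) * (theta (a - s) / theta a).
Proof.
move=> a0 b0; have := fay_swap tau_gt0 a b l s; move: a0 b0; gen_thetas => a0 b0 F.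
have -> : forall p q r t u v : C, p * q * (r * t / (u * v)) = p * q * r * t / (u * v).
  by move=> *; ring.
by rewrite F; fieldn0.
Qed.

Section PairedPoles.
Variables (n : nat) (x zz t : 'I_n -> C).

Definition pole_num (h y : C) : C :=
  \prod_k (theta (y - zz k - t k) * theta (y - zz k + t k + h)).
Definition resP (h : C) (i : 'I_n) : C :=
  pole_num h (- x i) / \prod_(j | j != i) (theta (x i - x j) * theta (x i - h - x j)).
Definition resM (h : C) (i : 'I_n) : C :=
  pole_num h (- x i - h) / \prod_(j | j != i) (theta (x i - x j) * theta (x i + h - x j)).
Definition polesH (h w : C) : C :=
  pole_num h w / \prod_k (theta (w + x k) * theta (w + x k + h)).

Definition sig : C := 2 * \sum_i (x i + zz i).

Definition half_gap (k : 'I_n * bool) : C := - (x k.1 + zz k.1) + (if k.2 then t k.1 else - t k.1).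
(** Sums of pole minus zero over the last factors, which the expansion divides by. *)
Definition kap (m : nat) : C := \sum_(k <- drop m (enum {: 'I_n * bool})) half_gap k.

Hypothesis kap_neq0 : forall m, (m < #|{: 'I_n * bool}|)%N -> theta (kap m) != 0.
Hypothesis x_neq0 : forall i j, i != j -> theta (x i - x j) != 0.

Lemma kap0 : kap 0 = - sig.
Proof.
rewrite /kap drop0 big_enum /= (eq_bigr (fun k => half_gap (k.1, k.2))); last by move=> [].
rewrite -(pair_bigA _ (fun i b => half_gap (i, b))) /= /sig mulr_sumr -sumrN.
by apply: eq_bigr => i _; rewrite big_bool /half_gap /=; ring.
Qed.

(** The partial fraction expansion with poles - x_i and - x_i - h and zeros z_i + t_i and
    z_i - t_i - h. The division by theta h comes from the two members of a pair. *)
Lemma paired_poles_generic (h w : C) : theta h != 0 ->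
  (forall i, theta (w + x i) != 0) -> (forall i, theta (w + x i + h) != 0) ->
  (forall i j, i != j -> theta (x i - h - x j) != 0) ->
  (forall i j, i != j -> theta (x i + h - x j) != 0) ->
  \sum_i (resP h i * (theta (w + x i - sig) / theta (w + x i))
     - resM h i * (theta (w + x i + h - sig) / theta (w + x i + h)))
  = theta h * theta (- sig) * polesH h w.
Proof.
move=> th wx wxh xm xp.
have [n0|n0] := posnP n.
  have ord : 'I_n -> False by rewrite n0 => -[].
  rewrite /sig !big1 ?mulr0 ?oppr0 ?th0 ?mulr0 ?mul0r // => i; by case: (ord i).
pose b (k : 'I_n * bool) : C := - x k.1 - (if k.2 then h else 0).
pose a (k : 'I_n * bool) : C := zz k.1 + (if k.2 then - t k.1 - h else t k.1).
have bw k : w - b k = w + x k.1 + (if k.2 then h else 0) by rewrite /b; ring.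
have sh m : pf_shift a b (drop m (enum {: 'I_n * bool})) = kap m.
  by apply: eq_bigr => -[i []] _; rewrite /a /b /half_gap /=; ring.
have := @theta_partial_fractions _ a b (enum {: 'I_n * bool}) w (enum_uniq _).
rewrite -cardE; move=> /(_ _)/wrap[|].
  move=> [i c] [j d] _ _; rewrite /b /=; have [<-|ij] := eqVneq i j.
    rewrite xpair_eqE eqxx /=; case: c d => -[] //= _.
      by rewrite (_ : _ - _ - _ = - h); [rewrite thN // oppr_eq0|ring].
    by rewrite (_ : _ - _ - _ = h); last by ring.
  move=> _; case: c d => -[] //=.
  - by rewrite (_ : _ - _ - _ = - (x i - x j)); [rewrite thN // oppr_eq0 x_neq0|ring].
  - by rewrite (_ : _ - _ - _ = - (x i + h - x j)); [rewrite thN // oppr_eq0 xp|ring].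
  - by rewrite (_ : _ - _ - _ = - (x i - h - x j)); [rewrite thN // oppr_eq0 xm|ring].
  - by rewrite (_ : _ - _ - _ = - (x i - x j)); [rewrite thN // oppr_eq0 x_neq0|ring].
move=> /(_ _)/wrap[|]; first by move=> m hm; rewrite sh kap_neq0.
move=> /(_ _)/wrap[|].
  by move=> [i []] _; rewrite bw /= ?addr0.
move=> /(_ _)/wrap[|]; first by rewrite card_prod card_ord card_bool muln_gt0 n0.
have -> : pf_shift a b (enum {: 'I_n * bool}) = - sig by rewrite -kap0 -sh drop0.
have numE y : pf_num a (enum {: 'I_n * bool}) y = pole_num h y.
  rewrite /pf_num big_enum /= (eq_bigr (fun k => theta (y - a (k.1, k.2)))); last by move=> [].
  rewrite -(pair_bigA _ (fun i c => theta (y - a (i, c)))) /=; apply: eq_bigr => i _.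
  rewrite big_bool /a /= mulrC; congr (theta _ * theta _); ring.
have denE : pf_den b (enum {: 'I_n * bool}) w = \prod_k (theta (w + x k) * theta (w + x k + h)).
  rewrite /pf_den big_enum /= (eq_bigr (fun k => theta (w - b (k.1, k.2)))); last by move=> [].
  rewrite -(pair_bigA _ (fun i c => theta (w - b (i, c)))) /=; apply: eq_bigr => i _.
  by rewrite big_bool !bw /= addr0 mulrC.
have coefE k : pf_coef a b (enum {: 'I_n * bool}) k =
   (if k.2 then - resM h k.1 else resP h k.1) / theta h.
  rewrite /pf_coef numE big_enum_cond /=.
  have -> : \prod_(k2 | k2 != k) theta (b k - b k2) =
     (if k.2 then - theta h else theta h) *
     \prod_(j | j != k.1) (theta (x k.1 - x j) *
        theta (if k.2 then x k.1 + h - x j else x k.1 - h - x j)).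
    rewrite (bigD1 (k.1, ~~ k.2)) /=; last by case: (k) => i []; rewrite /= xpair_eqE andbF.
    congr (_ * _).
      case: (k) => i [] /=; rewrite /b /=; last by congr theta; ring.
      by rewrite -thN //; congr theta; ring.
    rewrite (eq_bigl (fun k2 : 'I_n * bool => (k2.1 != k.1) && true)); last first.
      by case: (k) => i c [j d]; rewrite !xpair_eqE /= andbT; case: eqP; case: c d => -[].
    rewrite (eq_bigr (fun k2 => theta (b k - b (k2.1, k2.2)))); last by move=> [].
    rewrite -(pair_big (fun j => j != k.1) xpredT (fun i c => theta (b k - b (i, c)))) /=.
    apply: eq_bigr => j _; rewrite big_bool /b /=; case: (k.2).
      rewrite -[RHS]mulrNN -!thN //; congr (theta _ * theta _); ring.
    rewrite mulrC -[RHS]mulrNN -!thN //; congr (theta _ * theta _); ring.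
  case: (k) => i [] /=; rewrite /b /resM /resP /= ?subr0.
    by rewrite mulNr invrN invfM; ring.
  by rewrite invfM; ring.
rewrite numE denE big_enum /= => H.
rewrite /polesH -mulrA {}H mulr_sumr.
rewrite [RHS](eq_bigr (fun k => theta h * (pf_coef a b (enum {: 'I_n * bool}) (k.1, k.2) *
  (theta (w - b (k.1, k.2) - sig) / theta (w - b (k.1, k.2)))))); last by move=> [].
rewrite -(pair_bigA _ (fun i c => theta h * (pf_coef a b (enum {: 'I_n * bool}) (i, c) *
  (theta (w - b (i, c) - sig) / theta (w - b (i, c)))))) /=.
apply: eq_bigr => i _; rewrite big_bool !coefE !bw /= !addr0.
have e (y v : C) : theta h * (y / theta h * v) = y * v by rewrite !mulrA [theta h * y]mulrC mulfK.
by rewrite (e (- resM h i)) (e (resP h i)) mulNr addrC.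
Qed.

(** Both sides are holomorphic in h, so the zeros of theta h are reached by continuity. *)
Lemma paired_poles (h w : C) :
  (forall i, theta (w + x i) != 0) -> (forall i, theta (w + x i + h) != 0) ->
  (forall i j, i != j -> theta (x i - h - x j) != 0) ->
  (forall i j, i != j -> theta (x i + h - x j) != 0) ->
  \sum_i (resP h i * (theta (w + x i - sig) / theta (w + x i))
     - resM h i * (theta (w + x i + h - sig) / theta (w + x i + h)))
  = theta h * theta (- sig) * polesH h w.
Proof.
move=> wx wxh xm xp; apply: subr0_eq.
pose F (h : C) := \sum_i (resP h i * (theta (w + x i - sig) / theta (w + x i))
     - resM h i * (theta (w + x i + h - sig) / theta (w + x i + h)))
  - theta h * theta (- sig) * polesH h w.
have neq i j : j != i -> i != j by rewrite eq_sym.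
(* The sum is holomorphic in h also where the generic proof divides by theta h. *)
apply: (@dif_dense F); rewrite /F /resP /resM /polesH /pole_num.
  dif_auto.
  - by apply/prodf_neq0 => j /neq ij; apply: mulf_neq0; [exact: x_neq0|exact: xm].
  - by apply/prodf_neq0 => j /neq ij; apply: mulf_neq0; [exact: x_neq0|exact: xp].
  - exact: wxh.
  - by apply/prodf_neq0 => k _; apply: mulf_neq0; [exact: wx|exact: wxh].
have n1 : \forall q \near h, forall i, theta (w + x i + q) != 0.
  apply: near_fin => i; apply: (dif_near (f := fun q => theta (w + x i + q))); last exact: wxh.
  dif_auto.
have n2 : \forall q \near h, forall ij : 'I_n * 'I_n, ij.1 != ij.2 -> theta (x ij.1 - q - x ij.2) != 0.
  apply: near_fin => -[i j] /=; have [->|ij] := eqVneq i j; first by near=> q.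
  have : \forall q \near h, theta (x i - q - x j) != 0.
    apply: (dif_near (f := fun q => theta (x i - q - x j))); last exact: xm.
    dif_auto.
  by apply: filterS => q.
have n3 : \forall q \near h, forall ij : 'I_n * 'I_n, ij.1 != ij.2 -> theta (x ij.1 + q - x ij.2) != 0.
  apply: near_fin => -[i j] /=; have [->|ij] := eqVneq i j; first by near=> q.
  have : \forall q \near h, theta (x i + q - x j) != 0.
    apply: (dif_near (f := fun q => theta (x i + q - x j))); last exact: xp.
    dif_auto.
  by apply: filterS => q.
near=> q => tq; rewrite /F; apply/eqP; rewrite subr_eq0; apply/eqP.
have h2 : forall ij : 'I_n * 'I_n, ij.1 != ij.2 -> theta (x ij.1 - q - x ij.2) != 0 by near: q.
have h3 : forall ij : 'I_n * 'I_n, ij.1 != ij.2 -> theta (x ij.1 + q - x ij.2) != 0 by near: q.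
apply: (paired_poles_generic tq wx).
- by near: q.
- by move=> i j; exact: (h2 (i, j)).
- by move=> i j; exact: (h3 (i, j)).
Unshelve. all: by end_near.
Qed.

(** The sum over the poles that the commutator of e(z) and f(w) produces; m stands for lambda. *)
Definition efsum (h z w m : C) : C :=
  \sum_i (resP h i * (theta (z + x i + m) * theta (w + x i - m - sig) /
                      (theta (z + x i) * theta (w + x i)))
    - resM h i * (theta (z + x i + h + m) * theta (w + x i + h - m - sig) /
                      (theta (z + x i + h) * theta (w + x i + h)))).

Section EF.
Variables (h z w m : C).
Hypothesis sig_neq0 : (0 < n)%N -> theta sig != 0.
Hypothesis zx : forall i, theta (z + x i) != 0.
Hypothesis zxh : forall i, theta (z + x i + h) != 0.
Hypothesis wx : forall i, theta (w + x i) != 0.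
Hypothesis wxh : forall i, theta (w + x i + h) != 0.
Hypothesis xm : forall i j, i != j -> theta (x i - h - x j) != 0.
Hypothesis xp : forall i j, i != j -> theta (x i + h - x j) != 0.

(** Fay's identity separates the dependence on z and on w in each summand, after which the two
    sums are partial fraction expansions. *)
Lemma ef_split : theta (z - w) * efsum h z w m =
  theta h * (theta m * theta (z - w + m + sig) * polesH h z
   - theta (z - w + m) * theta (m + sig) * polesH h w).
Proof.
have [n0|n0] := posnP n.
  have ord : 'I_n -> False by rewrite n0 => -[].
  rewrite /efsum /polesH /pole_num /sig !big1 ?mulr0 ?addr0 ?invr1 //; try by move=> i; case: (ord i).
  by rewrite [theta m * _]mulrC subrr mulr0.
(* For n > 0 multiplication by theta sig makes the summands separable. *)
apply: (mulfI (sig_neq0 n0)); rewrite mulrA /efsum mulr_sumr.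
have aux (c u p X q Y : C) : c * (u * (p * X - q * Y)) = p * (c * u * X) - q * (c * u * Y) by ring.
have aux2 (p a X b Y q X' Y' : C) : p * (a * X - b * Y) - q * (a * X' - b * Y') =
  a * (p * X - q * X') - b * (p * Y - q * Y') by ring.
under eq_bigr => i _.
  rewrite -mulrA aux -{1}(_ : z + x i - (w + x i) = z - w); last by ring.
  rewrite (split_div m sig (zx i) (wx i)).
  rewrite -{1}(_ : z + x i + h - (w + x i + h) = z - w); last by ring.
  rewrite (split_div m sig (zxh i) (wxh i)).
  rewrite (_ : z + x i - (w + x i) = z - w); last by ring.
  rewrite (_ : z + x i + h - (w + x i + h) = z - w); last by ring.
  rewrite aux2.
  over.
rewrite sumrB -!mulr_sumr.
have Pw := paired_poles wx wxh xm xp; have Pz := paired_poles zx zxh xm xp.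
rewrite thN // in Pw Pz.
rewrite Pw Pz; move: (polesH h z) (polesH h w) => p q; gen_thetas; ring.
Qed.

(** The combination is chosen so that only the poles in z survive. *)
Lemma ef_swap : theta (z - w - m - sig) * theta m * efsum h z w m
  + theta (m + (z - w)) * theta (m + sig) * efsum h w z m
  = - theta (z - w) * theta (2 * m + sig) * (theta h * theta sig * polesH h z).
Proof.
have Pz := paired_poles zx zxh xm xp; rewrite thN // in Pz.
transitivity (theta (z - w) * theta (2 * m + sig) * (theta h * - theta sig * polesH h z)); last first.
  by rewrite mulrN mulNr !(mulrN, mulNr).
rewrite -Pz /efsum !mulr_sumr -big_split; apply: eq_bigr => i _ /=.
have aux (c p X q Y : C) : c * (p * X - q * Y) = p * (c * X) - q * (c * Y) by ring.
have := swap_div m sig (zx i) (wx i); have := swap_div m sig (zxh i) (wxh i).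
rewrite (_ : z + x i + h - (w + x i + h) - m - sig = z - w - m - sig); last by ring.
rewrite (_ : m + (z + x i + h) - (w + x i + h) = m + (z - w)); last by ring.
rewrite (_ : z + x i + h - (w + x i + h) = z - w); last by ring.
rewrite (_ : z + x i - (w + x i) - m - sig = z - w - m - sig); last by ring.
rewrite (_ : m + (z + x i) - (w + x i) = m + (z - w)); last by ring.
rewrite (_ : z + x i - (w + x i) = z - w); last by ring.
move=> e1 e2; rewrite [RHS]aux -e1 -e2.
by move: (resP h i) (resM h i) => p q; gen_thetas; ring.
Qed.
End EF.
End PairedPoles.
End ThetaIdentities.

(** * Functions modulo equality on a dense open set *)

Section Generic.
Context {R : realType} {n : nat}.
Local Notation C := (Cplx R).
Local Notation V := ('rV[C]_n).
Local Notation M := (Mfun R n).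
Local Open Scope classical_set_scope.

Definition gen (P : C -> V -> Prop) : Prop :=
  exists D : set (C * V), [/\ open D, dense D & forall q, D q -> P q.1 q.2].

Lemma genT (P : C -> V -> Prop) : (forall l x, P l x) -> gen P.
Proof.
by move=> H; exists setT; split=> [||q _//]; [exact: openT|move=> O [x Ox] _; exists x].
Qed.

Lemma gen_and P Q : gen P -> gen Q -> gen (fun l x => P l x /\ Q l x).
Proof.
move=> [D [oD dD hD]] [E [oE dE hE]]; exists (D `&` E); split.
- exact: openI.
- exact: denseI.
- by move=> q [Dq Eq]; split; [exact: hD|exact: hE].
Qed.

Lemma gen_imp P Q : (forall l x, P l x -> Q l x) -> gen P -> gen Q.
Proof. by move=> PQ [D [oD dD hD]]; exists D; split=> // q Dq; apply/PQ/hD. Qed.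

Lemma gen_and_imp P Q S : (forall l x, P l x -> Q l x -> S l x) -> gen P -> gen Q -> gen S.
Proof. by move=> H gP gQ; apply: gen_imp (gen_and gP gQ) => l x []; exact: H. Qed.

Lemma gen_seq (I : eqType) (s : seq I) (P : I -> C -> V -> Prop) :
  (forall i, i \in s -> gen (P i)) -> gen (fun l x => forall i, i \in s -> P i l x).
Proof.
elim: s => [|i s IH] H; first exact: genT.
apply: (gen_and_imp _ (H i (mem_head _ _)) (IH _)).
  by move=> l x h1 h2 j; rewrite inE => /orP[/eqP->|] //; exact: h2.
by move=> j js; apply: H; rewrite inE js orbT.
Qed.

Lemma gen_fin (I : finType) (P : I -> C -> V -> Prop) :
  (forall i, gen (P i)) -> gen (fun l x => forall i, P i l x).
Proof.
move=> H; apply: gen_imp (@gen_seq _ (enum I) P (fun i _ => H i)) => l x h i.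
by apply: h; rewrite mem_enum.
Qed.

Lemma gen_shift P (a : C) (v : V) : gen P -> gen (fun l x => P (l + a) (x + v)).
Proof.
move=> [D [oD dD hD]].
pose sh (b : C) (w : V) (q : C * V) : C * V := (q.1 + b, q.2 + w).
have csh b w : continuous (sh b w).
  have -> : sh b w = (fun q => q + (b, w)) by apply/funext => -[].
  by move=> q; apply: cvgD; [exact: cvg_id|exact: cvg_cst].
have oP b w O : open O -> open (sh b w @^-1` O).
  by move=> oO; have /continuousP := csh b w; apply.
exists (sh a v @^-1` D); split; first exact: oP.
- move=> O [x Ox] oO.
  have [|y [Oy Dy]] := dD (sh (- a) (- v) @^-1` O) _ (oP _ _ _ oO).
    by exists (sh a v x); rewrite /sh /= !addrK -surjective_pairing.
  by exists (sh (- a) (- v) y); split=> //; rewrite /sh /= !subrK -surjective_pairing.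
- by move=> q Dq; exact: (hD _ Dq).
Qed.

Lemma gen_eqM (f g : M) : mero_eqM f g <-> gen (fun l x => f l x = g l x).
Proof. by split=> -[D [oD dD hD]]; exists D; split. Qed.

Definition Lop (c : M) (p : C) (f : M) : M := fun l x => c l x * f (l + p) x.
Definition Sop (c : 'I_n -> M) (p q : C) (f : M) : M :=
  fun l x => \sum_i c i l x * f (l + p) (x + q *: delta_mx 0 i).

Definition nullM : pred M := fun f => `[< mero_eqM f 0 >].

Lemma nullM_closed : zmod_closed nullM.
Proof.
split; first by apply/asboolP; apply/gen_eqM/genT.
move=> f g /asboolP/gen_eqM hf /asboolP/gen_eqM hg; apply/asboolP/gen_eqM.
apply: (gen_and_imp _ hf hg) => l x ef eg.
by rewrite !fctE ef eg subr0.
Qed.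
Definition nullI : zmodClosed M :=
  HB.pack nullM (GRing.isZmodClosed.Build M nullM nullM_closed).
Definition QM := {ideal_quot nullI}.
HB.instance Definition _ := GRing.Zmodule.on QM.
HB.instance Definition _ := ZmodQuotient.on QM.

Local Open Scope quotient_scope.

Lemma piM_eq (f g : M) : \pi_QM f = \pi_QM g <-> gen (fun l x => f l x = g l x).
Proof.
split.
  move=> /eqmodP /=; rewrite /Quotient.equiv => /asboolP/gen_eqM.
  by apply: gen_imp => l x /eqP; rewrite !fctE subr_eq0 => /eqP.
move=> h; apply/eqmodP => /=; rewrite /Quotient.equiv; apply/asboolP/gen_eqM.
by apply: gen_imp h => l x e; rewrite !fctE e subrr.
Qed.

(** Operators that are additive and compatible with equality on dense open sets, hence act on
    [QM]. *)
Record opM := OpM {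
  opf :> M -> M;
  opf_add : forall f g l x, opf (f - g) l x = opf f l x - opf g l x;
  opf_gen : forall f g, gen (fun l x => f l x = g l x) ->
    gen (fun l x => opf f l x = opf g l x) }.

Fact liftM_key : unit. Proof. exact: tt. Qed.
Definition liftM (P : opM) : QM -> QM := locked_with liftM_key (fun q => \pi_QM (P (repr q))).

Lemma liftM_pi P f : liftM P (\pi_QM f) = \pi_QM (P f).
Proof. by rewrite /liftM unlock; apply/piM_eq/opf_gen/piM_eq; rewrite reprK. Qed.

Lemma piMB (f g : M) : \pi_QM (f - g) = \pi_QM f - \pi_QM g.
Proof. exact: (raddfB \pi_QM). Qed.
Lemma piMD (f g : M) : \pi_QM (f + g) = \pi_QM f + \pi_QM g.
Proof. exact: (raddfD \pi_QM). Qed.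

Lemma liftM_additive P : zmod_morphism (liftM P).
Proof.
move=> u v; rewrite -[u]reprK -[v]reprK -piMB !liftM_pi -piMB; apply/piM_eq/genT.
by move=> l x; rewrite opf_add !fctE.
Qed.
HB.instance Definition _ P := GRing.isZmodMorphism.Build QM QM (liftM P) (liftM_additive P).

Lemma Lop_add c p f g l x : Lop c p (f - g) l x = Lop c p f l x - Lop c p g l x.
Proof. by rewrite /Lop -mulrBr !fctE. Qed.
Lemma Lop_gen c p f g : gen (fun l x => f l x = g l x) ->
  gen (fun l x => Lop c p f l x = Lop c p g l x).
Proof.
move=> /(gen_shift p 0); apply: gen_imp => l x; rewrite addr0 /Lop => -> //.
Qed.
Definition LopM c p := OpM (@Lop_add c p) (@Lop_gen c p).

Lemma Sop_add c p q f g l x : Sop c p q (f - g) l x = Sop c p q f l x - Sop c p q g l x.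
Proof. by rewrite /Sop -sumrB; apply: eq_bigr => i _; rewrite -mulrBr !fctE. Qed.
Lemma Sop_gen c p q f g : gen (fun l x => f l x = g l x) ->
  gen (fun l x => Sop c p q f l x = Sop c p q g l x).
Proof.
move=> h; have := gen_fin (fun i => gen_shift p (q *: delta_mx 0 i) h).
by apply: gen_imp => l x H; apply: eq_bigr => i _; rewrite H.
Qed.
Definition SopM c p q := OpM (@Sop_add c p q) (@Sop_gen c p q).

End Generic.
Arguments QM R n : clear implicits.
Arguments opM R n : clear implicits.

(** * Meromorphic coefficients and homogeneous difference operators *)

Section GlobalQuotients.
Context {R : realType} {n : nat}.
Local Notation C := (Cplx R).
Local Notation V := ('rV[C]_n).
Local Notation M := (Mfun R n).

Definition entire (f : M) : Prop := forall p : C * V, differentiable (joint f) p.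

(** Global quotients of entire functions. Unlike local ones these are visibly stable under
    products and translations, and all coefficients below are of this form. *)
Definition quotient_of_entire (f : M) : Prop := exists g k : M,
  [/\ entire g, entire k, gen (fun l x => k l x != 0) &
      forall l x, k l x != 0 -> f l x = g l x / k l x].

Lemma quotient_of_entire_meroM f : quotient_of_entire f -> meroM f.
Proof.
move=> [g [k [dg dk [D [oD dD hD]] fE]]] p.
exists setT, (joint g), (joint k); split.
- by split=> //; exact: openT.
- by move=> q _; split; [exact: dg|exact: dk].
- by move=> O oO O0 _; have [q [Oq Dq]] := dD O O0 oO; exists q => //; exact: hD.
- by move=> [l x] _; exact: fE.
Qed.

Lemma quotient_of_entire_entire f : entire f -> quotient_of_entire f.
Proof.
move=> df; exists f, (fun _ _ => 1); split=> //.
- by move=> p; exact: dif_cst.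
- by apply: genT => l x; rewrite oner_neq0.
- by move=> l x _; rewrite divr1.
Qed.

Lemma quotient_of_entire_cst (c : C) : quotient_of_entire (fun _ _ => c).
Proof. by apply: quotient_of_entire_entire => p; exact: dif_cst. Qed.

Lemma quotient_of_entireV f : entire f -> gen (fun l x => f l x != 0) -> quotient_of_entire (fun l x => (f l x)^-1).
Proof.
move=> df nf; exists (fun _ _ => 1), f; split=> //.
- by move=> p; exact: dif_cst.
- by move=> l x _; rewrite div1r.
Qed.

Lemma quotient_of_entireM f g : quotient_of_entire f -> quotient_of_entire g ->
  quotient_of_entire (fun l x => f l x * g l x).
Proof.
move=> [a [b [da db nb fE]]] [c [d [dc dd nd gE]]].
exists (fun l x => a l x * c l x), (fun l x => b l x * d l x); split.
- by move=> p; apply: difM; [exact: da|exact: dc].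
- by move=> p; apply: difM; [exact: db|exact: dd].
- by apply: (gen_and_imp _ nb nd) => l x; exact: mulf_neq0.
- move=> l x; rewrite mulf_eq0 negb_or => /andP[b0 d0].
  by rewrite fE // gE // invfM mulrACA.
Qed.

Lemma quotient_of_entireN f : quotient_of_entire f -> quotient_of_entire (fun l x => - f l x).
Proof.
move=> mf; have := quotient_of_entireM (quotient_of_entire_cst (-1)) mf.
by under eq_fun do under eq_fun do rewrite mulN1r.
Qed.

Lemma quotient_of_entire_shift f (a : C) (v : V) : quotient_of_entire f -> quotient_of_entire (fun l x => f (l + a) (x + v)).
Proof.
move=> [g [k [dg dk nk fE]]].
have dsh p : differentiable (fun q : C * V => (q.1 + a, q.2 + v)) p.
  have -> : (fun q : C * V => (q.1 + a, q.2 + v)) = (fun q => q + (a, v)) by apply/funext => -[].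
  by apply: differentiableD; [by []|exact: differentiable_cst].
exists (fun l x => g (l + a) (x + v)), (fun l x => k (l + a) (x + v)); split.
- by move=> p; exact: (differentiable_comp (dsh p) (dg _)).
- by move=> p; exact: (differentiable_comp (dsh p) (dk _)).
- exact: gen_shift nk.
- by move=> l x; exact: fE.
Qed.

(** The terms may differ in the single shifts; the two totals are what the weight grading sees. *)
Definition homogeneous_op (p q : C) (T : M -> M) : Prop :=
  exists (I : finType) (c : I -> M) (v : I -> V),
    [/\ forall k, quotient_of_entire (c k), forall k, \sum_i v k 0 i = q &
        forall f l x, T f l x = \sum_k c k l x * f (l + p) (x + v k)].

Lemma homogeneous_op_comp p q p' q' T T' : homogeneous_op p q T -> homogeneous_op p' q' T' ->
  homogeneous_op (p + p') (q + q') (fun f => T (T' f)).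
Proof.
move=> [I [c [v [mc vq TE]]]] [J [d [w [md wq TE']]]].
exists (I * J)%type, (fun k l x => c k.1 l x * d k.2 (l + p) (x + v k.1)), (fun k => v k.1 + w k.2).
split.
- by move=> k; apply: quotient_of_entireM => //; exact: quotient_of_entire_shift.
- by move=> k; rewrite -(vq k.1) -(wq k.2) -big_split; apply: eq_bigr => i _; rewrite mxE.
- move=> f l x; rewrite TE.
  under eq_bigr do rewrite TE' mulr_sumr.
  rewrite pair_bigA /=; apply: eq_bigr => k _.
  by rewrite mulrA !addrA.
Qed.

Lemma homogeneous_opD p q T T' : homogeneous_op p q T -> homogeneous_op p q T' ->
  homogeneous_op p q (fun f l x => T f l x + T' f l x).
Proof.
move=> [I [c [v [mc vq TE]]]] [J [d [w [md wq TE']]]].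
exists (I + J)%type, (fun k => match k with inl i => c i | inr j => d j end),
  (fun k => match k with inl i => v i | inr j => w j end); split.
- by case.
- by case.
- by move=> f l x; rewrite TE TE' big_sumType.
Qed.

Lemma homogeneous_op_Lop p c : quotient_of_entire c -> homogeneous_op p 0 (Lop c p).
Proof.
move=> mc; exists unit, (fun=> c), (fun=> 0); split=> //.
- by move=> _; rewrite big1 // => i _; rewrite mxE.
- by move=> f l x; rewrite big_const card_unit /= addr0 /Lop addr0.
Qed.

Lemma homogeneous_op_Sop p q (c : 'I_n -> M) : (forall i, quotient_of_entire (c i)) -> homogeneous_op p q (Sop c p q).
Proof.
move=> mc; exists 'I_n, c, (fun i => q *: delta_mx 0 i); split=> // k.
rewrite (bigD1 k) //= !mxE !eqxx mulr1 big1 ?addr0 // => i ik.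
by rewrite !mxE eqxx (negPf ik) mulr0.
Qed.

Lemma homogeneous_op_ord p q T : homogeneous_op p q T -> exists (N : nat) (c : 'I_N -> M) (v : 'I_N -> V),
  [/\ forall k, quotient_of_entire (c k), forall k, \sum_i v k 0 i = q &
      forall f l x, T f l x = \sum_(k < N) c k l x * f (l + p) (x + v k)].
Proof.
move=> [I [c [v [mc vq TE]]]].
exists #|I|, (fun k => c (enum_val k)), (fun k => v (enum_val k)); split=> //.
by move=> f l x; rewrite TE (reindex _ (onW_bij _ (@enum_val_bij I))).
Qed.

Lemma homogeneous_op_difference p q T : homogeneous_op p q T -> difference_operator T.
Proof.
move=> /homogeneous_op_ord[N [c [v [mc _ TE]]]]; exists N, c, (fun=> p), v.
by split=> // k; exact: quotient_of_entire_meroM.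
Qed.

Lemma homogeneous_op_x_difference p q T : homogeneous_op p q T -> x_difference_operator (fun l g => T (fun=> g) l).
Proof.
move=> /homogeneous_op_ord[N [c [v [mc _ TE]]]]; exists N, c, v.
by split=> [k|l g x]; [exact: quotient_of_entire_meroM|rewrite TE].
Qed.

(** The shift of lambda is the same in every term. *)
Lemma homogeneous_op_local p q T f l x : homogeneous_op p q T -> T f l x = T (fun=> f (l + p)) l x.
Proof. by move=> [I [c [v [_ _ TE]]]]; rewrite !TE. Qed.

Lemma homogeneous_op_sum p q T (I : finType) (a : I -> C) (g : I -> V -> C) l x : homogeneous_op p q T ->
  T (fun=> (fun y => \sum_i a i * g i y)) l x = \sum_i a i * T (fun=> g i) l x.
Proof.
move=> [J [c [v [_ _ TE]]]]; rewrite TE; under [RHS]eq_bigr do rewrite TE mulr_sumr.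
rewrite exchange_big; apply: eq_bigr => k _ /=.
by rewrite mulr_sumr; apply: eq_bigr => i _; rewrite mulrCA.
Qed.

(** The multiplication operator h is an affine function of the sum of the x_i. *)
Lemma homogeneous_op_weight p q T (s : V -> C) (m : C) (g : V -> C) (l : C) (x : V) : homogeneous_op p q T ->
  (forall y v : V, \sum_i v 0 i = q -> s (y + v) = s y + m) ->
  T (fun=> (fun y => s y * g y)) l x = (s x + m) * T (fun=> g) l x.
Proof.
move=> [J [c [v [_ vq TE]]]] sE; rewrite !TE mulr_sumr; apply: eq_bigr => k _.
by rewrite sE // mulrCA.
Qed.

End GlobalQuotients.

(** * From exchange relations to the RLL relation *)

Section AbstractRLL.
Variable V : zmodType.
Variables (az aw ez ew fz fw kz kw gzw gwz Yzw Ywz Xzw Xwz : {additive V -> V}).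
(* A1, A2 and B1, B2 are alpha and beta at lambda and at - lambda; primes denote the argument
   lambda + h, and H1, H2, K1, K2 have the argument lambda - 2 eta h^(3) of the left hand side. *)
Variables (A1 A2 B1 B2 A1' A2' B1' B2' H1 H2 K1 K2 : {additive V -> V}).
Variable (awi : V -> V).

Hypothesis (awiK : forall v, aw (awi v) = v) (awK : forall v, awi (aw v) = v).
Hypothesis aa : forall v, az (aw v) = aw (az v).
Hypothesis kk : forall v, kz (kw v) = kw (kz v).
Hypothesis bb : forall v, az (ez (aw (ew v))) = aw (ew (az (ez v))).
Hypothesis cc : forall v, fz (az (fw (aw v))) = fw (aw (fz (az v))).
Hypothesis E1 : forall v, az (ew v) = A1' (ew (az v)) + B2' (az (ez v)).
Hypothesis E2 : forall v, az (ez (aw v)) = aw (A2' (az (ez v)) + B1' (ew (az v))).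
Hypothesis ac1 : forall v, H1 (az (fw (aw v))) + K1 (fz (az (aw v))) = fw (aw (az v)).
Hypothesis ac2 : forall v, H2 (fz (az (aw v))) + K2 (az (fw (aw v))) = aw (fz (az v)).
Hypothesis ak : forall v, H1 (az (kw v)) = A1 (kw (az v)).
Hypothesis defGzw : forall v, az (ez (fw (aw v))) = az (fw (ez (aw v))) + gzw v.
Hypothesis defGwz : forall v, aw (ew (fz (az v))) = aw (fz (ew (az v))) + gwz v.
Hypothesis G1 : forall v, H1 (gzw v) + K1 (kz (aw v)) = B1 (kw (az v)).
Hypothesis G2 : forall v, A1 (gwz v) + B2 (aw (kz v)) = K2 (az (kw v)).
Hypothesis G3 : forall v, K2 (gzw v) + H2 (kz (aw v)) = A2 (aw (kz v)) + B1 (gwz v).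
Hypothesis Y1 : forall v, ez v = B1 (ew v) + A1 (Yzw v).
Hypothesis Y2 : forall v, az (ez (kw v)) = az (kw (Yzw v)).
Hypothesis Y2' : forall v, aw (ew (kz v)) = aw (kz (Ywz v)).
Hypothesis Y3 : forall v, Ywz v = B2 (Yzw v) + A2 (ew v).
Hypothesis X1 : forall v, fz v = fw (K2 v) + Xzw (H1 v).
Hypothesis X2 : forall v, kw (fz v) = Xzw (kw v).
Hypothesis X2' : forall v, kz (fw v) = Xwz (kz v).
Hypothesis X3 : forall v, Xwz v = Xzw (K1 v) + fw (H2 v).
(* The entries of the R matrix are functions of lambda only. *)
Hypothesis (A1aw : forall v, A1 (aw v) = aw (A1' v)) (A2aw : forall v, A2 (aw v) = aw (A2' v)).
Hypothesis (B1aw : forall v, B1 (aw v) = aw (B1' v)) (B2aw : forall v, B2 (aw v) = aw (B2' v)).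
Hypothesis (A1kwaz : forall v, kw (az (A1 v)) = A1 (kw (az v))).
Hypothesis (B1kwaz : forall v, kw (az (B1 v)) = B1 (kw (az v))).
Hypothesis (A2awkz : forall v, aw (kz (A2 v)) = A2 (aw (kz v))).
Hypothesis (B2awkz : forall v, aw (kz (B2 v)) = B2 (aw (kz v))).
Hypothesis (A1fw : forall v, A1 (fw v) = fw (A1 v)) (A2fw : forall v, A2 (fw v) = fw (A2 v)).
Hypothesis (B1fw : forall v, B1 (fw v) = fw (B1 v)) (B2fw : forall v, B2 (fw v) = fw (B2 v)).
Hypothesis (A1fz : forall v, A1' (fz v) = fz (A1' v)) (A2fz : forall v, A2' (fz v) = fz (A2' v)).
Hypothesis (B1fz : forall v, B1' (fz v) = fz (B1' v)) (B2fz : forall v, B2' (fz v) = fz (B2' v)).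
Hypothesis (A1gwz : forall v, A1 (gwz v) = gwz (A1 v)) (B1gwz : forall v, B1 (gwz v) = gwz (B1 v)).
Hypothesis (A1X : forall v, A1 (Xzw v) = Xzw (A1 v)) (B1X : forall v, B1 (Xzw v) = Xzw (B1 v)).

Let bz v := az (ez v).
Let bw v := aw (ew v).
Let cz v := fz (az v).
Let cw v := fw (aw v).
Let dz v := fz (az (ez v)) + kz v.
Let dw v := fw (aw (ew v)) + kw v.

Let aw_inj u v : aw u = aw v -> u = v.
Proof. by move=> e; rewrite -[u]awK e awK. Qed.

Let Xv v := awi (ez (aw v)).
Let XvE v : aw (Xv v) = ez (aw v). Proof. exact: awiK. Qed.
Let azX v : az (Xv v) = A2' (az (ez v)) + B1' (ew (az v)).
Proof. by apply: aw_inj; rewrite -aa XvE E2. Qed.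

Lemma rll_aa v : az (aw v) = aw (az v). Proof. exact: aa. Qed.
Lemma rll_bb v : bz (bw v) = bw (bz v). Proof. exact: bb. Qed.
Lemma rll_cc v : cz (cw v) = cw (cz v). Proof. exact: cc. Qed.

Lemma rll_ab1 v : az (bw v) = A1 (bw (az v)) + B2 (aw (bz v)).
Proof. by rewrite /bw /bz aa E1 raddfD A1aw B2aw. Qed.
Lemma rll_ab2 v : bz (aw v) = A2 (aw (bz v)) + B1 (bw (az v)).
Proof. by rewrite /bw /bz E2 raddfD A2aw B1aw. Qed.

Lemma rll_ac1 v : H1 (az (cw v)) + K1 (cz (aw v)) = cw (az v). Proof. exact: ac1. Qed.
Lemma rll_ac2 v : H2 (cz (aw v)) + K2 (az (cw v)) = aw (cz v). Proof. exact: ac2. Qed.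

Lemma rll_ad1 v : H1 (az (dw v)) + K1 (cz (bw v)) = A1 (dw (az v)) + B2 (cw (bz v)).
Proof.
rewrite /dw /cz /bw /cw /bz !raddfD /= addrAC ac1 ak; rewrite addrAC; congr (_ + _).
by rewrite A1fw B2fw -raddfD -aa; congr (fw _); exact: rll_ab1.
Qed.

Let dzE (g : {additive V -> V}) v : g (dz v) = g (fz (az (ez v))) + g (kz v).
Proof. exact: raddfD. Qed.
Let dwE (g : {additive V -> V}) v : g (dw v) = g (fw (aw (ew v))) + g (kw v).
Proof. exact: raddfD. Qed.

Let step_ii v : A1 (bw (cz v)) + B2 (aw (fz (az (ez v)))) = aw (fz (az (ew v))) + A1 (gwz v).
Proof.
rewrite /bw /cz defGwz raddfD /= addrAC; congr (_ + _).
by rewrite E1 A1aw A1fz B2aw B2fz !raddfD.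
Qed.

Lemma rll_ad2 v : H2 (cz (bw v)) + K2 (az (dw v)) = A1 (bw (cz v)) + B2 (aw (dz v)).
Proof.
have -> : B2 (aw (dz v)) = B2 (aw (fz (az (ez v)))) + B2 (aw (kz v)) by rewrite dzE raddfD.
have -> : K2 (az (dw v)) = K2 (az (fw (aw (ew v)))) + K2 (az (kw v)) by rewrite dwE raddfD.
by rewrite [RHS]addrA step_ii -addrA G2 addrA /cz /bw ac2.
Qed.

Let step_iii v : A2 (aw (fz (az (ez v)))) + B1 (bw (cz v)) = aw (fz (az (Xv v))) + B1 (gwz v).
Proof.
rewrite /bw /cz defGwz raddfD /= addrA; congr (_ + _).
by rewrite azX A2aw A2fz B1aw B1fz !raddfD.
Qed.

Let step_iii' v : A2 (aw (dz v)) + B1 (bw (cz v)) =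
  aw (fz (az (Xv v))) + (A2 (aw (kz v)) + B1 (gwz v)).
Proof.
have -> : A2 (aw (dz v)) = A2 (aw (fz (az (ez v)))) + A2 (aw (kz v)) by rewrite dzE raddfD.
by rewrite addrAC step_iii addrAC -addrA.
Qed.

Lemma rll_da2 v : H2 (dz (aw v)) + K2 (bz (cw v)) = A2 (aw (dz v)) + B1 (bw (cz v)).
Proof.
have -> : K2 (bz (cw v)) = K2 (az (fw (ez (aw v)))) + K2 (gzw v).
  by rewrite /bz /cw defGzw raddfD.
rewrite step_iii' dzE addrACA -XvE ac2; congr (_ + _).
by rewrite addrC G3.
Qed.

Let step_iv v : A2 (cw (bz v)) + B1 (dw (az v)) = fw (bz (aw v)) + B1 (kw (az v)).
Proof.
rewrite dwE addrA; congr (_ + _).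
by rewrite /cw A2fw B1fw -raddfD -rll_ab2.
Qed.

Lemma rll_da1 v : H1 (bz (cw v)) + K1 (dz (aw v)) = A2 (cw (bz v)) + B1 (dw (az v)).
Proof.
have -> : H1 (bz (cw v)) = H1 (az (fw (ez (aw v)))) + H1 (gzw v).
  by rewrite /bz /cw defGzw raddfD.
by rewrite step_iv dzE addrACA G1 -XvE ac1 -aa XvE.
Qed.

Let kbY v : kw (bz v) = B1 (kw (az (ew v))) + H1 (bz (kw v)).
Proof. by rewrite /bz Y2 ak Y1 !raddfD /= B1kwaz A1kwaz. Qed.

Lemma rll_bd1 v : H1 (bz (dw v)) + K1 (dz (bw v)) = dw (bz v).
Proof.
have -> : H1 (bz (dw v)) = H1 (bz (cw (ew v))) + H1 (bz (kw v)).
  by rewrite /bz dwE !raddfD.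
rewrite addrAC rll_da1 step_iv -addrA -kbY /dw; congr (fw _ + _).
by rewrite -/(bw (ew v)) rll_bb.
Qed.

Let fazX v : aw (fz (az (Xv (ew v)))) = aw (fz (ew (az (ez v)))).
Proof.
congr (aw (fz _)); apply: aw_inj; rewrite -aa XvE; exact: bb.
Qed.

Let bd2_rest v : A2 (aw (kz (ew v))) + B1 (gwz (ew v)) + K2 (bz (kw v)) =
  gwz (ez v) + bw (kz v).
Proof.
have -> : gwz (ez v) = B1 (gwz (ew v)) + A1 (gwz (Yzw v)).
  by rewrite Y1 raddfD /= -B1gwz -A1gwz.
have -> : bw (kz v) = B2 (aw (kz (Yzw v))) + A2 (aw (kz (ew v))).
  by rewrite /bw Y2' Y3 !raddfD /= B2awkz A2awkz.
have -> : K2 (bz (kw v)) = A1 (gwz (Yzw v)) + B2 (aw (kz (Yzw v))).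
  by rewrite /bz Y2 -G2.
by rewrite !addrA [RHS](ACl (4*1*2*3)).
Qed.

Lemma rll_bd2 v : H2 (dz (bw v)) + K2 (bz (dw v)) = bw (dz v).
Proof.
have -> : K2 (bz (dw v)) = K2 (bz (cw (ew v))) + K2 (bz (kw v)).
  by rewrite /bz dwE !raddfD.
rewrite addrA rll_da2 step_iii' fazX -addrA bd2_rest.
have -> : bw (dz v) = aw (ew (fz (az (ez v)))) + bw (kz v).
  by rewrite /bw dzE raddfD.
by rewrite defGwz addrA.
Qed.

Lemma rll_cd1 v : cz (dw v) = A1 (dw (cz v)) + B2 (cw (dz v)).
Proof.
have -> : cz (dw v) = cz (cw (ew v)) + cz (kw v) by rewrite /cz dwE raddfD.
have -> : B2 (cw (dz v)) = B2 (fw (aw (fz (az (ez v))))) + B2 (fw (aw (kz v))).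
  by rewrite /cw dzE !raddfD.
rewrite dwE addrACA A1fw !B2fw -(raddfD fw) -/(bw (cz v)) step_ii (raddfD fw) -addrA.
rewrite rll_cc; congr (_ + _).
by rewrite addrCA -(raddfD fw) G2 /cz X1 ak addrC X2 A1X.
Qed.

Let cd2_rest v : fz (gzw v) + kz (cw v) =
  fw (A2 (aw (kz v)) + B1 (gwz v)) + B1 (kw (cz v)).
Proof.
have -> : fz (gzw v) = fw (K2 (gzw v)) + Xzw (H1 (gzw v)) by exact: X1.
have -> : kz (cw v) = Xzw (K1 (kz (aw v))) + fw (H2 (kz (aw v))).
  by rewrite /cw X2' X3.
have -> : B1 (kw (cz v)) = Xzw (H1 (gzw v)) + Xzw (K1 (kz (aw v))).
  by rewrite /cz X2 B1X -G1 raddfD.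
by rewrite -G3 raddfD /= !addrA [RHS](ACl (1*3*4*2)).
Qed.

Let cd2_main v : cw (fz (az (Xv v))) = fz (az (fw (ez (aw v)))).
Proof. by rewrite -XvE; symmetry; exact: cc. Qed.

Lemma rll_cd2 v : dz (cw v) = A2 (cw (dz v)) + B1 (dw (cz v)).
Proof.
have -> : dz (cw v) = fz (az (fw (ez (aw v)))) + (fz (gzw v) + kz (cw v)).
  by rewrite /dz /cw defGzw raddfD /= addrA.
have -> : A2 (cw (dz v)) + B1 (dw (cz v)) =
    fw (A2 (aw (dz v)) + B1 (bw (cz v))) + B1 (kw (cz v)).
  by rewrite dwE addrA /cw A2fw B1fw -(raddfD fw).
by rewrite step_iii' (raddfD fw) cd2_rest -cd2_main /cw !addrA.
Qed.

Let Jsym v : fz (gzw (ew v)) + kz (cw (ew v)) + cz (ez (kw v)) =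
  fw (gwz (ez v)) + fw (bw (kz v)) + kw (cz (ez v)).
Proof.
rewrite cd2_rest -[fw (gwz _) + _]raddfD -bd2_rest [in RHS]raddfD /= -!addrA.
congr (_ + _).
have -> : cz (ez (kw v)) = fw (K2 (bz (kw v))) + A1 (kw (cz (Yzw v))).
  by rewrite /cz X1 /bz Y2 ak -A1X X2.
have -> : kw (cz (ez v)) = B1 (kw (cz (ew v))) + A1 (kw (cz (Yzw v))).
  by rewrite /cz !X2 Y1 !raddfD /= B1kwaz A1kwaz B1X A1X.
by rewrite addrCA.
Qed.

Lemma rll_dd v : dz (dw v) = dw (dz v).
Proof.
have -> : dz (dw v) = fz (az (fw (ez (bw v)))) + (fz (gzw (ew v)) + kz (cw (ew v))
    + cz (ez (kw v))) + kz (kw v).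
  rewrite /dz /dw !raddfD /= defGzw raddfD /= -/(bw v) -/(cw (ew v)) -/(cz _).
  by rewrite !addrA [LHS](ACl (1*2*4*3*5)).
have -> : dw (dz v) = fw (aw (fz (ew (bz v)))) + (fw (gwz (ez v)) + fw (bw (kz v))
    + kw (cz (ez v))) + kw (kz v).
  rewrite /dz /dw !raddfD /= defGwz raddfD /= -/(bw _) -/(bz v) -/(cz _).
  by rewrite !addrA.
by rewrite Jsym kk -cd2_main /cw fazX.
Qed.

Definition Tz (i j : bool) v := if i then if j then az v else bz v else if j then cz v else dz v.
Definition Tw (i j : bool) v := if i then if j then aw v else bw v else if j then cw v else dw v.

(** Component (i, j; p, q) of the RLL relation. The entries of L are a, a e, f a and
    f a e + k; each of the sixteen cases moves the factors at w past those at z. *)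
Theorem rll_components (i j p q : bool) v :
  (let X k m := Tz k p (Tw m q v) in
   if i then if j then X true true else H1 (X true false) + K1 (X false true)
   else if j then H2 (X false true) + K2 (X true false) else X false false) =
  (let Y k m := Tw j m (Tz i k v) in
   if p then if q then Y true true else A1 (Y true false) + B2 (Y false true)
   else if q then A2 (Y false true) + B1 (Y true false) else Y false false).
Proof.
case: i j p q => [] [] [] []; rewrite /Tz /Tw /=.
- exact: rll_aa.
- exact: rll_ab1.
- exact: rll_ab2.
- exact: rll_bb.
- exact: rll_ac1.
- exact: rll_ad1.
- exact: rll_da1.
- exact: rll_bd1.
- exact: rll_ac2.
- exact: rll_ad2.
- exact: rll_da2.
- exact: rll_bd2.
- exact: rll_cc.
- exact: rll_cd1.
- exact: rll_cd2.
- exact: rll_dd.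
Qed.

End AbstractRLL.

(** * Exchange relations of the Gauss factors *)

Section GaussOperators.
Context {R : realType} (tau : Cplx R) (tau_gt0 : 0 < complex.Im tau).
Context {n : nat} (h : Cplx R) (zz t : 'I_n -> Cplx R).
Local Notation C := (Cplx R).
Local Notation V := ('rV[C]_n).
Local Notation M := (Mfun R n).
Local Notation theta := (th tau).

(** The dynamical shift - 2 eta h on W. *)
Definition sx (x : V) : C := 2 * \sum_i (x 0 i + zz i).
Definition Sx (x : V) : C := \sum_i (x 0 i + zz i + t i).
Definition dl (i : 'I_n) (q : C) : V := q *: delta_mx 0 i.

Definition Qx (z : C) (x : V) : C := \prod_j theta (z + x 0 j).
Definition Qi (i : 'I_n) (z : C) (x : V) : C := \prod_(j | j != i) theta (z + x 0 j).
Definition xden (i : 'I_n) (x : V) : C := \prod_(j | j != i) theta (x 0 i - x 0 j).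
(** With [Dm], the residue-like factors Delta_+(- x_i) and Delta_-(- x_i) over the product of
    the theta (x_i - x_j). *)
Definition Dp (i : 'I_n) (x : V) : C := \prod_k theta (- x 0 i - zz k - t k) / xden i x.
Definition Dm (i : 'I_n) (x : V) : C := \prod_k theta (- x 0 i - zz k + t k) / xden i x.

Definition Ax (z : C) : M := fun l x => Qx z x * (theta (l + Sx x) / theta l).
Definition ec (z : C) (i : 'I_n) : M := fun l x =>
  - (theta (z + x 0 i + l + h) / theta (z + x 0 i)) * (Dp i x / theta (l + h + Sx x)).
Definition fc (z : C) (i : 'I_n) : M := fun l x =>
  - (theta (z + x 0 i - (l + sx x)) / theta (z + x 0 i + h)) * (Dm i x / theta (l + h + Sx x)).
Definition del (z : C) : C := \prod_k (theta (z - zz k - t k) * theta (z - zz k + t k + h)).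
Definition Kc (z : C) : M := fun l x =>
  del z / Qx (z + h) x * (theta (l + sx x + h) / theta (l + h + Sx x)).
Definition yc (z w : C) (i : 'I_n) : M := fun l x =>
  - (theta (l + (z + x 0 i)) * theta (w + x 0 i + h) / (theta (z + x 0 i) * theta (w + x 0 i)))
  * (Dp i x / theta (l + h + Sx x)).
Definition xc (z w : C) (i : 'I_n) : M := fun l x =>
  - (theta (l + sx x + h) * theta (w + x 0 i + 2 * h) * theta (z + x 0 i - (l + sx x) - h) /
     (theta (l + sx x + 3 * h) * theta (w + x 0 i + h) * theta (z + x 0 i + h)))
  * (Dm i x / theta (l + h + Sx x)).
Definition gc (z w : C) : M := fun l x =>
  Qx z x * Qx w x * efsum tau (fun i => x 0 i) zz t h z w l / (theta l * theta (l + h)).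

(** The Gauss factors a, e, f, k. In addition, [opY] and [opX] are what e and f become after
    being carried across k, and [opG] is the commutator of e and f between two factors a. *)
Definition opA z := LopM (Ax z) (- h).
Definition opAi z := LopM (fun l x => (Ax z (l + h) x)^-1) h.
Definition opE z := SopM (ec z) (2 * h) (- h).
Definition opF z := SopM (fc z) 0 h.
Definition opK z := LopM (Kc z) h.
Definition opY z w := SopM (yc z w) (2 * h) (- h).
Definition opX z w := SopM (xc z w) 0 h.
Definition opG z w := LopM (gc z w) 0.
Definition opS (s : C -> C) : opM R n := LopM (fun l _ => s l) 0.
Definition opH (s : C -> C) : opM R n := LopM (fun l x => s (l + sx x)) 0.

Definition al (u l : C) : C := theta (l + h) * theta u / (theta l * theta (u - h)).
Definition be (u l : C) : C := - (theta (l + u) * theta h / (theta l * theta (u - h))).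

Lemma dlE i q (x : V) j : (x + dl i q) 0 j = x 0 j + (if j == i then q else 0).
Proof.
by rewrite /dl !mxE eqxx /=; case: (j == i) => /=; rewrite ?mulr1 ?mulr0.
Qed.
Lemma dl_eq i q (x : V) : (x + dl i q) 0 i = x 0 i + q.
Proof. by rewrite dlE eqxx. Qed.
Lemma dl_neq i q (x : V) j : j != i -> (x + dl i q) 0 j = x 0 j.
Proof. by rewrite dlE => /negPf->; rewrite addr0. Qed.
Lemma sum_dl i q (x : V) (F : 'I_n -> C) :
  \sum_j ((x + dl i q) 0 j + F j) = \sum_j (x 0 j + F j) + q.
Proof.
rewrite (bigD1 i) //= [in RHS](bigD1 i) //= dl_eq.
under eq_bigr => j ji do rewrite dl_neq //.
by rewrite /= -!addrA; congr (_ + _); rewrite addrC -!addrA.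
Qed.
Lemma sx_dl i q (x : V) : sx (x + dl i q) = sx x + 2 * q.
Proof. by rewrite /sx sum_dl mulrDr. Qed.
Lemma Sx_dl i q (x : V) : Sx (x + dl i q) = Sx x + q.
Proof.
rewrite /Sx; under eq_bigr do rewrite -addrA; rewrite sum_dl.
by under [in RHS]eq_bigr do rewrite -addrA.
Qed.
Lemma Qx_D1 i z (x : V) : Qx z x = theta (z + x 0 i) * Qi i z x.
Proof. by rewrite /Qx (bigD1 i). Qed.
Lemma Qi_dl i q z (x : V) : Qi i z (x + dl i q) = Qi i z x.
Proof. by apply: eq_bigr => j ji; rewrite dl_neq. Qed.
Lemma Qx_dl i q z (x : V) : Qx z (x + dl i q) = theta (z + x 0 i + q) * Qi i z x.
Proof. by rewrite (Qx_D1 i) Qi_dl dl_eq addrA. Qed.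

(** The argument f is affine with slope 1 along some direction, so that every point can be moved
    slightly to make theta f nonzero. *)
Lemma gen_th (f : C -> V -> C) (dl : C) (dx : V) :
  (forall p : C * V, differentiable (fun q : C * V => f q.1 q.2) p) ->
  (forall l x s, f (l + s * dl) (x + s *: dx) = f l x + s) ->
  gen (fun l x => theta (f l x) != 0).
Proof.
move=> df fE; exists [set q | theta (f q.1 q.2) != 0]%classic; split=> //.
  rewrite openE => q fq; apply: (@dif_near _ _ q (fun q => theta (f q.1 q.2)) _ fq).
  exact: (@dif_theta _ _ tau_gt0 _ _ (fun q => f q.1 q.2)).
move=> O [p Op] oO.
have ct : continuous (fun s : C => (p.1 + s * dl, p.2 + s *: dx) : C * V).
  move=> s; apply: differentiable_continuous; apply: differentiable_pair.
    by apply: difD; [exact: dif_cst|apply: difM; [exact: dif_id|exact: dif_cst]].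
  apply: differentiableD; first exact: differentiable_cst.
  exact: differentiableZl.
have : \forall s \near (0 : C), O (p.1 + s * dl, p.2 + s *: dx).
  apply: ct; rewrite mul0r scale0r !addr0 -surjective_pairing.
  by apply: open_nbhs_nbhs; split.
move=> /nbhs_normP[eps /= /ofR_eps[e e0 ->] H].
have [q hq tq] := th_dense tau_gt0 (f p.1 p.2) e0.
exists (p.1 + (q - f p.1 p.2) * dl, p.2 + (q - f p.1 p.2) *: dx); split.
  by apply: H; rewrite /= /ball_ sub0r normrN nmE ltcR.
by rewrite /= fE addrC subrK.
Qed.

Lemma dif_l (p : C * V) : differentiable (fun q : C * V => q.1) p.
Proof.
apply: (@linear_differentiable _ (C * V)%type C (fst : {linear (C * V)%type -> C})) => q.
exact: cvg_fst.
Qed.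
Lemma dif_x (p : C * V) : differentiable (fun q : C * V => q.2) p.
Proof.
apply: (@linear_differentiable _ (C * V)%type V (snd : {linear (C * V)%type -> V})) => q.
exact: cvg_snd.
Qed.
Lemma dif_coord i (p : C * V) : differentiable (fun q : C * V => q.2 0 i) p.
Proof.
apply: (@differentiable_comp _ _ _ _ snd (fun N : 'rV[C]_n => N 0 i)).
  exact: dif_x.
exact: differentiable_coord.
Qed.
Lemma dif_sx (p : C * V) : differentiable (fun q : C * V => sx q.2) p.
Proof.
apply: difM; first exact: dif_cst.
apply: (@dif_sum _ _ _ _ _ _ (fun i (q : C * V) => q.2 0 i + zz i)) => i.
by apply: difD; [exact: dif_coord|exact: dif_cst].
Qed.
Lemma dif_Sx (p : C * V) : differentiable (fun q : C * V => Sx q.2) p.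
Proof.
apply: (@dif_sum _ _ _ _ _ _ (fun i (q : C * V) => q.2 0 i + zz i + t i)) => i.
by apply: difD; [apply: difD; [exact: dif_coord|exact: dif_cst]|exact: dif_cst].
Qed.

Lemma gen_l c : gen (fun l (x : V) => theta (l + c) != 0).
Proof.
apply: (@gen_th _ 1 0) => [p|l x s]; first by apply: difD; [exact: dif_l|exact: dif_cst].
by rewrite mulr1 addrAC.
Qed.
Lemma gen_lS c : gen (fun l x => theta (l + c + Sx x) != 0).
Proof.
apply: (@gen_th _ 1 0) => [p|l x s].
  by apply: difD; [apply: difD; [exact: dif_l|exact: dif_cst]|exact: dif_Sx].
by rewrite mulr1 scaler0 addr0; ring.
Qed.
Lemma gen_ls c : gen (fun l x => theta (l + sx x + c) != 0).
Proof.
apply: (@gen_th _ 1 0) => [p|l x s].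
  by apply: difD; [apply: difD; [exact: dif_l|exact: dif_sx]|exact: dif_cst].
by rewrite mulr1 scaler0 addr0; ring.
Qed.
Lemma gen_x z c : gen (fun (l : C) (x : V) => forall i, theta (z + x 0 i + c) != 0).
Proof.
apply: gen_fin => i; apply: (@gen_th _ 0 (delta_mx 0 i)) => [p|l x s].
  by apply: difD; [apply: difD; [exact: dif_cst|exact: dif_coord]|exact: dif_cst].
by rewrite -/(dl i s) dl_eq -!addrA (addrC s) !addrA.
Qed.
Lemma gen_xx c : gen (fun (l : C) (x : V) => forall ij : 'I_n * 'I_n, ij.1 != ij.2 ->
  theta (x 0 ij.1 - x 0 ij.2 + c) != 0).
Proof.
apply: gen_fin => -[i j] /=; have [->|ij] := eqVneq i j; first by apply: genT.
have : gen (fun (l : C) (x : V) => theta (x 0 i - x 0 j + c) != 0).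
  apply: (@gen_th _ 0 (delta_mx 0 i)) => [p|l x s].
    by apply: difD; [apply: difB; exact: dif_coord|exact: dif_cst].
  by rewrite -/(dl i s) dl_eq dl_neq 1?eq_sym // -!addrA (addrC s) !addrA.
by apply: gen_imp => l x.
Qed.

(** Terms of the two double sums need to agree only after adding those of (i, j) and (j, i). *)
Lemma sum_pair_sym (T T' : 'I_n -> 'I_n -> C) :
  (forall i j, T i j + T j i = T' i j + T' j i) ->
  \sum_i \sum_j T i j = \sum_i \sum_j T' i j.
Proof.
move=> H; have two0 : (2 : C) != 0 by rewrite pnatr_eq0.
have D (U : 'I_n -> 'I_n -> C) : 2 * \sum_i \sum_j U i j = \sum_i \sum_j (U i j + U j i).
  rewrite mulr_natl mulr2n [in X in _ + X]exchange_big -big_split /=.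
  by apply: eq_bigr => i _; rewrite -big_split.
apply: (mulfI two0); rewrite !D; apply: eq_bigr => i _; apply: eq_bigr => j _.
exact: H.
Qed.

Lemma sum_pair_diag (T T' : 'I_n -> 'I_n -> C) :
  (forall i j, i != j -> T i j = T' i j) ->
  \sum_i \sum_j T i j = \sum_i \sum_j T' i j + \sum_i (T i i - T' i i).
Proof.
move=> H; rewrite -big_split; apply: eq_bigr => i _ /=.
rewrite (bigD1 i) //= [in RHS](bigD1 i) //=.
rewrite [in RHS](eq_bigr (T i)) => [|j ji]; last by rewrite H // eq_sym.
by rewrite [RHS]addrAC addrCA subrr addr0.
Qed.

Local Open Scope quotient_scope.
Local Notation "'L' P" := (@liftM R n P) (at level 9, P at level 8).

Ltac toQ f := elim/quotW => f; rewrite ?liftM_pi -?piMD ?liftM_pi -?piMD; apply/piM_eq.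

Lemma opAE z f l x : opA z f l x = Ax z l x * f (l - h) x.
Proof. by []. Qed.
Lemma opAiE z f l x : opAi z f l x = (Ax z (l + h) x)^-1 * f (l + h) x.
Proof. by []. Qed.
Lemma opEE z f l x : opE z f l x = \sum_i ec z i l x * f (l + 2 * h) (x + dl i (- h)).
Proof. by []. Qed.
Lemma opFE z f l x : opF z f l x = \sum_i fc z i l x * f (l + 0) (x + dl i h).
Proof. by []. Qed.
Lemma opKE z f l x : opK z f l x = Kc z l x * f (l + h) x.
Proof. by []. Qed.
Lemma opYE z w f l x : opY z w f l x = \sum_i yc z w i l x * f (l + 2 * h) (x + dl i (- h)).
Proof. by []. Qed.
Lemma opXE z w f l x : opX z w f l x = \sum_i xc z w i l x * f (l + 0) (x + dl i h).
Proof. by []. Qed.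
Lemma opGE z w f l x : opG z w f l x = gc z w l x * f (l + 0) x.
Proof. by []. Qed.
Lemma opSE s f l x : opS s f l x = s l * f (l + 0) x.
Proof. by []. Qed.
Lemma opHE s f l x : opH s f l x = s (l + sx x) * f (l + 0) x.
Proof. by []. Qed.
Lemma addME (f g : M) l x : (f + g) l x = f l x + g l x.
Proof. by []. Qed.
Definition opE_def := (opAE, opAiE, opEE, opFE, opKE, opYE, opXE, opGE, opSE, opHE, addME).

Lemma alN u l : al u (- l) = theta (l - h) * theta u / (theta l * theta (u - h)).
Proof. by rewrite /al thN // (_ : - l + h = - (l - h)); [rewrite thN //; gen_thetas => *; rewrite !(mulNr, invrN, mulrN) opprK|ring]. Qed.
Lemma beN u l : be u (- l) = theta (u - l) * theta h / (theta l * theta (u - h)).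
Proof. by rewrite /be thN // (addrC (- l)) mulNr [in (- _)^-1]invrN mulrN opprK. Qed.

(** Used with P = Q an instance of Fay's identity: the difference of the two sides of a relation
    is a rational multiple of the difference of the two sides of Fay's identity. *)
Lemma eq_by (c A B P Q : C) : P = Q -> A - B = c * (P - Q) -> A = B.
Proof. by move=> -> /eqP; rewrite subrr mulr0 subr_eq0 => /eqP. Qed.

Lemma rel_AA z w v : L(opA z) (L(opA w) v) = L(opA w) (L(opA z) v).
Proof.
elim/quotW: v => f; rewrite !liftM_pi; apply/piM_eq/genT => l x.
by rewrite /= /Lop /Ax; ring.
Qed.

Lemma rel_KK z w v : L(opK z) (L(opK w) v) = L(opK w) (L(opK z) v).
Proof.
elim/quotW: v => f; rewrite !liftM_pi; apply/piM_eq/genT => l x.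
by rewrite /= /Lop /Kc; ring.
Qed.

(** The values of theta that occur in denominators. *)
Record generic (z w l : C) (x : V) : Prop := Generic {
  nz_l0 : theta l != 0; nz_l1 : theta (l + h) != 0; nz_l2 : theta (l + 2 * h) != 0;
  nz_lm : theta (l - h) != 0;
  nz_S0 : theta (l + Sx x) != 0; nz_Sm : theta (l - h + Sx x) != 0; nz_S1 : theta (l + h + Sx x) != 0;
  nz_S2 : theta (l + 2 * h + Sx x) != 0;
  nz_s0 : theta (l + sx x) != 0; nz_s2 : theta (l + sx x + 2 * h) != 0;
  nz_s3 : theta (l + sx x + 3 * h) != 0;
  nz_z0 : forall i, theta (z + x 0 i) != 0; nz_z1 : forall i, theta (z + x 0 i + h) != 0;
  nz_z2 : forall i, theta (z + x 0 i + 2 * h) != 0; nz_zm : forall i, theta (z + x 0 i - h) != 0;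
  nz_w0 : forall i, theta (w + x 0 i) != 0; nz_w1 : forall i, theta (w + x 0 i + h) != 0;
  nz_w2 : forall i, theta (w + x 0 i + 2 * h) != 0; nz_wm : forall i, theta (w + x 0 i - h) != 0;
  nz_x0 : forall i j, i != j -> theta (x 0 i - x 0 j) != 0;
  nz_x1 : forall i j, i != j -> theta (x 0 i - x 0 j + h) != 0 }.

Lemma generic_gen z w : gen (generic z w).
Proof.
have := gen_and (gen_l 0) (gen_and (gen_l h) (gen_and (gen_l (2 * h)) (gen_and (gen_l (- h))
  (gen_and (gen_lS 0) (gen_and (gen_lS (- h)) (gen_and (gen_lS h) (gen_and (gen_lS (2 * h))
  (gen_and (gen_ls 0) (gen_and (gen_ls (2 * h)) (gen_and (gen_ls (3 * h))
  (gen_and (gen_x z 0) (gen_and (gen_x z h) (gen_and (gen_x z (2 * h)) (gen_and (gen_x z (- h))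
  (gen_and (gen_x w 0) (gen_and (gen_x w h) (gen_and (gen_x w (2 * h)) (gen_and (gen_x w (- h))
  (gen_and (gen_xx 0) (gen_xx h)))))))))))))))))))).
apply: gen_imp => l x [a1 [a2 [a3 [a4 [b1 [bm [b2 [b3 [c1 [c2 [c3 [d1 [d2 [d3 [d4 [e1 [e2 [e3 [e4 [g1 g2]]]]]]]]]]]]]]]]]]]].
rewrite addr0 in a1; rewrite addr0 in b1; rewrite addr0 in c1.
split; try assumption.
- by move=> i; have := d1 i; rewrite addr0.
- by move=> i; have := e1 i; rewrite addr0.
- by move=> i j ij; have := g1 (i, j) ij; rewrite addr0.
- by move=> i j ij; exact: (g2 (i, j) ij).
Qed.

Lemma rel_AE z w v : theta (z - w - h) != 0 ->
  L(opA z) (L(opE w) v) = L(opS (fun l => al (z - w) (l + h))) (L(opE w) (L(opA z) v))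
    + L(opS (fun l => be (z - w) (- (l + h)))) (L(opA z) (L(opE z) v)).
Proof.
move=> u0; move: v; toQ f.
apply: gen_imp (generic_gen z w) => l x g.
rewrite !opE_def !mulr_sumr -big_split; apply: eq_bigr => i _; rewrite !opE_def [in RHS]/=.
f_merge f; move: (f _ _) => {}f.
rewrite /Ax /ec Qx_dl Sx_dl !(Qx_D1 i) beN /al.
have := fay_AE tau_gt0 (z + x 0 i) (w + x 0 i) h l.
move: (Qi i z x) (Dp i x) => q d F.
apply: (eq_by (c := - q * d * f / (theta l * theta (w + x 0 i) * theta (l + h) * theta (z - w - h))) F).
move: u0 (nz_l0 g) (nz_l1 g) (nz_l2 g) (nz_S0 g) (nz_S1 g) (nz_z0 g i) (nz_w0 g i).
by clear F g; th_solve.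
Qed.

Lemma rel_AEA z w v : theta (z - w - h) != 0 ->
  L(opA z) (L(opE z) (L(opA w) v)) = L(opA w) (
    L(opS (fun l => al (z - w) (- (l + h)))) (L(opA z) (L(opE z) v))
    + L(opS (fun l => be (z - w) (l + h))) (L(opE w) (L(opA z) v))).
Proof.
move=> u0; move: v; toQ f.
apply: gen_imp (generic_gen z w) => l x g.
rewrite !opE_def !mulr_sumr -big_split mulr_sumr.
apply: eq_bigr => i _; rewrite !opE_def [in RHS]/=.
f_merge f; move: (f _ _) => {}f.
rewrite /Ax /ec !Qx_dl !Sx_dl !(Qx_D1 i) alN /be.
have := fay_AEA tau_gt0 (z + x 0 i) (w + x 0 i) h l.
move: (Qi i z x) (Qi i w x) (Dp i x) => q p d F.
apply: (eq_by (c := - q * p * d * f * theta (l + Sx x) /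
  (theta l * theta (l + h) * theta l * theta (z - w - h))) F).
move: u0 (nz_l0 g) (nz_l1 g) (nz_lm g) (nz_S0 g) (nz_Sm g) (nz_z0 g i) (nz_w0 g i).
by clear F g; th_solve.
Qed.

Lemma rel_AFA z w v : theta (z - w - h) != 0 ->
  L(opH (al (z - w))) (L(opA z) (L(opF w) (L(opA w) v)))
  + L(opH (be (z - w))) (L(opF z) (L(opA z) (L(opA w) v)))
  = L(opF w) (L(opA w) (L(opA z) v)).
Proof.
move=> u0; move: v; toQ f.
apply: gen_imp (generic_gen z w) => l x g.
rewrite !opE_def !mulr_sumr -big_split; apply: eq_bigr => i _; rewrite !opE_def [in LHS]/=.
f_merge f; move: (f _ _) => {}f.
rewrite /Ax /fc !Qx_dl !Sx_dl !(Qx_D1 i) /al /be.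
have := fay_AFA tau_gt0 (l + sx x) (z + x 0 i) (w + x 0 i) h.
move: (Qi i z x) (Qi i w x) (Dm i x) => q p d F.
apply: (eq_by (c := q * p * d * f * theta (l + Sx x) /
  (theta l * theta (l - h) * theta (l + sx x) * theta (z - w - h))) F).
move: u0 (nz_l0 g) (nz_lm g) (nz_S0 g) (nz_S1 g) (nz_s0 g) (nz_z1 g i) (nz_w1 g i).
by clear F g; th_solve.
Qed.

Lemma rel_FAA z w v : theta (z - w - h) != 0 ->
  L(opH (fun l => al (z - w) (- l))) (L(opF z) (L(opA z) (L(opA w) v)))
  + L(opH (fun l => be (z - w) (- l))) (L(opA z) (L(opF w) (L(opA w) v)))
  = L(opA w) (L(opF z) (L(opA z) v)).
Proof.
move=> u0; move: v; toQ f.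
apply: gen_imp (generic_gen z w) => l x g.
rewrite !opE_def !mulr_sumr -big_split; apply: eq_bigr => i _; rewrite !opE_def [in LHS]/=.
f_merge f; move: (f _ _) => {}f.
rewrite /Ax /fc !Qx_dl !Sx_dl !(Qx_D1 i) alN beN.
have := fay_FAA tau_gt0 (l + sx x) (z + x 0 i) (w + x 0 i) h.
move: (Qi i z x) (Qi i w x) (Dm i x) => q p d F.
apply: (eq_by (c := q * p * d * f * theta (l + Sx x) /
  (theta l * theta (l - h) * theta (l + sx x) * theta (z - w - h))) F).
move: u0 (nz_l0 g) (nz_lm g) (nz_S0 g) (nz_S1 g) (nz_s0 g) (nz_z1 g i) (nz_w1 g i).
by clear F g; th_solve.
Qed.

Lemma rel_Y1 z w v : theta (z - w - h) != 0 ->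
  L(opE z) v = L(opS (be (z - w))) (L(opE w) v) + L(opS (al (z - w))) (L(opY z w) v).
Proof.
move=> u0; move: v; toQ f.
apply: gen_imp (generic_gen z w) => l x g.
rewrite !opE_def !mulr_sumr -big_split; apply: eq_bigr => i _; rewrite [in RHS]/=.
f_merge f; move: (f _ _) => {}f.
rewrite /ec /yc /al /be !addr0.
have := fay_Y1 tau_gt0 (z + x 0 i) (w + x 0 i) h l.
move: (Dp i x) => d F.
apply: (eq_by (c := - d * f / theta (l + h + Sx x) / (theta (z + x 0 i) * theta (w + x 0 i) *
  theta l * theta (z - w - h))) F).
move: u0 (nz_l0 g) (nz_S1 g) (nz_z0 g i) (nz_w0 g i).
by clear F g; th_solve.
Qed.

Lemma rel_Y3 z w v : theta (z - w - h) != 0 ->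
  L(opY w z) v = L(opS (fun l => be (z - w) (- l))) (L(opY z w) v)
    + L(opS (fun l => al (z - w) (- l))) (L(opE w) v).
Proof.
move=> u0; move: v; toQ f.
apply: gen_imp (generic_gen z w) => l x g.
rewrite !opE_def !mulr_sumr -big_split; apply: eq_bigr => i _; rewrite [in RHS]/=.
f_merge f; move: (f _ _) => {}f.
rewrite /ec /yc alN beN !addr0.
have := fay_Y3 tau_gt0 (z + x 0 i) (w + x 0 i) h l.
move: (Dp i x) => d F.
apply: (eq_by (c := - d * f / theta (l + h + Sx x) / (theta (z + x 0 i) * theta (w + x 0 i) *
  theta l * theta (z - w - h))) F).
move: u0 (nz_l0 g) (nz_S1 g) (nz_z0 g i) (nz_w0 g i).
by clear F g; th_solve.
Qed.

Lemma rel_X1 z w v : theta (z - w - h) != 0 ->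
  L(opF z) v = L(opF w) (L(opH (fun l => be (z - w) (- l))) v)
    + L(opX z w) (L(opH (al (z - w))) v).
Proof.
move=> u0; move: v; toQ f.
apply: gen_imp (generic_gen z w) => l x g.
rewrite !opE_def -big_split; apply: eq_bigr => i _; rewrite !opE_def [in RHS]/=.
f_merge f; move: (f _ _) => {}f.
rewrite /fc /xc sx_dl beN /al.
have := fay_X1 tau_gt0 (l + sx x) (z + x 0 i) (w + x 0 i) h.
move: (Dm i x) => d F.
apply: (eq_by (c := - d * f / theta (l + h + Sx x) / (theta (z + x 0 i + h) *
  theta (w + x 0 i + h) * theta (l + sx x + 2 * h) * theta (z - w - h))) F).
move: u0 (nz_s2 g) (nz_s3 g) (nz_S1 g) (nz_z1 g i) (nz_w1 g i).
by clear F g; th_solve.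
Qed.

Lemma rel_X3 z w v : theta (z - w - h) != 0 ->
  L(opX w z) v = L(opX z w) (L(opH (be (z - w))) v)
    + L(opF w) (L(opH (fun l => al (z - w) (- l))) v).
Proof.
move=> u0; move: v; toQ f.
apply: gen_imp (generic_gen z w) => l x g.
rewrite !opE_def -big_split; apply: eq_bigr => i _; rewrite !opE_def [in RHS]/=.
f_merge f; move: (f _ _) => {}f.
rewrite /fc /xc sx_dl alN /be.
have := fay_X3 tau_gt0 (l + sx x) (z + x 0 i) (w + x 0 i) h.
move: (Dm i x) => d F.
apply: (eq_by (c := - d * f * theta (l + sx x + h) / theta (l + h + Sx x) /
  (theta (l + sx x + 3 * h) * theta (z + x 0 i + h) *
  theta (w + x 0 i + h) * theta (l + sx x + 2 * h) * theta (z - w - h))) F).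
move: u0 (nz_s2 g) (nz_s3 g) (nz_S1 g) (nz_z1 g i) (nz_w1 g i).
by clear F g; th_solve.
Qed.

Lemma rel_Y2 z w v : L(opA z) (L(opE z) (L(opK w) v)) = L(opA z) (L(opK w) (L(opY z w) v)).
Proof.
move: v; toQ f.
apply: gen_imp (generic_gen z w) => l x g.
rewrite !opE_def !mulr_sumr; apply: eq_bigr => i _; rewrite !opE_def.
f_merge f; move: (f _ _) => {}f.
rewrite /ec /yc /Kc !Qx_dl !Sx_dl !sx_dl !(Qx_D1 i (w + h)) !invfM.
move: (Qi i (w + h) x)^-1 (Dp i x) (del w) (Ax z l x) => q d D A.
move: (nz_S0 g) (nz_S1 g) (nz_z0 g i) (nz_w0 g i) (nz_w1 g i).
by clear g; th_solve.
Qed.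

Lemma rel_X2 z w v : L(opK w) (L(opF z) v) = L(opX z w) (L(opK w) v).
Proof.
move: v; toQ f.
apply: gen_imp (generic_gen z w) => l x g.
rewrite !opE_def !mulr_sumr; apply: eq_bigr => i _; rewrite !opE_def.
f_merge f; move: (f _ _) => {}f.
rewrite /fc /xc /Kc !Qx_dl !Sx_dl !sx_dl !(Qx_D1 i (w + h)) !invfM.
move: (Qi i (w + h) x)^-1 (Dm i x) (del w) => q d D.
move: (nz_S1 g) (nz_S2 g) (nz_s3 g) (nz_z1 g i) (nz_w1 g i) (nz_w2 g i).
by clear g; th_solve.
Qed.

Lemma rel_HAK z w v : theta (z - w - h) != 0 ->
  L(opH (al (z - w))) (L(opA z) (L(opK w) v)) = L(opS (al (z - w))) (L(opK w) (L(opA z) v)).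
Proof.
move=> u0; move: v; toQ f.
apply: gen_imp (generic_gen z w) => l x g.
rewrite !opE_def; f_merge f; move: (f _ _) => {}f.
rewrite /Ax /Kc /al; move: (Qx z x) (Qx (w + h) x)^-1 (del w) => q p d.
move: u0 (nz_s0 g) (nz_S0 g) (nz_S1 g) (nz_l0 g) (nz_l1 g).
by clear g; th_solve.
Qed.

Lemma opSA (s : C -> C) z v :
  L(opS s) (L(opA z) v) = L(opA z) (L(opS (fun l => s (l + h))) v).
Proof.
move: v; toQ f; apply: genT => l x; rewrite !opE_def.
by f_merge f; s_merge s; move: (f _ _) (s _) (Ax z) => ? ? ?; rewrite addr0; ring.
Qed.

Lemma opSF (s : C -> C) z v : L(opS s) (L(opF z) v) = L(opF z) (L(opS s) v).
Proof.
move: v; toQ f; apply: genT => l x; rewrite !opE_def mulr_sumr; apply: eq_bigr => i _.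
by rewrite !opE_def !addr0 mulrCA.
Qed.
Lemma opSX (s : C -> C) z w v : L(opS s) (L(opX z w) v) = L(opX z w) (L(opS s) v).
Proof.
move: v; toQ f; apply: genT => l x; rewrite !opE_def mulr_sumr; apply: eq_bigr => i _.
by rewrite !opE_def !addr0 mulrCA.
Qed.
Lemma opSG (s : C -> C) z w v : L(opS s) (L(opG z w) v) = L(opG z w) (L(opS s) v).
Proof. by move: v; toQ f; apply: genT => l x; rewrite !opE_def !addr0 mulrCA. Qed.

Lemma opSKA (s : C -> C) z w v :
  L(opK w) (L(opA z) (L(opS s) v)) = L(opS s) (L(opK w) (L(opA z) v)).
Proof.
move: v; toQ f; apply: genT => l x; rewrite !opE_def !addr0 addrK.
by move: (f _ _) (s _) (Ax z _ _) (Kc w _ _) => ? ? ? ?; ring.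
Qed.
Lemma opSAK (s : C -> C) z w v :
  L(opA w) (L(opK z) (L(opS s) v)) = L(opS s) (L(opA w) (L(opK z) v)).
Proof.
move: v; toQ f; apply: genT => l x; rewrite !opE_def !addr0 subrK.
by move: (f _ _) (s _) (Ax w _ _) (Kc z _ _) => ? ? ? ?; ring.
Qed.

Lemma Qx_neq0 z (x : V) : (forall i, theta (z + x 0 i) != 0) -> Qx z x != 0.
Proof. by move=> H; apply/prodf_neq0 => i _; exact: H. Qed.

Lemma opAK z v : L(opA z) (L(opAi z) v) = v.
Proof.
move: v; elim/quotW => f; rewrite !liftM_pi; apply/piM_eq.
apply: gen_imp (generic_gen z z) => l x g; rewrite !opE_def subrK mulVKf //.
by rewrite /Ax !mulf_neq0 ?invr_eq0 ?Qx_neq0 ?(nz_S0 g) ?(nz_l0 g) //; exact: (nz_z0 g).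
Qed.
Lemma opAiK z v : L(opAi z) (L(opA z) v) = v.
Proof.
move: v; elim/quotW => f; rewrite !liftM_pi; apply/piM_eq.
apply: gen_imp (generic_gen z z) => l x g; rewrite !opE_def addrK mulKf //.
by rewrite /Ax !mulf_neq0 ?invr_eq0 ?Qx_neq0 ?(nz_S1 g) ?(nz_l1 g) //; exact: (nz_z0 g).
Qed.

Definition Qij (i j : 'I_n) (z : C) (x : V) : C := \prod_(k | (k != i) && (k != j)) theta (z + x 0 k).
Lemma Qx_D2 i j z (x : V) : i != j ->
  Qx z x = theta (z + x 0 i) * theta (z + x 0 j) * Qij i j z x.
Proof.
by move=> ij; rewrite /Qx (bigD1 i) //= (bigD1 j) 1?eq_sym //= mulrA.
Qed.
Lemma Qij_dl i j k q z (x : V) : k \in [:: i; j] -> Qij i j z (x + dl k q) = Qij i j z x.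
Proof.
move=> kij; apply: eq_bigr => m /andP[mi mj]; rewrite dl_neq //.
by apply: contraTneq kij => <-; rewrite !inE negb_or mi mj.
Qed.
Lemma Qij_sym i j z (x : V) : Qij i j z x = Qij j i z x.
Proof. by apply: eq_bigl => k; rewrite andbC. Qed.

Definition Dg (s : 'I_n -> C) (i : 'I_n) (x : V) : C :=
  \prod_k theta (- x 0 i - zz k + s k) / xden i x.
Lemma DpE i x : Dp i x = Dg (fun k => - t k) i x. Proof. by []. Qed.
Lemma DmE i x : Dm i x = Dg t i x. Proof. by []. Qed.

Definition Npair (s s' : 'I_n -> C) (i j : 'I_n) (x : V) : C :=
  (\prod_k theta (- x 0 i - zz k + s k) * \prod_k theta (- x 0 j - zz k + s' k)) /
  (\prod_(k | (k != i) && (k != j)) theta (x 0 i - x 0 k) *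
   \prod_(k | (k != i) && (k != j)) theta (x 0 j - x 0 k)).
Lemma Npair_sym s s' i j x : Npair s s' i j x = Npair s' s j i x.
Proof.
have e a : \prod_(k | (k != j) && (k != i)) theta (x 0 a - x 0 k) =
  \prod_(k | (k != i) && (k != j)) theta (x 0 a - x 0 k).
  by apply: eq_bigl => k; rewrite andbC.
by rewrite /Npair !e; congr (_ * _^-1); exact: mulrC.
Qed.

Lemma xdenE i j (x : V) : i != j -> xden i x =
  theta (x 0 i - x 0 j) * \prod_(k | (k != i) && (k != j)) theta (x 0 i - x 0 k).
Proof. by move=> ij; rewrite /xden (bigD1 j) 1?eq_sym. Qed.

(** Only the factors that involve both i and j see the order of the two shifts. *)
Lemma Dg_pair s s' i j q (x : V) : i != j ->
  Dg s i x * Dg s' j (x + dl i q) =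
  Npair s s' i j x / (theta (x 0 i - x 0 j) * theta (x 0 j - x 0 i - q)).
Proof.
move=> ij; have ji : j != i by rewrite eq_sym.
rewrite /Dg (xdenE _ ij) (xdenE _ ji) dl_eq !(dl_neq _ _ ji).
have -> : \prod_(k | (k != j) && (k != i)) theta (x 0 j - (x + dl i q) 0 k) =
          \prod_(k | (k != i) && (k != j)) theta (x 0 j - x 0 k).
  by rewrite (eq_bigl _ _ (fun k => andbC _ _)); apply: eq_bigr => k /andP[ki _]; rewrite dl_neq.
rewrite /Npair (_ : x 0 j - (x 0 i + q) = x 0 j - x 0 i - q); last by rewrite opprD addrA.
rewrite !invfM; move: (\prod_k _) (\prod_k _) (\prod_(k | _) _)^-1 (\prod_(k | _) _)^-1.
by move: (theta _)^-1 (theta _)^-1 => *; ring.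
Qed.

(** The part of the coefficient of the shifts of p = x_i and q = x_j which is not symmetric in
    the two variables. *)
Definition pairc (z w p q l g : C) : C :=
  theta (z + q) * theta (z + p + l) * (theta (w + q + l + g) * theta (w + p - g)) /
  (theta (p - q) * theta (q - p + g)).

(** By Fay's identity each coefficient splits into a part symmetric in z and w and a part
    whose sum over the two orders is. *)
Lemma pairc_sym (z w p q l g : C) : theta l != 0 -> theta (p - q) != 0 ->
  theta (q - p + g) != 0 -> theta (p - q + g) != 0 ->
  pairc z w p q l g + pairc z w q p l g = pairc w z p q l g + pairc w z q p l g.
Proof.
move=> l0 pq0 q0 p0.
(* Fay's identity, solved for the product in which p' and q' are mixed. *)
have Fl (b p' q' : C) : theta (p' - q') != 0 ->
   theta (b + q' + l + g) * theta (b + p' - g) =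
   ((theta (l + g + q' - p') * theta g * theta (l + b + p') * theta (b + q')) +
    (theta (l + g) * theta (p' - q' - g) * theta (l + b + q') * theta (b + p'))) /
   (theta l * theta (p' - q')).
  move=> e0; rewrite -(fay_AEAE tau_gt0 b g l p' q').
  by move: l0 e0; gen_thetas => ? ?; fieldn0.
have qp0 : theta (q - p) != 0 by rewrite -opprB thN // oppr_eq0.
rewrite /pairc (Fl w p q) // (Fl w q p) // (Fl z p q) // (Fl z q p) //.
have e1 : theta (q - p) = - theta (p - q) by rewrite -thN // opprB.
have e2 : theta (p - q - g) = - theta (q - p + g).
  by rewrite -thN //; congr (theta _); ring.
have e3 : theta (q - p - g) = - theta (p - q + g).
  by rewrite -thN //; congr (theta _); ring.
rewrite e1 e2 e3.
rewrite (_ : l + w + p = w + p + l); last by ring.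
rewrite (_ : l + w + q = w + q + l); last by ring.
rewrite (_ : l + z + p = z + p + l); last by ring.
rewrite (_ : l + z + q = z + q + l); last by ring.
move: l0 pq0 q0 p0; clear; gen_thetas => l0 pq0 q0 p0.
by field; rewrite ?oppr_eq0 l0 pq0 q0 p0.
Qed.

Lemma mul_shuffle (A e d s B e' d' s' F : C) :
  A * (- e * (d / s) * (B * (- e' * (d' / s') * F))) = (A * (e / s) * B * (e' / s') * F) * (d * d').
Proof. by move: (s^-1) (s'^-1) => *; ring. Qed.

Lemma rel_AEAE z w v :
  L(opA z) (L(opE z) (L(opA w) (L(opE w) v))) = L(opA w) (L(opE w) (L(opA z) (L(opE z) v))).
Proof.
move: v; toQ f.
apply: gen_imp (generic_gen z w) => l x g.
pose T z w i j := Ax z l x * (ec z i (l - h) x * (Ax w (l - h + 2 * h) (x + dl i (- h)) *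
   (ec w j (l - h + 2 * h - h) (x + dl i (- h)) *
     f (l - h + 2 * h - h + 2 * h) (x + dl i (- h) + dl j (- h))))).
have TE z' w' : opA z' (opE z' (opA w' (opE w' f))) l x = \sum_i \sum_j T z' w' i j.
  rewrite !opE_def mulr_sumr; apply: eq_bigr => i _; rewrite !opE_def !mulr_sumr.
  by apply: eq_bigr.
rewrite !TE; apply: sum_pair_sym => i j.
have [<-|ij] := eqVneq i j.
  rewrite /T /Ax /ec !Qx_dl !Sx_dl !(Qx_D1 i) !dl_eq.
  clear T TE; f_merge f; move: (f _ _) (Qi i z x) (Qi i w x) (Dp i x) (Dp i _) => {}f q p d d'.
  move: (nz_l0 g) (nz_l1 g) (nz_S0 g) (nz_z0 g i) (nz_w0 g i) (nz_zm g i) (nz_wm g i).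
  by clear g; th_solve.
have ji : j != i by rewrite eq_sym.
(* For different indices the coefficient is symmetric up to [pairc]. *)
have Toff z' w' i' j' : i' != j' ->
  (forall k, theta (z' + x 0 k) != 0) -> (forall k, theta (w' + x 0 k) != 0) ->
  (forall k, theta (z' + x 0 k - h) != 0) -> (forall k, theta (w' + x 0 k - h) != 0) ->
  T z' w' i' j' = Qij i' j' z' x * Qij i' j' w' x * Npair (fun k => - t k) (fun k => - t k) i' j' x *
   (theta (l + Sx x) / (theta l * theta (l + h))) / theta (l + Sx x) *
   f (l + 2 * h) (x + dl i' (- h) + dl j' (- h)) * pairc z' w' (x 0 i') (x 0 j') l h.
  move=> ij' z0 w0 zm wm; have ji' : j' != i' by rewrite eq_sym.
  have D := Dg_pair (fun k => - t k) (fun k => - t k) (- h) x ij'.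
  rewrite /T /ec mul_shuffle !DpE.
  rewrite D /Ax !(Qx_D2 _ _ ij') !Qij_dl ?inE ?eqxx ?orbT // !Sx_dl !dl_eq !(dl_neq _ _ ji').
  rewrite /pairc; clear D T TE; f_merge f.
  move: (f _ _) (Qij _ _ _ _) (Qij _ _ _ _) (Npair _ _ _ _ _) => {}f q p N.
  move: (nz_x0 g ij') (nz_x1 g ji') (nz_l0 g) (nz_l1 g) (nz_S0 g) (z0 i') (z0 j') (w0 i') (w0 j') (wm i').
  by clear g z0 w0 zm wm; th_solve.
have Z0 := nz_z0 g; have Zm := nz_zm g; have W0 := nz_w0 g; have Wm := nz_wm g.
rewrite !Toff // !(Qij_sym j i) (Npair_sym _ _ j i) ![_ + dl j _ + _]addrAC.
have := pairc_sym z w (nz_l0 g) (nz_x0 g ij) (nz_x1 g ji) (nz_x1 g ij).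
move: (pairc _ _ _ _ _ _) (pairc _ _ _ _ _ _) (pairc _ _ _ _ _ _) (pairc _ _ _ _ _ _) => p1 p2 p3 p4.
move=> e; rewrite [Qij i j w x * _]mulrC -!mulrDr.
exact: (f_equal (fun y => _ * y) e).
Qed.

Lemma mul_shuffle2 (A e d s B e' d' s' F : C) :
  - e * (d / s) * (A * (- e' * (d' / s') * (B * F))) = (e / s * A * (e' / s') * B * F) * (d * d').
Proof. by move: (s^-1) (s'^-1) => *; ring. Qed.

(** The computation of [rel_AEAE] with h and lambda + s replaced by their opposites. *)
Lemma rel_FAFA z w v :
  L(opF z) (L(opA z) (L(opF w) (L(opA w) v))) = L(opF w) (L(opA w) (L(opF z) (L(opA z) v))).
Proof.
move: v; toQ f.
apply: gen_imp (generic_gen z w) => l x g.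
pose T z w i j := fc z i l x * (Ax z (l + 0) (x + dl i h) * (fc w j (l + 0 - h) (x + dl i h) *
   (Ax w (l + 0 - h + 0) (x + dl i h + dl j h) * f (l + 0 - h + 0 - h) (x + dl i h + dl j h)))).
have TE z' w' : opF z' (opA z' (opF w' (opA w' f))) l x = \sum_i \sum_j T z' w' i j.
  rewrite !opE_def; apply: eq_bigr => i _; rewrite !opE_def !mulr_sumr.
  by apply: eq_bigr.
rewrite !TE; apply: sum_pair_sym => i j.
have [<-|ij] := eqVneq i j.
  rewrite /T /Ax /fc !Qx_dl !Sx_dl !sx_dl !Qi_dl !dl_eq.
  clear T TE; f_merge f; move: (f _ _) (Qi i z x) (Qi i w x) (Dm i x) (Dm i _) => {}f q p d d'.
  move: (nz_l0 g) (nz_lm g) (nz_S0 g) (nz_S1 g) (nz_z1 g i) (nz_w1 g i) (nz_z2 g i) (nz_w2 g i).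
  by clear g; th_solve.
have ji : j != i by rewrite eq_sym.
have Toff z' w' i' j' : i' != j' ->
  (forall k, theta (z' + x 0 k + h) != 0) -> (forall k, theta (w' + x 0 k + h) != 0) ->
  T z' w' i' j' = Qij i' j' z' x * Qij i' j' w' x * Npair t t i' j' x /
   (theta l * theta (l - h)) * f (l - h - h) (x + dl i' h + dl j' h) *
   pairc z' w' (x 0 i') (x 0 j') (- (l + sx x)) (- h).
  move=> ij' z0 w0; have ji' : j' != i' by rewrite eq_sym.
  have D := Dg_pair t t h x ij'.
  rewrite /T /fc mul_shuffle2 !DmE.
  rewrite D /Ax !(Qx_D2 _ _ ij') !Qij_dl ?inE ?eqxx ?orbT // !Sx_dl !sx_dl !(dl_eq, dl_neq _ _ ji', dl_neq _ _ ij').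
  rewrite /pairc; clear D T TE; f_merge f.
  move: (f _ _) (Qij _ _ _ _) (Qij _ _ _ _) (Npair _ _ _ _ _) => {}f q p N.
  have x1 : theta (x 0 j' - x 0 i' - h) != 0.
    by rewrite -oppr_eq0 -thN // (_ : - (x 0 j' - x 0 i' - h) = x 0 i' - x 0 j' + h);
      [exact: (nz_x1 g ij')|ring].
  move: (nz_x0 g ij') x1 (nz_l0 g) (nz_lm g) (nz_S0 g) (nz_S1 g) (z0 i') (w0 j').
  by clear g z0 w0; th_solve.
have Z1 := nz_z1 g; have W1 := nz_w1 g.
rewrite !Toff // !(Qij_sym j i) (Npair_sym _ _ j i) ![_ + dl j _ + _]addrAC.
have L0 : theta (- (l + sx x)) != 0 by rewrite thN // oppr_eq0 (nz_s0 g).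
have x1 (i' j' : 'I_n) : i' != j' -> theta (x 0 j' - x 0 i' - h) != 0.
  move=> ij'; rewrite -oppr_eq0 -thN // (_ : - (x 0 j' - x 0 i' - h) = x 0 i' - x 0 j' + h);
      [exact: (nz_x1 g ij')|ring].
have := pairc_sym z w L0 (nz_x0 g ij) (x1 _ _ ij) (x1 _ _ ji).
move=> e; rewrite [Qij i j w x * _]mulrC -!mulrDr.
exact: (f_equal (fun y => _ * y) e).
Qed.

Lemma resPE i (x : V) : resP tau (fun i => x 0 i) zz t h i = Dp i x * Dm i (x + dl i (- h)).
Proof.
rewrite /resP /pole_num /Dp /Dm /xden !big_split /= dl_eq mulrACA -invfM.
congr (_ * _ / (_ * _)); apply: eq_bigr => k ki; last by rewrite dl_neq.
by congr (theta _); ring.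
Qed.
Lemma resME i (x : V) : resM tau (fun i => x 0 i) zz t h i = Dm i x * Dp i (x + dl i h).
Proof.
rewrite /resM /pole_num /Dp /Dm /xden !big_split /= dl_eq mulrC [in RHS]mulrACA -invfM mulrC.
rewrite [X in X / _]mulrC; congr (_ * _ / (_ * _)); apply: eq_bigr => k ki; last by rewrite dl_neq.
- by congr (theta _); ring.
- by congr (theta _); ring.
Qed.

(** For i <> j the shifts of x_i and x_j commute with the coefficients up to the oddness of
    theta; for i = j the two orders give the residues at - x_i and at - x_i - h. *)
Lemma rel_EF_commutator z w v :
  L(opA z) (L(opE z) (L(opF w) (L(opA w) v))) =
  L(opA z) (L(opF w) (L(opE z) (L(opA w) v))) + L(opG z w) v.
Proof.
move: v; toQ f.
apply: gen_imp (generic_gen z w) => l x g.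
have [T TE] : {T | forall i j, T i j = Ax z l x * (ec z i (l - h) x *
  (fc w j (l - h + 2 * h) (x + dl i (- h)) *
  (Ax w (l - h + 2 * h + 0) (x + dl i (- h) + dl j h) *
   f (l - h + 2 * h + 0 - h) (x + dl i (- h) + dl j h))))} by exact (exist _ (fun i j => _) (fun i j => erefl)).
have [T' TE'] : {T' | forall i j, T' i j = Ax z l x * (fc w j (l - h) x *
  (ec z i (l - h + 0) (x + dl j h) *
  (Ax w (l - h + 0 + 2 * h) (x + dl i (- h) + dl j h) *
   f (l - h + 0 + 2 * h - h) (x + dl i (- h) + dl j h))))} by exact (exist _ (fun i j => _) (fun i j => erefl)).
have -> : opA z (opE z (opF w (opA w f))) l x = \sum_i \sum_j T i j.
  rewrite opAE opEE mulr_sumr; apply: eq_bigr => i _; rewrite opFE [X in _ * X]mulr_sumr mulr_sumr.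
  by apply: eq_bigr => j _; rewrite TE opAE.
rewrite addME; have -> : opA z (opF w (opE z (opA w f))) l x = \sum_i \sum_j T' i j.
  rewrite exchange_big opAE opFE mulr_sumr; apply: eq_bigr => j _; rewrite opEE [X in _ * X]mulr_sumr mulr_sumr.
  by apply: eq_bigr => i _; rewrite TE' opAE [x + dl i (- h) + _]addrAC.
rewrite (@sum_pair_diag T T') => [|i j ij].
  congr (_ + _); rewrite opGE /gc /efsum mulr_sumr !mulr_suml; apply: eq_bigr => i _.
  rewrite resPE resME TE TE' {TE TE' T T'}.
  have dlK1 : x + dl i (- h) + dl i h = x by rewrite -addrA /dl -scalerDl addNr scale0r addr0.
  rewrite dlK1 (_ : sig (fun i => x 0 i) zz = sx x) //.
  rewrite /Ax /ec /fc !Sx_dl !sx_dl !dl_eq.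
  f_merge f; move: (f _ _) (Qx z x) (Qx w x) => {}f q p.
  move: (Dp i x) (Dm i x) (Dp i _) (Dm i _) => d1 d2 d3 d4.
  move: (nz_l0 g) (nz_l1 g) (nz_S0 g) (nz_S1 g) (nz_z0 g i) (nz_w0 g i) (nz_z1 g i) (nz_w1 g i).
  by clear g; th_solve.
have ji : j != i by rewrite eq_sym.
rewrite TE TE' {TE TE' T T'} /ec /fc.
have aux (A e d s e' d' s' F : C) : A * (- e * (d / s) * (- e' * (d' / s') * F)) =
  (A * (e / s) * (e' / s') * F) * (d * d') by move: (s^-1) (s'^-1) => *; ring.
rewrite !aux !DpE !DmE (Dg_pair _ _ _ _ ij) (Dg_pair _ _ _ _ ji) (Npair_sym _ _ j i).
rewrite !Sx_dl !sx_dl !(dl_neq _ _ ji, dl_neq _ _ ij) /Ax !Sx_dl.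
f_merge f; move: (f _ _) (Qx _ _) (Qx _ _) (Npair _ _ _ _ _) => {}f q p N.
have -> : theta (x 0 j - x 0 i) = - theta (x 0 i - x 0 j) by rewrite -thN // opprB.
have -> : theta (x 0 i - x 0 j - h) = - theta (x 0 j - x 0 i - - h).
  by rewrite -thN //; congr (theta _); ring.
rewrite mulrNN.
move: (nz_l0 g) (nz_S0 g) (nz_S1 g) (nz_x0 g ij) (nz_x1 g ji) (nz_z0 g i) (nz_w1 g j) (nz_l1 g).
by clear g; th_solve.
Qed.

Lemma Kpoles z (x : V) : (forall i, theta (z + x 0 i) != 0) ->
  del z / Qx (z + h) x = Qx z x * polesH tau (fun i => x 0 i) zz t h z.
Proof.
move=> z0; have Q0 := Qx_neq0 z0.
rewrite /polesH big_split /= -/(Qx z x) -/(del z).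
have -> : \prod_i theta (z + x 0 i + h) = Qx (z + h) x.
  by apply: eq_bigr => i _; rewrite addrAC.
by rewrite (_ : pole_num tau zz t h z = del z) // invfM [RHS]mulrCA mulVKf.
Qed.

(** Each partial sum is a nonconstant affine function of the x_i. *)
Lemma gen_kap : gen (fun (l : C) (x : V) => forall m, (m < #|{: 'I_n * bool}|)%N ->
  theta (kap (fun i => x 0 i) zz t m) != 0).
Proof.
pose N := #|{: 'I_n * bool}|.
have := @gen_fin _ _ 'I_N (fun m l x => theta (kap (fun i => x 0 i) zz t m) != 0) _.
move=> H; apply: gen_imp (H _) => [l x Hm m mN|m]; first exact: (Hm (Ordinal mN)).
pose s := drop m (enum {: 'I_n * bool}).
have s0 : (0 < size s)%N by rewrite size_drop -cardE subn_gt0.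
case E : s s0 => [//|k0 s'] _.
pose c := count (fun k : 'I_n * bool => k.1 == k0.1) s.
have c0 : c%:R != 0 :> C by rewrite pnatr_eq0 /c E /= eqxx.
(* c of the remaining factors involve the variable of k0, each with slope -1. *)
apply: (@gen_th _ 0 ((- c%:R^-1) *: delta_mx 0 k0.1)) => [p|l x q].
  rewrite /kap -/s.
  apply: (@dif_sum _ _ _ _ _ _ (fun k (q : C * V) => half_gap (fun i => q.2 0 i) zz t k)) => k.
  apply: difD; last exact: dif_cst.
  by apply: differentiableN; apply: difD; [exact: dif_coord|exact: dif_cst].
rewrite /kap -/s scalerA -/(dl k0.1 (q * - c%:R^-1)).
rewrite (eq_bigr (fun k => half_gap (fun i => x 0 i) zz t k + (q / c%:R) * (k.1 == k0.1)%:R)); last first.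
  move=> k _; rewrite /half_gap dlE; case: (k.1 == k0.1); rewrite ?mulr1 ?mulr0 ?addr0 //.
  by move: (if _ then _ else _) (c%:R^-1) => a b; ring.
rewrite big_split /= -mulr_sumr; congr (_ + _).
have -> : \sum_(k <- s) (k.1 == k0.1)%:R = c%:R :> C.
  by rewrite /c -sum1_count natr_sum [RHS]big_mkcond /=; apply: eq_bigr => k _; case: (_ == _).
by rewrite divfK.
Qed.

Lemma gen_sig : gen (fun (l : C) (x : V) => (0 < n)%N -> theta (sig (fun i => x 0 i) zz) != 0).
Proof.
have [n0|n0] := posnP n; first exact: genT.
pose i0 : 'I_n := Ordinal n0; have two0 : (2 : C) != 0 by rewrite pnatr_eq0.
have : gen (fun (l : C) (x : V) => theta (sx x) != 0).
  apply: (@gen_th _ 0 (2^-1 *: delta_mx 0 i0)) => [p|l x q]; first exact: dif_sx.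
  by rewrite scalerA -/(dl i0 (q / 2)) sx_dl mulrCA divff // mulr1.
by apply: gen_imp => l x.
Qed.

Lemma generic_ef z w : gen (fun l x =>
  theta (z - w) * efsum tau (fun i => x 0 i) zz t h z w l =
  theta h * (theta l * theta (z - w + l + sx x) * polesH tau (fun i => x 0 i) zz t h z
    - theta (z - w + l) * theta (l + sx x) * polesH tau (fun i => x 0 i) zz t h w) /\
  theta (z - w - l - sx x) * theta l * efsum tau (fun i => x 0 i) zz t h z w l
  + theta (l + (z - w)) * theta (l + sx x) * efsum tau (fun i => x 0 i) zz t h w z l
  = - theta (z - w) * theta (2 * l + sx x) *
    (theta h * theta (sx x) * polesH tau (fun i => x 0 i) zz t h z)).
Proof.
apply: gen_imp (gen_and (generic_gen z w) (gen_and gen_kap gen_sig)) => l x [g [k0 s0]].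
have xm i j : i != j -> theta (x 0 i - h - x 0 j) != 0.
  move=> ij; rewrite -oppr_eq0 -thN // (_ : - (x 0 i - h - x 0 j) = x 0 j - x 0 i + h); last by ring.
  by apply: (nz_x1 g); rewrite eq_sym.
have xp i j : i != j -> theta (x 0 i + h - x 0 j) != 0.
  by move=> ij; rewrite addrAC; exact: (nz_x1 g).
split.
  exact: (ef_split tau_gt0 k0 (nz_x0 g) l s0 (nz_z0 g) (nz_z1 g) (nz_w0 g) (nz_w1 g) xm xp).
exact: (ef_swap tau_gt0 k0 (nz_x0 g) l (nz_z0 g) (nz_z1 g) (nz_w0 g) (nz_w1 g) xm xp).
Qed.

Lemma rel_G1 z w v : theta (z - w - h) != 0 ->
  L(opH (al (z - w))) (L(opG z w) v) + L(opH (be (z - w))) (L(opK z) (L(opA w) v))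
  = L(opS (be (z - w))) (L(opK w) (L(opA z) v)).
Proof.
move=> u0; move: v; toQ f.
apply: gen_imp (gen_and (generic_gen z w) (generic_ef z w)) => l x [g [F _]].
rewrite !opE_def !addr0; f_merge f; move: (f _ _) => {}f.
rewrite /gc /Kc (Kpoles (nz_z0 g)) (Kpoles (nz_w0 g)) /Ax /al /be.
move: (efsum _ _ _ _ _ _ _ _) (polesH _ _ _ _ _ z) (polesH _ _ _ _ _ w) (Qx z x) (Qx w x) F
  => E Hz Hw q p F.
apply: (eq_by (c := theta (l + sx x + h) * q * p * f / (theta (l + sx x) * theta (z - w - h) *
  theta l * theta (l + h))) F).
move: u0 (nz_l0 g) (nz_l1 g) (nz_S1 g) (nz_s0 g).
by clear F g; th_solve.
Qed.

Lemma rel_G2 z w v : theta (z - w - h) != 0 ->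
  L(opS (al (z - w))) (L(opG w z) v) + L(opS (fun l => be (z - w) (- l))) (L(opA w) (L(opK z) v))
  = L(opH (fun l => be (z - w) (- l))) (L(opA z) (L(opK w) v)).
Proof.
move=> u0; move: v; toQ f.
apply: gen_imp (gen_and (generic_gen z w) (generic_ef w z)) => l x [g [F _]].
rewrite !opE_def !addr0; f_merge f; move: (f _ _) => {}f.
rewrite /gc /Kc (Kpoles (nz_z0 g)) (Kpoles (nz_w0 g)) /Ax !beN /al.
move: (efsum _ _ _ _ _ _ _ _) (polesH _ _ _ _ _ z) (polesH _ _ _ _ _ w) (Qx z x) (Qx w x) F
  => E Hz Hw q p.
rewrite (_ : w - z + l + sx x = - (z - w - (l + sx x))); last by ring.
rewrite (_ : w - z + l = - (z - w - l)); last by ring.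
rewrite -(opprB z w) !thN // !(mulNr, mulrN) => F.
apply: (eq_by (c := - q * p * f / (theta l * theta l * theta (z - w - h))) F).
move: u0 (nz_l0 g) (nz_l1 g) (nz_S0 g) (nz_s0 g).
by clear F g; th_solve.
Qed.

(** Combines [ef_swap] with the three-term identity [fay_sq]. *)
Lemma rel_G3 z w v : theta (z - w - h) != 0 ->
  L(opH (fun l => be (z - w) (- l))) (L(opG z w) v)
    + L(opH (fun l => al (z - w) (- l))) (L(opK z) (L(opA w) v))
  = L(opS (fun l => al (z - w) (- l))) (L(opA w) (L(opK z) v))
    + L(opS (be (z - w))) (L(opG w z) v).
Proof.
move=> u0; move: v; toQ f.
apply: gen_imp (gen_and (generic_gen z w) (generic_ef z w)) => l x [g [_ F1]].
rewrite !opE_def !addr0; f_merge f; move: (f _ _) => {}f.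
rewrite /gc /Kc (Kpoles (nz_z0 g)) /Ax !alN beN /be.
move: (efsum _ _ _ _ _ z w _) (efsum _ _ _ _ _ w z _) (polesH _ _ _ _ _ z) (Qx z x) (Qx w x) F1
  => E E' Hz q p F1.
have F2 := fay_sq tau_gt0 (l + sx x) h l.
(* The quadratic identity F2 absorbs the terms with the residue function. *)
have := congr2 +%R (congr1 (fun y => theta h * y) F1) (congr1 (fun y => theta (z - w) * Hz * y) F2).
rewrite /= => F.
apply: (eq_by (c := q * p * f / (theta (l + sx x) * theta l * theta l * theta (l + h) *
  theta (z - w - h))) F).
move: u0 (nz_l0 g) (nz_l1 g) (nz_S0 g) (nz_S1 g) (nz_s0 g).
by clear F F1 F2 g; th_solve.
Qed.

End GaussOperators.

(** * The determinant equation and the coefficients of b and c *)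

Section QuantumDeterminant.
Context {R : realType} (tau : Cplx R) (tau_gt0 : 0 < complex.Im tau).
Context {n : nat} (h : Cplx R) (zz t : 'I_n -> Cplx R).
Local Notation C := (Cplx R).
Local Notation V := ('rV[C]_n).
Local Notation M := (Mfun R n).
Local Notation theta := (th tau).
Local Notation opA := (opA tau h zz t).
Local Notation opE := (opE tau h zz t).
Local Notation opF := (opF tau h zz t).
Local Notation opK := (opK tau h zz t).
Local Open Scope quotient_scope.
Local Notation "'L' P" := (@liftM R n P) (at level 9, P at level 8).

Lemma rel_AFA_shifted z v : L(opA (z + h)) (L(opF z) (L(opA z) v)) =
  L(opF (z + h)) (L(opA (z + h)) (L(opA z) v)).
Proof.
move: v; elim/quotW => f; rewrite !liftM_pi; apply/piM_eq.
apply: gen_imp (generic_gen tau_gt0 h zz t z z) => l x g.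
rewrite !opE_def !mulr_sumr; apply: eq_bigr => i _; rewrite !opE_def.
f_merge f; move: (f _ _) => {}f.
rewrite /Ax /fc !Qx_dl !Sx_dl !(Qx_D1 _ i) ?Qi_dl ?dl_eq.
move: (Qi _ i z x) (Qi _ i (z + h) x) (Dm _ _ _ i x) => q p d.
move: (nz_l0 g) (nz_lm g) (nz_S0 g) (nz_S1 g) (nz_z1 g i) (nz_z2 g i).
by clear g; th_solve.
Qed.

Definition qdet (z : C) : M := fun l x => theta (l + sx zz x) / theta l * del tau h zz t z.
Definition opQ z := LopM (qdet z) 0.
Lemma opQE z f l x : opQ z f l x = qdet z l x * f (l + 0) x. Proof. by []. Qed.

Lemma rel_AK_qdet z v : L(opA (z + h)) (L(opK z) v) = L(opQ z) v.
Proof.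
move: v; elim/quotW => f; rewrite !liftM_pi; apply/piM_eq.
apply: gen_imp (generic_gen tau_gt0 h zz t z z) => l x g.
rewrite opQE !opE_def; f_merge f; move: (f _ _) => {}f.
have Q0 : Qx tau (z + h) x != 0.
  by apply: Qx_neq0 => i; rewrite addrAC; exact: (nz_z1 g).
rewrite /Ax /Kc /qdet; move: (Qx _ (z + h) x) (del _ _ _ _ z) Q0 => q d Q0.
move: Q0 (nz_l0 g) (nz_S0 g).
by clear g; th_solve.
Qed.

Lemma AE_coef z i l (x : V) : generic tau h zz t z z l x ->
  Ax tau zz t z l x * ec tau h zz t z i (l - h) x =
  - (theta (l + z + x 0 i) / theta l * (Qi tau i z x / xden tau i x)
     * \prod_k theta (- x 0 i - zz k - t k)).
Proof.
move=> g; rewrite /Ax /ec (Qx_D1 _ i) /Dp.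
move: (Qi _ i z x) (\prod_k _) (xden tau i x)^-1 => q p d.
move: (nz_l0 g) (nz_S0 g) (nz_z0 g i).
by clear g; th_solve.
Qed.

Lemma FA_coef z i l (x : V) : generic tau h zz t z z l x ->
  fc tau h zz t z i l x * Ax tau zz t z l (x + dl i h) =
  - (theta (- l + z + x 0 i - sx zz x) / theta l * (Qi tau i z x / xden tau i x)
     * \prod_k theta (- x 0 i - zz k + t k)).
Proof.
move=> g; rewrite /Ax /fc Qx_dl Sx_dl /Dm.
move: (Qi _ i z x) (\prod_k _) (xden tau i x)^-1 => q p d.
move: (nz_l0 g) (nz_S1 g) (nz_z1 g i).
by clear g; th_solve.
Qed.

End QuantumDeterminant.

(** * The L operator *)

Section LOperator.
Context {R : realType} (tau : Cplx R) (tau_gt0 : 0 < complex.Im tau).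
Context {n : nat} (h : Cplx R) (zz t : 'I_n -> Cplx R).
Local Notation C := (Cplx R).
Local Notation V := ('rV[C]_n).
Local Notation M := (Mfun R n).
Local Notation theta := (th tau).
Local Notation opA := (opA tau h zz t).
Local Notation opAi := (opAi tau h zz t).
Local Notation opE := (opE tau h zz t).
Local Notation opF := (opF tau h zz t).
Local Notation opK := (opK tau h zz t).
Local Notation sx := (sx zz).
Local Open Scope quotient_scope.
Local Notation "'L' P" := (@liftM R n P) (at level 9, P at level 8).

Ltac ent := let p := fresh "p" in move=> p; rewrite /joint; repeat lazymatch goal with
  | |- differentiable (fun _ => ?c) _ => exact: dif_cst
  | |- differentiable (fun q => fun_of_matrix (snd q) _ _) _ => exact: dif_coord
  | |- differentiable (fun q => fst q) _ => exact: dif_l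
  | |- differentiable (fun q => ?g (snd q)) _ => first [exact: dif_sx | exact: dif_Sx]
  | |- differentiable (fun q => GRing.opp (@?f q)) _ => apply: (@differentiableN _ _ _ f)
  | |- differentiable (fun q => GRing.add (@?f q) (GRing.opp (@?g q))) _ => apply: (@difB _ _ _ f g)
  | |- differentiable (fun q => GRing.add (@?f q) (@?g q)) _ => apply: (@difD _ _ _ f g)
  | |- differentiable (fun q => th _ (@?f q)) _ => apply: (@dif_theta _ _ tau_gt0 _ _ f)
  | |- differentiable (fun q => bigop _ _ (fun i => BigBody i GRing.mul _ (@?f i q))) _ =>
      apply: (@dif_prod _ _ _ _ _ _ f) => ?
  end.

Lemma quotient_of_entire_Qx z : quotient_of_entire (fun (_ : C) (x : V) => Qx tau z x).
Proof. by apply: quotient_of_entire_entire; rewrite /Qx; ent. Qed.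

Lemma quotient_of_entire_QxV z : quotient_of_entire (fun (_ : C) (x : V) => (Qx tau z x)^-1).
Proof.
apply: quotient_of_entireV; first by rewrite /Qx; ent.
apply: gen_imp (gen_x tau_gt0 z 0) => l x H; apply: Qx_neq0 => i.
by have := H i; rewrite addr0.
Qed.

Lemma quotient_of_entire_num s i : quotient_of_entire (fun (_ : C) (x : V) => \prod_k theta (- x 0 i - zz k + s k)).
Proof.
by apply: quotient_of_entire_entire; ent.
Qed.

Lemma quotient_of_entire_Dg s i : quotient_of_entire (fun (_ : C) (x : V) => Dg tau zz s i x).
Proof.
apply: quotient_of_entireM (quotient_of_entire_num s i) _; apply: quotient_of_entireV.
  by rewrite /xden; ent.
apply: gen_imp (gen_xx tau_gt0 0) => l x H; apply/prodf_neq0 => j ji.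
by have := H (i, j); rewrite addr0 /=; apply; rewrite eq_sym.
Qed.

Lemma quotient_of_entire_lSV : quotient_of_entire (fun (l : C) (x : V) => (theta (l + h + Sx zz t x))^-1).
Proof. by apply: quotient_of_entireV (gen_lS tau_gt0 zz t h); ent. Qed.

Lemma quotient_of_entire_xV z c i : quotient_of_entire (fun (l : C) (x : V) => (theta (z + x 0 i + c))^-1).
Proof.
apply: quotient_of_entireV; first by ent.
by apply: gen_imp (gen_x tau_gt0 z c) => l x.
Qed.

Lemma quotient_of_entire_Ax z : quotient_of_entire (Ax tau zz t z).
Proof.
apply: (quotient_of_entireM (quotient_of_entire_Qx z)); apply: quotient_of_entireM.
  by apply: quotient_of_entire_entire; ent.
apply: quotient_of_entireV; first by ent.
by apply: gen_imp (gen_l tau_gt0 0) => l x; rewrite addr0.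
Qed.

Lemma quotient_of_entire_ec z i : quotient_of_entire (ec tau h zz t z i).
Proof.
apply: quotient_of_entireM.
  apply: quotient_of_entireN; apply: quotient_of_entireM; first by apply: quotient_of_entire_entire; ent.
  by have := quotient_of_entire_xV z 0 i; under eq_fun do under eq_fun do rewrite addr0.
by apply: quotient_of_entireM quotient_of_entire_lSV; exact: (quotient_of_entire_Dg (fun k => - t k)).
Qed.

Lemma quotient_of_entire_fc z i : quotient_of_entire (fc tau h zz t z i).
Proof.
apply: quotient_of_entireM.
  apply: quotient_of_entireN; apply: quotient_of_entireM; last exact: quotient_of_entire_xV.
  by apply: quotient_of_entire_entire; ent.
by apply: quotient_of_entireM quotient_of_entire_lSV; exact: quotient_of_entire_Dg.
Qed.

Lemma quotient_of_entire_Kc z : quotient_of_entire (Kc tau h zz t z).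
Proof.
apply: quotient_of_entireM; first by apply: quotient_of_entireM (quotient_of_entire_cst _) (quotient_of_entire_QxV _).
by apply: quotient_of_entireM quotient_of_entire_lSV; apply: quotient_of_entire_entire; ent.
Qed.

Definition opD z (f : M) : M := fun l x => opF z (opA z (opE z f)) l x + opK z f l x.
Definition opL z (i j : bool) : M -> M :=
  if i then if j then fun f => opA z f else fun f => opA z (opE z f)
  else if j then fun f => opF z (opA z f) else opD z.

Lemma homogeneous_op_A z : homogeneous_op (- h) 0 (opA z). Proof. exact: homogeneous_op_Lop (quotient_of_entire_Ax z). Qed.
Lemma homogeneous_op_K z : homogeneous_op h 0 (opK z). Proof. exact: homogeneous_op_Lop (quotient_of_entire_Kc z). Qed.
Lemma homogeneous_op_E z : homogeneous_op (2 * h) (- h) (opE z).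
Proof. exact: homogeneous_op_Sop (quotient_of_entire_ec z). Qed.
Lemma homogeneous_op_F z : homogeneous_op 0 h (opF z). Proof. exact: homogeneous_op_Sop (quotient_of_entire_fc z). Qed.

Lemma homogeneous_op_opL z i j : homogeneous_op (if j then - h else h)
  (if i then if j then 0 else - h else if j then h else 0) (opL z i j).
Proof.
have hAE : homogeneous_op h (- h) (fun f => opA z (opE z f)).
  have := homogeneous_op_comp (homogeneous_op_A z) (homogeneous_op_E z).
  by rewrite add0r (_ : - h + 2 * h = h); last by ring.
case: i j => [] [] //=.
- exact: homogeneous_op_A.
- by have := homogeneous_op_comp (homogeneous_op_F z) (homogeneous_op_A z); rewrite add0r addr0.
- apply: homogeneous_opD (homogeneous_op_K z).
  by have := homogeneous_op_comp (homogeneous_op_F z) hAE; rewrite add0r addrN.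
Qed.

Lemma piL z i j f : \pi_(QM R n) (opL z i j f) =
  (if i then if j then L(opA z) (\pi_(QM R n) f) else L(opA z) (L(opE z) (\pi_(QM R n) f))
   else if j then L(opF z) (L(opA z) (\pi_(QM R n) f)) else
   L(opF z) (L(opA z) (L(opE z) (\pi_(QM R n) f))) + L(opK z) (\pi_(QM R n) f)).
Proof. by case: i j => [] []; rewrite /= ?liftM_pi // -piMD. Qed.

Ltac feed H := match type of H with ?P -> _ =>
  let hp := fresh in assert (hp : P); [|specialize (H hp); clear hp] end.

(** The components of the RLL relation, evaluated at points of a dense open set. *)
Lemma opL_rll z w (i j p q : bool) (f : M) : theta (z - w - h) != 0 ->
  let a := al tau h (z - w) in let b := be tau h (z - w) in
  gen (fun l x =>
  (let X k m := opL z k p (opL w m q f) l x in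
   if i then if j then X true true
     else a (l + sx x) * X true false + b (l + sx x) * X false true
   else if j then a (- (l + sx x)) * X false true + b (- (l + sx x)) * X true false
     else X false false) =
  (let Y k m := opL w j m (opL z i k f) l x in
   if p then if q then Y true true else a l * Y true false + b (- l) * Y false true
   else if q then a (- l) * Y false true + b l * Y true false else Y false false)).
Proof.
move=> u0 a b.
have := @rll_components (QM R n) (L(opA z)) (L(opA w)) (L(opE z)) (L(opE w))
  (L(opF z)) (L(opF w)) (L(opK z)) (L(opK w)) (L(opG tau h zz t z w)) (L(opG tau h zz t w z))
  (L(opY tau h zz t z w)) (L(opY tau h zz t w z)) (L(opX tau h zz t z w)) (L(opX tau h zz t w z))
  (L(@opS R n a)) (L(@opS R n (fun l => a (- l)))) (L(@opS R n b)) (L(@opS R n (fun l => b (- l))))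
  (L(@opS R n (fun l => a (l + h)))) (L(@opS R n (fun l => a (- (l + h)))))
  (L(@opS R n (fun l => b (l + h)))) (L(@opS R n (fun l => b (- (l + h)))))
  (L(opH zz a)) (L(opH zz (fun l => a (- l)))) (L(opH zz b)) (L(opH zz (fun l => b (- l))))
  (L(opAi w)).
move=> H.
feed H; first by move=> v; exact: opAK.
feed H; first by move=> v; exact: opAiK.
feed H; first by move=> v; exact: rel_AA.
feed H; first by move=> v; exact: rel_KK.
feed H; first by move=> v; exact: rel_AEAE.
feed H; first by move=> v; exact: rel_FAFA.
feed H; first by move=> v; exact: rel_AE.
feed H; first by move=> v; exact: rel_AEA.
feed H; first by move=> v; exact: rel_AFA.
feed H; first by move=> v; exact: rel_FAA.
feed H; first by move=> v; exact: rel_HAK.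
feed H; first by move=> v; exact: rel_EF_commutator.
feed H; first by move=> v; exact: rel_EF_commutator.
feed H; first by move=> v; exact: rel_G1.
feed H; first by move=> v; exact: rel_G2.
feed H; first by move=> v; exact: rel_G3.
feed H; first by move=> v; exact: rel_Y1.
feed H; first by move=> v; exact: rel_Y2.
feed H; first by move=> v; exact: rel_Y2.
feed H; first by move=> v; exact: rel_Y3.
feed H; first by move=> v; exact: rel_X1.
feed H; first by move=> v; exact: rel_X2.
feed H; first by move=> v; exact: rel_X2.
feed H; first by move=> v; exact: rel_X3.
feed H; first by move=> v; exact: opSA.
feed H; first by move=> v; exact: opSA.
feed H; first by move=> v; exact: opSA.
feed H; first by move=> v; exact: opSA.
feed H; first by move=> v; exact: opSKA.
feed H; first by move=> v; exact: opSKA.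
feed H; first by move=> v; exact: opSAK.
feed H; first by move=> v; exact: opSAK.
feed H; first by move=> v; exact: opSF.
feed H; first by move=> v; exact: opSF.
feed H; first by move=> v; exact: opSF.
feed H; first by move=> v; exact: opSF.
feed H; first by move=> v; exact: opSF.
feed H; first by move=> v; exact: opSF.
feed H; first by move=> v; exact: opSF.
feed H; first by move=> v; exact: opSF.
feed H; first by move=> v; exact: opSG.
feed H; first by move=> v; exact: opSG.
feed H; first by move=> v; exact: opSX.
feed H; first by move=> v; exact: opSX.
move: (H i j p q (\pi_(QM R n) f)) => {H}.
have eT x y z' g : Tz (L(opA z')) (L(opE z')) (L(opF z')) (L(opK z')) x y (\pi_(QM R n) g)
  = \pi_(QM R n) (opL z' x y g) by rewrite piL.
have eT' x y z' g : Tw (L(opA z')) (L(opE z')) (L(opF z')) (L(opK z')) x y (\pi_(QM R n) g)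
  = \pi_(QM R n) (opL z' x y g) by rewrite piL.
have eL P g : (L P : {additive QM R n -> QM R n}) (\pi_(QM R n) g) = \pi_(QM R n) (P g).
  exact: liftM_pi.
case: i j p q => [] [] [] []; cbv iota beta zeta; rewrite ?eT ?eT' ?eT ?eL -?piMD => e;
  by have := proj1 (piM_eq _ _) e; apply: gen_imp => l x; rewrite ?addME ?opHE ?opSE ?addr0.
Qed.

Lemma qdet_opD z f : L(opA (z + h)) (\pi_(QM R n) (opD z f)) =
  L(opF (z + h)) (L(opA (z + h)) (L(opA z) (L(opE z) (\pi_(QM R n) f)))) +
  \pi_(QM R n) (fun l x => qdet tau h zz t z l x * f l x).
Proof.
have -> : \pi_(QM R n) (opD z f) = \pi_(QM R n) (opL z false false f) by [].
rewrite piL (raddfD (L(opA (z + h)))) /= rel_AFA_shifted // rel_AK_qdet //; congr (_ + _).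
by rewrite liftM_pi; apply/piM_eq/genT => l x; rewrite opQE addr0.
Qed.

End LOperator.

Section Relations.
Context {R : realType} (tau eta : Cplx R) (tau_gt0 : 0 < complex.Im tau) (eta0 : eta != 0).
Context {n : nat} (zz : 'I_n -> Cplx R) (La : 'I_n -> nat).
Local Notation C := (Cplx R).
Local Notation V := ('rV[C]_n).
Local Notation M := (Mfun R n).
Local Notation theta := (th tau).
Local Notation h := (2 * eta).
Let t (i : 'I_n) : C := (La i)%:R * eta.
Local Notation opA := (opA tau h zz t).
Local Notation opAi := (opAi tau h zz t).
Local Notation opE := (opE tau h zz t).
Local Notation opF := (opF tau h zz t).
Local Notation opK := (opK tau h zz t).
Local Notation opD := (opD tau h zz t).
Local Notation opL := (opL tau h zz t).
Local Open Scope quotient_scope.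
Local Notation "'L' P" := (@liftM R n P) (at level 9, P at level 8).
Local Notation piQ f := (\pi_(QM R n) f).

Lemma op_aE z (f : M) : op_a tau eta zz La z f = opA z f.
Proof. by rewrite /op_a -thE. Qed.

Lemma prod_div (i : 'I_n) (F G : 'I_n -> C) :
  \prod_(j | j != i) (F j / G j) = (\prod_(j | j != i) F j) / (\prod_(j | j != i) G j).
Proof. by rewrite big_split /= prodfV. Qed.

Lemma op_bE z (f : M) : piQ (op_b tau eta zz La z f) = L(opA z) (L(opE z) (piQ f)).
Proof.
rewrite !liftM_pi; apply/piM_eq.
apply: gen_imp (generic_gen tau_gt0 h zz t z z) => l x g.
rewrite !opE_def mulr_sumr /op_b -sumrN; apply: eq_bigr => i _.
rewrite /Tx /Tl -/(dl i (- h)) prod_div /Delta_plus -thE.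
rewrite (_ : l - h + 2 * h = l + h); last by ring.
by rewrite [RHS]mulrA (AE_coef i g) mulNr.
Qed.

Lemma op_cE z (f : M) : piQ (op_c tau eta zz La z f) = L(opF z) (L(opA z) (piQ f)).
Proof.
rewrite !liftM_pi; apply/piM_eq.
apply: gen_imp (generic_gen tau_gt0 h zz t z z) => l x g.
rewrite !opE_def /op_c -sumrN; apply: eq_bigr => i _.
rewrite !opE_def /Tx /Tl -/(dl i h) prod_div /Delta_minus -thE addr0.
by rewrite [RHS]mulrA (FA_coef i g) mulNr.
Qed.

Lemma hW_sx (x : V) (l : C) : l - 2 * eta * hW eta zz x = l + sx zz x.
Proof.
rewrite /hW /sx -/(ssum zz x); congr (l + _).
by rewrite mulNr mulrN opprK mulrA mulfK.
Qed.

Lemma hW_shift (x v : V) (q : C) : \sum_i v 0 i = q ->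
  hW eta zz (x + v) = hW eta zz x - eta^-1 * q.
Proof.
move=> <-; rewrite /hW /ssum.
have -> : \sum_i ((x + v) 0 i + zz i) = \sum_i (x 0 i + zz i) + \sum_i v 0 i.
  by rewrite -big_split; apply: eq_bigr => i _; rewrite mxE addrAC.
by rewrite mulrDr !mulNr.
Qed.

(** The operator a(z + h) is injective on [QM], and the canonical d(z) is one solution. *)
Lemma determinantE z (f g : M) :
  mero_eqM
    (fun l x => op_a tau eta zz La (z + h) g l x - op_c tau eta zz La (z + h) (op_b tau eta zz La z f) l x)
    (fun l x => Defs.theta tau (l - h * hW eta zz x) / Defs.theta tau l
       * \prod_i (Defs.theta tau (z - zz i - (La i)%:R * eta) *
                  Defs.theta tau (z - zz i + (La i)%:R * eta + h)) * f l x)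
  <-> piQ g = piQ (opD z f).
Proof.
rewrite gen_eqM -(piM_eq (fun l x => _ - _) (fun l x => _ * _ * _)).
have -> : (fun l x => op_a tau eta zz La (z + h) g l x - op_c tau eta zz La (z + h) (op_b tau eta zz La z f) l x)
  = (opA (z + h) g - op_c tau eta zz La (z + h) (op_b tau eta zz La z f) : M).
  by rewrite op_aE.
rewrite piMB op_cE op_bE -liftM_pi.
have -> : (fun l x => Defs.theta tau (l - h * hW eta zz x) / Defs.theta tau l
       * \prod_i (Defs.theta tau (z - zz i - (La i)%:R * eta) *
                  Defs.theta tau (z - zz i + (La i)%:R * eta + h)) * f l x) =
   (fun l x => qdet tau h zz t z l x * f l x).
  by apply/funext => l; apply/funext => x; rewrite hW_sx -thE.
have E := qdet_opD tau_gt0 h zz t z f; split=> [e|->].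
  rewrite -[LHS](opAiK tau_gt0 h zz t (z + h)) -[RHS](opAiK tau_gt0 h zz t (z + h)); congr (L _ _).
  by rewrite E -e [RHS]addrCA subrr addr0.
by rewrite E [X in X - _]addrC addrK.
Qed.

Lemma canonical_op_d : is_op_d tau eta zz La opD.
Proof.
split=> [z|z f _]; last exact/determinantE.
exact: (homogeneous_op_difference (homogeneous_op_opL tau_gt0 h zz t z false false)).
Qed.

Lemma op_d_unique d z (f : M) : is_op_d tau eta zz La d -> meroM f -> piQ (d z f) = piQ (opD z f).
Proof. by move=> [_ dd] mf; apply/determinantE; exact: dd. Qed.

(** The entry (i, j) as an operator on functions of x alone: lambda is a parameter, and the
    argument is regarded as independent of lambda. *)
Definition Lx (z : C) (i j : bool) (l : C) (g : Wfun R n) : Wfun R n := opL z i j (fun=> g) l.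
Definition Lop_of (z l : C) (F : @VW R n) : @VW R n := fun i x => \sum_(j : bool) Lx z i j l (F j) x.

(** The entry (i, j) shifts lambda by - 2 eta times the weight of e[j]. *)
Lemma Lx_local z i j (f : M) l x :
  Lx z i j l (f (l - h * wt j)) x = opL z i j f l x.
Proof.
rewrite /Lx (homogeneous_op_local f l x (homogeneous_op_opL tau_gt0 h zz t z i j)); congr (opL z i j (fun=> f _) l x).
by case: j; rewrite /wt ?mulr1 ?mulrN1 ?opprK.
Qed.

Lemma Lx_sum z i j (I : finType) (a : I -> C) (g : I -> Wfun R n) l x :
  Lx z i j l (fun y => \sum_k a k * g k y) x = \sum_k a k * Lx z i j l (g k) x.
Proof. exact: (homogeneous_op_sum _ _ _ _ (homogeneous_op_opL tau_gt0 h zz t z i j)). Qed.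

Lemma Lx_scale z i j (a : C) (g : Wfun R n) l x :
  Lx z i j l (fun y => a * g y) x = a * Lx z i j l g x.
Proof.
have := Lx_sum z i j (fun _ : unit => a) (fun=> g) l x.
rewrite big_const card_unit /= addr0 => <-; congr (Lx _ _ _ _ _ x).
by apply/funext => y; rewrite big_const card_unit /= addr0.
Qed.

Lemma Lop_tens z i m l (g : Wfun R n) x : Lop_of z l (tens m g) i x = Lx z i m l g x.
Proof.
rewrite /Lop_of (bigD1 m) //= [X in _ + X]big1 ?addr0 => [|j jm].
  by rewrite /tens eqxx Lx_scale mul1r.
by rewrite /tens (negPf jm) Lx_scale mul0r.
Qed.

Lemma Ltilde_opL z m f l i x : Ltilde eta (Lop_of z) m f l i x = opL z i m f l x.
Proof. by rewrite /Ltilde Lop_tens Lx_local. Qed.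

Lemma Lop_weight z l (F : @VW R n) i x :
  Lop_of z l (total_h (hW eta zz) F) i x = total_h (hW eta zz) (Lop_of z l F) i x.
Proof.
rewrite /total_h /Lop_of mulr_sumr; apply: eq_bigr => j _.
have H := homogeneous_op_opL tau_gt0 h zz t z i j.
have W := @homogeneous_op_weight _ _ _ _ _ (fun y => @wt R j + hW eta zz y) (@wt R i - @wt R j) (F j) l x H.
rewrite /Lx W {W}; first by congr (_ * _); ring.
move=> y v vq; rewrite (hW_shift _ vq) addrA; congr (_ + _).
have eV : eta^-1 * h = 2 by rewrite mulrCA mulVf // mulr1.
by case: i j {H vq} => [] []; rewrite /wt ?mulr0 ?mulrN ?eV; ring.
Qed.

(** Applying L(z) at lambda and L(w) at lambda - 2 eta h amounts to composing the difference
    operators, by [Lx_local]. *)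
Lemma Lop_of_comp z w k m l (F : @VVW R n) x :
  Lop_of z l (fun p => Lop_of w (l - h * wt p) (F p) m) k x =
  \sum_(p : bool) \sum_(q : bool) opL z k p (opL w m q (fun=> F p q)) l x.
Proof.
apply: eq_bigr => p _.
have := Lx_sum z k p (fun _ : bool => 1) (fun q => Lx w m q (l - h * wt p) (F p q)) l x.
rewrite [RHS](eq_bigr (fun q => opL z k p (opL w m q (fun=> F p q)) l x)) => [<-|q _].
  congr (Lx _ _ _ _ _ x); apply/funext => y; apply: eq_bigr => q _; by rewrite mul1r.
by rewrite mul1r -(Lx_local z k p (opL w m q (fun=> F p q))).
Qed.

Lemma opL_comp_linear z w i j k m (a b : C) (g g' : Wfun R n) l x :
  opL z i j (opL w k m (fun=> (fun y => a * g y + b * g' y))) l x =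
  a * opL z i j (opL w k m (fun=> g)) l x + b * opL z i j (opL w k m (fun=> g')) l x.
Proof.
have H := homogeneous_op_comp (homogeneous_op_opL tau_gt0 h zz t z i j) (homogeneous_op_opL tau_gt0 h zz t w k m).
have := homogeneous_op_sum (fun c : bool => if c then a else b) (fun c => if c then g else g') l x H.
rewrite big_bool /= => <-; congr (opL _ _ _ (opL _ _ _ (fun=> _)) l x).
by apply/funext => l'; apply/funext => y; rewrite big_bool.
Qed.

Lemma RmatE u l (U : bool -> bool -> C) : let a := al tau h u in let b := be tau h u in
  Rmat tau eta u l U = fun p q =>
  if p then if q then U true true else a l * U true false + b l * U false true
  else if q then a (- l) * U false true + b (- l) * U true false else U false false.
Proof.
apply/funext => p; apply/funext => q; rewrite /Rmat /EE /alpha /beta -thE.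
by case: p q => [] [] /=; rewrite !(mulr1n, mulr0n, mul1r, mul0r, mulr0, addr0, add0r).
Qed.

Lemma obeys_canonical d : is_op_d tau eta zz La d ->
  obeys_relations tau eta (hW eta zz)
    (op_a tau eta zz La) (op_b tau eta zz La) (op_c tau eta zz La) d.
Proof.
move=> hd; exists Lop_of; split.
- move=> z; exists (Lx z); split=> // i j.
  exact: (homogeneous_op_x_difference (homogeneous_op_opL tau_gt0 h zz t z i j)).
- move=> z f mf.
  have E i m g : piQ (opL z i m f) = piQ g -> mero_eqM (fun l => Ltilde eta (Lop_of z) m f l i) g.
    move=> /piM_eq e; apply/gen_eqM; apply: gen_imp e => l x <-; exact: Ltilde_opL.
  split; apply: E.
  + by rewrite op_aE.
  + by rewrite op_cE piL.
  + by rewrite op_bE piL.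
  + by rewrite (op_d_unique z hd mf).
- move=> z F _ i; apply/gen_eqM/genT => l x; exact: Lop_weight.
- move=> z w u0 F _ i j; apply/gen_eqM.
  rewrite -thE in u0.
  have H p q := opL_rll tau_gt0 zz t i j p q (fun=> F p q) u0.
  have := gen_and (gen_and (H true true) (H true false)) (gen_and (H false true) (H false false)).
  apply: gen_imp => l x {H} [[e1 e2] [e3 e4]].
  rewrite /R12 RmatE hW_sx /L13 /L23.
  rewrite (Lop_of_comp w z j i l (fun m k => fun y => Rmat tau eta (z - w) l (fun k m => F k m y) k m) x).
  have bb (U : bool -> C) : \sum_(k : bool) U k = U true + U false by rewrite big_bool.
  rewrite !Lop_of_comp !bb.
  (* The matrix R(z - w, lambda) acts before the two operators, with lambda frozen. *)
  have eG k m : (fun y => Rmat tau eta (z - w) l (fun k m => F k m y) k m) =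
    (fun y => if k then if m then F true true y else al tau h (z - w) l * F true false y + be tau h (z - w) l * F false true y
      else if m then al tau h (z - w) (- l) * F false true y + be tau h (z - w) (- l) * F true false y else F false false y).
    by apply/funext => y; rewrite RmatE.
  rewrite !eG !opL_comp_linear.
  have E := congr2 +%R (congr2 +%R e1 e2) (congr2 +%R e3 e4).
  move: E {e1 e2 e3 e4 eG}; cbv beta zeta => E.
  by apply: etrans (etrans _ E) _; case: i j {E} => [] []; cbv iota; ring.
Qed.

End Relations.

Theorem theorem3p1 (R : realType) (tau eta : Cplx R)
    (tau_gt0 : 0 < complex.Im tau) (eta_neq0 : eta != 0)
    (n : nat) (zz : 'I_n -> Cplx R) (zz_inj : injective zz) (La : 'I_n -> nat) :
  (exists d : Cplx R -> Mfun R n -> Mfun R n, is_op_d tau eta zz La d) /\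
  (forall d : Cplx R -> Mfun R n -> Mfun R n, is_op_d tau eta zz La d ->
     obeys_relations tau eta (hW eta zz)
       (op_a tau eta zz La) (op_b tau eta zz La) (op_c tau eta zz La) d).
Proof.
split; first by eexists; exact: (canonical_op_d tau_gt0 eta_neq0).
exact: (obeys_canonical tau_gt0 eta_neq0).
Qed.
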